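(* Let $f(x) \in \mathbf{Z}[x]$ be a nonzero polynomial. Write $f(x) = c\, g(x)^2 h(x)$ where $c \in \mathbf{Z}$, $g(x) \in \mathbf{Z}[x]$, and $h(x)$ is a squarefree polynomial in $\mathbf{Z}[x]$ whose coefficients have gcd $1$. If $\deg h>3$, assume the $abc$ conjecture. Then the image of $\{f(1),f(2),\dots,f(B)\}$ in $(\mathbf{Q}^*/\mathbf{Q}^{*2}) \cup \{0\}$ has size $c_f B + o(B)$ as $B\to\infty$, for some constant $c_f \in [0,1]$. Moreover: if $\deg h=0$ then $c_f=0$; if $\deg h\ge 2$ then $c_f=1$; and if $\deg h=1$, say $h(x)=ax+b$, then $$c_f = \frac{6}{\pi^2} \left( \sum_{r=0}^{|a|-1} \delta_r \right) \prod_{p \mid a} (1-p^{-2})^{-1} \in \frac{1}{\pi^2} \mathbf{Q},$$ where the product is over primes $p$ dividing $a$, and $\delta_r :=1/m^2$ if $m$ is the smallest positive integer satisfying $m^2 r \equiv b \pmod{a}$, while $\delta_r:=0$ if no such $m$ exists.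
   Context: The image in $(\mathbf{Q}^*/\mathbf{Q}^{*2})\cup\{0\}$ means: $0$ maps to $0$, and a nonzero integer maps to its class modulo nonzero rational squares. The $abc$ conjecture: for every $\epsilon>0$ there is $C(\epsilon)>0$ such that if $a,b,c$ are coprime positive integers with $a+b=c$ then $c<C(\epsilon)(\prod_{p\mid abc}p)^{1+\epsilon}$. *)

(* Defs.v *)
From HB Require Import structures.
From mathcomp Require Import all_boot all_order all_algebra.
From mathcomp Require Import finmap.
From mathcomp Require Import all_classical all_reals all_analysis.
Set Implicit Arguments.
Unset Strict Implicit.
Unset Printing Implicit Defensive.
Import Order.TTheory GRing.Theory Num.Theory.
Import numFieldNormedType.Exports.
Local Open Scope classical_set_scope.
Local Open Scope ring_scope.

Notation Qstar := {x : rat | x != 0}.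

Definition eq_mod_squares (x y : Qstar) : bool :=
  `[< exists q : Qstar, \val x = \val q ^+ 2 * \val y >].

Lemma eq_mod_squares_refl : reflexive eq_mod_squares.
Proof.
move=> x; apply/asboolP; exists (exist _ 1 (oner_neq0 rat)).
by rewrite /= expr1n mul1r.
Qed.

Lemma eq_mod_squares_sym : symmetric eq_mod_squares.
Proof.
suff H x y : eq_mod_squares x y -> eq_mod_squares y x.
  by move=> x y; apply/idP/idP; exact: H.
move=> /asboolP[[q q0] /= xy]; apply/asboolP.
have qV0 : q^-1 != 0 by rewrite invr_eq0.
by exists (exist _ q^-1 qV0); rewrite /= xy exprVn mulKf// expf_neq0.
Qed.

Lemma eq_mod_squares_trans : transitive eq_mod_squares.
Proof.
move=> y x z /asboolP[[q q0] /= xy] /asboolP[[s s0] /= yz]; apply/asboolP.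
by exists (exist _ (q * s) (mulf_neq0 q0 s0)); rewrite /= xy yz exprMn mulrA.
Qed.

Canonical eq_mod_squares_equiv :=
  EquivRel eq_mod_squares eq_mod_squares_refl eq_mod_squares_sym
    eq_mod_squares_trans.

Notation Qstar_mod_squares := {eq_quot eq_mod_squares}%qT.

(* [option] adjoins the element 0, represented by [None]; [insub] fails
   exactly on the rational 0. *)
Definition square_class (n : int) : option Qstar_mod_squares :=
  omap (\pi_(Qstar_mod_squares))%qT (insub (n%:~R : rat) : option Qstar).

Definition image_size (f : {poly int}) (B : nat) : nat :=
  #|` [fset square_class f.[n%:Z] | n in iota 1 B]%fset |.

Definition squarefree_poly (h : {poly int}) : Prop :=
  forall d q : {poly int}, h = q * d ^+ 2 -> d \is a GRing.unit.

Definition abc_conjecture (R : realType) : Prop :=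
  forall eps : R, 0 < eps ->
  exists C : R, 0 < C /\
    forall a b c : nat, (0 < a)%N -> (0 < b)%N -> (0 < c)%N ->
      gcdn a (gcdn b c) = 1%N -> (a + b = c)%N ->
      c%:R < C * (\prod_(p <- primes (a * b * c)) p%:R) `^ (1 + eps).

Definition delta_cond (a b : int) (r m : nat) : bool :=
  (0 < m)%N && (m%:Z ^+ 2 * r%:Z == b %[mod a])%Z.

Definition delta (R : realType) (a b : int) (r : nat) : R :=
  if pselect (exists m, delta_cond a b r m) is left ex
  then 1 / (ex_minn ex)%:R ^+ 2 else 0.

(* Main.v *)
(* The class of [f n] is that of [c * h n], so one counts the square classes of the values of [h].

   Degree at least 2.  If [h m] and [h n] have the same class then [u ^ 2 * h n = v ^ 2 * h m], where [u] and [v] are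
   bounded as soon as the square factors of [h m] and [h n] are.  For fixed [u <> v] such an [m] is [alpha * n + beta + O(1 / n)],
   which is rarely an integer; so it is enough to show that [h n] rarely has a large square factor.  Prime powers are
   handled by Hensel lifting, and [p ^ 2] with [p] up to [B] by counting roots modulo [p ^ 2].  For [p] of order at least
   [B]: in degree 2, [h n = q * p ^ 2] with [q] bounded is a sparse Pell-type equation.  In degree 3 (Hooley),
   [h n = q * y ^ 2] with [q] much smaller than [n]; there are [O(Q)] roots [nu] modulo [q <= Q] (short lattice vectors
   and norms from the cubic field), and for each the values of [t] with [h (nu + q * t) / q] a square are sieved by small
   primes, modulo which a cubic takes square values at most 15 times out of 16.  In degree at least 4, a Belyi map and
   the [abc] conjecture give [rad (F n) >> n ^ (deg F - 1 - epsilon)] for squarefree [F], and [F = h(X) * h(X + j)] shows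
   that exceptional [n] cannot be at moderate distance.

   Degree 1.  The classes correspond to the squarefree [q] having a multiple [m ^ 2 * q = a * n + b], [n <= B]; only the
   least [m] matters, and it depends on [q] modulo [a].  Squarefree numbers have a density in each reduced residue class,
   because writing [n = s ^ 2 * q] yields a recursion with contraction factor [zeta 2 - 1 < 1]; the fixed point is expressed
   by [zeta 2 = pi ^ 2 / 6]. *)

Require Import Defs.
From mathcomp Require Import all_boot all_order all_algebra.
From mathcomp Require Import finmap all_field.
From mathcomp Require Import all_classical all_reals all_analysis.
From mathcomp Require Import zify ring lra.
From mathcomp Require polyorder.
Import Order.TTheory GRing.Theory Num.Theory.
Import numFieldNormedType.Exports.
Set Implicit Arguments.
Unset Strict Implicit.
Unset Printing Implicit Defensive.

(** * Counting functions *)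

Local Open Scope nat_scope.

(** The size of [p] is what shapes the proof. Among [n <= B], counting roots modulo [p ^ 2] leaves
    up to [B / p ^ 2 + 1] solutions per root. The quotients add up to a small multiple of [B], but
    the terms 1 cost one unit per prime. This is affordable for [p <= B / M], and for [p = O(B)]
    because primes have density zero, but no further, whereas [p] can be of order [B ^ (d / 2)] for
    [h] of degree [d]. Beyond that point the method depends on the degree. As this range moves with
    [B], exceptional sets are families of predicates indexed by the cut-off. Densities are written
    over the naturals as [k * cnt <= B], with [k] kept as a parameter: the bound [M] on the square
    factors depends on the proportion [1 / k] of integers that may be lost, and collisions are then
    excluded for finitely many pairs [u, v <= M]. *)

Definition cnt (P : pred nat) (B : nat) : nat := count P (iota 1 B).

Lemma cnt_le (P Q : pred nat) B :
  (forall n, 0 < n <= B -> P n -> Q n) -> cnt P B <= cnt Q B.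
Proof.
move=> PQ; rewrite /cnt -!sum1_count big_mkcond [leqRHS]big_mkcond /=.
rewrite big_seq [leqRHS]big_seq; apply: leq_sum => n.
rewrite mem_iota add1n ltnS => nB.
by case: ifP => // /PQ ->.
Qed.

Lemma cnt_leU (P Q S : pred nat) B :
  (forall n, 0 < n <= B -> P n -> Q n || S n) -> cnt P B <= cnt Q B + cnt S B.
Proof.
move=> PQ; rewrite /cnt -count_predUI; apply: leq_trans (leq_addr _ _).
exact: cnt_le.
Qed.

Lemma cnt_bigU (I : eqType) (s : seq I) (P : pred nat) (Q : I -> pred nat) B :
  (forall n, 0 < n <= B -> P n -> exists2 i, i \in s & Q i n) ->
  cnt P B <= \sum_(i <- s) cnt (Q i) B.
Proof.
elim: s P => [|i s IH] P PQ.
  rewrite big_nil (leq_trans (@cnt_le _ pred0 _ _)) ?/cnt ?count_pred0//.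
  by move=> n nB /(PQ _ nB) [].
rewrite big_cons (leq_trans (@cnt_leU _ (Q i) (fun n => P n && ~~ Q i n) _ _))//.
  by move=> n nB ->; case: (Q i n).
rewrite leq_add2l; apply: IH => n nB /andP[/(PQ _ nB)[j]].
rewrite inE => /orP[/eqP -> -> //|js Qj _]; by exists j.
Qed.

Lemma cnt_leB P B : cnt P B <= B.
Proof. by rewrite /cnt (leq_trans (count_size _ _))// size_iota. Qed.

Lemma cnt_fin (P : pred nat) B N : (forall n, 0 < n <= B -> P n -> n <= N) -> cnt P B <= N.
Proof.
move=> PN; case: (leqP B N) => [BN|/ltnW NB].
  exact: leq_trans (cnt_leB _ _) BN.
rewrite -(subnKC NB) /cnt iotaD count_cat.
rewrite -[leqRHS]addn0 leq_add//; first exact: cnt_leB.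
rewrite leqn0 -leqn0 leqNgt -has_count; apply/hasPn => n.
rewrite mem_iota add1n => /andP[Nn nB]; apply/negP => /PN; lia.
Qed.

Lemma cntE P B : cnt P B = size [seq n <- iota 1 B | P n].
Proof. by rewrite size_filter. Qed.

Lemma cnt_inj (P Q : pred nat) (f : nat -> nat) B B' :
  {in [pred n | (0 < n <= B) && P n] &, injective f} ->
  (forall n, 0 < n <= B -> P n -> (0 < f n <= B') && Q (f n)) ->
  cnt P B <= cnt Q B'.
Proof.
move=> finj fPQ; rewrite !cntE -(size_map f).
have PB n : n \in [seq n <- iota 1 B | P n] -> (0 < n <= B) && P n.
  by rewrite mem_filter mem_iota add1n ltnS andbC.
apply: uniq_leq_size.
  rewrite map_inj_in_uniq ?filter_uniq ?iota_uniq// => x y /PB xP /PB yP.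
  exact: finj.
move=> _ /mapP[n /PB /andP[nB Pn] ->].
by have /andP[? ?] := fPQ _ nB Pn; rewrite mem_filter mem_iota add1n ltnS andbC; apply/andP.
Qed.

Lemma count_periodic (P : pred nat) M a :
  (forall n, P (n + M) = P n) -> count P (iota a M) = count P (iota 0 M).
Proof.
move=> per; elim: a => // a <-.
case: M per => [//|M] per.
have -> : iota a.+1 M.+1 = iota a.+1 M ++ [:: a + M.+1].
  by rewrite -{1}(addn1 M) iotaD /= addSnnS.
by rewrite count_cat /= addn0 per addnC.
Qed.

Lemma periodicM (P : pred nat) M k n :
  (forall n, P (n + M) = P n) -> P (n + k * M) = P n.
Proof. by move=> per; elim: k => [|k IH]; rewrite ?mul0n ?addn0// mulSn addnCA addnC per. Qed.

Lemma periodic_mod (P : pred nat) M n :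
  (forall n, P (n + M) = P n) -> P (n %% M) = P n.
Proof. by move=> per; rewrite {2}(divn_eq n M) addnC periodicM. Qed.

(** Arrange [[0, m * n)] in [n] rows of length [m]. In the column of [j] the predicate [P] is
    constant, and the entries [j + i * m] run once through the residues modulo [n], since [m] is
    invertible there. *)
Lemma count_crt (P Q : pred nat) m n :
  (forall x, P (x + m) = P x) -> (forall x, Q (x + n) = Q x) -> coprime m n ->
  count (predI P Q) (iota 0 (m * n)) = count P (iota 0 m) * count Q (iota 0 n).
Proof.
move=> Pm Qn co.
case: (posnP n) Qn co => [->|n0] Qn co; first by rewrite muln0 /= muln0.
have -> : iota 0 (m * n) = flatten [seq [seq j + i * m | j <- iota 0 m] | i <- iota 0 n].
  elim: (n) => [|k IH]; first by rewrite muln0.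
  rewrite mulnS addnC iotaD add0n IH -addn1 [iota 0 (k + 1)]iotaD map_cat flatten_cat /= cats0 add0n.
  congr (_ ++ _); rewrite -[in LHS](addn0 (m * k)) iotaDl.
  by apply: eq_map => j; rewrite addnC mulnC.
rewrite count_flatten -map_comp sumnE big_map.
transitivity (\sum_(i <- iota 0 n) \sum_(j <- iota 0 m) P j * Q (j + i * m)).
  apply: eq_bigr => i _ /=; rewrite count_map -sum1_count big_mkcond /=.
  apply: eq_bigr => j _ /=; rewrite /preim /= periodicM//.
  by case: (P j); case: (Q _).
rewrite exchange_big /=.
transitivity (\sum_(j <- iota 0 m) P j * count Q (iota 0 n)).
  apply: eq_bigr => j _; rewrite -big_distrr /=; congr (_ * _).
  transitivity (\sum_(x <- [seq (j + i * m) %% n | i <- iota 0 n]) Q x).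
    by rewrite big_map; apply: eq_bigr => i _; rewrite periodic_mod.
  rewrite -[RHS]sum1_count big_mkcond [RHS]big_mkcond /=.
  rewrite (eq_bigr (fun x => if Q x then 1 else 0)); last by move=> x _; case: (Q x).
  apply: perm_big.
  have sub : {subset [seq (j + i * m) %% n | i <- iota 0 n] <= iota 0 n}.
    by move=> _ /mapP[i _ ->]; rewrite mem_iota add0n /= ltn_pmod.
  have un : uniq [seq (j + i * m) %% n | i <- iota 0 n].
    rewrite map_inj_in_uniq ?iota_uniq// => u v.
    rewrite !mem_iota !add0n /= => un vn /eqP.
    rewrite eqn_modDl; wlog xy : u v un vn / u <= v.
      by move=> W; case: (leqP u v) => [|/ltnW] le E; [|symmetry]; apply: W => //; rewrite eq_sym.
    rewrite eq_sym eqn_mod_dvd ?leq_mul2r ?xy ?orbT// -mulnBl Gauss_dvdl; last by rewrite coprime_sym.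
    move=> /dvdn_leq H; case: (ltnP 0 (v - u)) => [/H|]; lia.
  have /(uniq_min_size un sub) [_ E] : size (iota 0 n) <= size [seq (j + i * m) %% n | i <- iota 0 n].
    by rewrite size_map.
  by apply: uniq_perm; rewrite ?iota_uniq//.
rewrite -big_distrl /=; congr (_ * _).
by rewrite -sum1_count [RHS]big_mkcond /=; apply: eq_bigr => x _; case: (P x).
Qed.

(** The periodicity of the conjunction belongs to the conclusion because the induction applies
    [count_crt] to it. *)
Lemma count_crt_seq (s : seq nat) (m : nat -> nat) (P : nat -> pred nat) :
  pairwise coprime (map m s) ->
  {in s, forall p x, P p (x + m p) = P p x} ->
  let A := fun x => all (P^~ x) s in
  count A (iota 0 (\prod_(p <- s) m p)) = \prod_(p <- s) count (P p) (iota 0 (m p))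
  /\ (forall x, A (x + \prod_(p <- s) m p) = A x).
Proof.
elim: s => [|p s IH] /=; first by rewrite !big_nil.
move=> /andP[mco co] per.
have [|cA pA] := IH co; first by move=> q qs; apply: per; rewrite inE qs orbT.
have Pm := per p (mem_head _ _).
rewrite !big_cons /=; split; last first.
  move=> x; congr (_ && _); first by rewrite mulnC periodicM.
  by rewrite (periodicM _ _ pA).
rewrite -cA; apply: count_crt => //.
rewrite big_seq; apply: (big_ind (coprime (m p))); first exact: coprimen1.
  by move=> x y; rewrite coprimeMr => -> ->.
move=> q qs; apply: (allP mco); exact: map_f.
Qed.

Lemma cnt_periodic_le (P : pred nat) M a T :
  0 < M -> (forall n, P (n + M) = P n) ->
  count P (iota a T) <= (T %/ M).+1 * count P (iota 0 M).
Proof.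
move=> M0 per; have : T <= (T %/ M).+1 * M by rewrite {1}(divn_eq T M) mulSn addnC leq_add2r ltnW// ltn_pmod.
move: (T %/ M).+1 => k Tk.
apply: (@leq_trans (count P (iota a (k * M)))).
  by rewrite -(subnKC Tk) iotaD count_cat leq_addr.
elim: k a {Tk} => [|k IH] a; first by rewrite mul0n.
by rewrite mulSn iotaD count_cat mulSn count_periodic// leq_add2l IH.
Qed.

Lemma cnt_periodic_ge (P : pred nat) M a T :
  0 < M -> (forall n, P (n + M) = P n) ->
  (T %/ M) * count P (iota 0 M) <= count P (iota a T).
Proof.
move=> M0 per; have : (T %/ M) * M <= T by exact: leq_divM.
move: (T %/ M) => k Tk.
apply: (@leq_trans (count P (iota a (k * M)))); last first.
  by rewrite -(subnKC Tk) iotaD count_cat leq_addr.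
elim: k a {Tk} => [|k IH] a; first by rewrite mul0n.
by rewrite mulSn mulSn iotaD count_cat count_periodic// leq_add2l IH.
Qed.

(** * Sets of density zero *)

(* The predicate may depend on the cut-off [B]. *)
Definition small (k : nat) (P : nat -> pred nat) : Prop :=
  exists B0, forall B, B0 <= B -> k * cnt (P B) B <= B.

Definition thin (P : nat -> pred nat) : Prop := forall k, small k P.

Lemma small_sub k N0 (P Q : nat -> pred nat) :
  (forall B n, N0 <= B -> 0 < n <= B -> P B n -> Q B n) -> small k Q -> small k P.
Proof.
move=> PQ [B0 QB]; exists (maxn B0 N0) => B; rewrite geq_max => /andP[B0B NB].
apply: leq_trans (QB B B0B); rewrite leq_mul2l cnt_le ?orbT// => n; exact: PQ.
Qed.

Lemma smallU k N0 (P Q S : nat -> pred nat) :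
  (forall B n, N0 <= B -> 0 < n <= B -> P B n -> Q B n || S B n) ->
  small k.*2 Q -> small k.*2 S -> small k P.
Proof.
move=> PQ [B1 QB] [B2 SB]; exists (maxn N0 (maxn B1 B2)) => B.
rewrite !geq_max => /and3P[NB /QB {}QB /SB {}SB].
have := @cnt_leU _ _ _ B (fun n => PQ B n NB).
rewrite -!muln2 in QB SB *; nia.
Qed.

Lemma small0 N0 (P : nat -> pred nat) k :
  (forall B n, N0 <= B -> 0 < n <= B -> ~~ P B n) -> small k P.
Proof.
move=> P0; exists N0 => B NB; suff -> : cnt (P B) B = 0 by rewrite muln0.
apply/eqP; rewrite -leqn0; apply: cnt_fin => n nB Pn.
by have := P0 B n NB nB; rewrite Pn.
Qed.

Lemma thin_sub N0 (P Q : nat -> pred nat) :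
  (forall B n, N0 <= B -> 0 < n <= B -> P B n -> Q B n) -> thin Q -> thin P.
Proof. by move=> PQ tQ k; apply: small_sub PQ (tQ k). Qed.

Lemma thinU N0 (P Q S : nat -> pred nat) :
  (forall B n, N0 <= B -> 0 < n <= B -> P B n -> Q B n || S B n) ->
  thin Q -> thin S -> thin P.
Proof. by move=> PQ tQ tS k; apply: smallU PQ (tQ _) (tS _). Qed.

Lemma thin_fin N (P : nat -> pred nat) :
  (forall B n, 0 < n <= B -> P B n -> n <= N) -> thin P.
Proof.
move=> PN k; exists (k * N) => B kN; apply: leq_trans kN.
by rewrite leq_mul2l cnt_fin ?orbT// => n; exact: PN.
Qed.

Lemma thin_bigU (I : eqType) (s : seq I) N0 (P : nat -> pred nat) (Q : I -> nat -> pred nat) :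
  (forall B n, N0 <= B -> 0 < n <= B -> P B n -> exists2 i, i \in s & Q i B n) ->
  {in s, forall i, thin (Q i)} -> thin P.
Proof.
elim: s P => [|i s IH] P PQ tQ.
  by apply: (@thin_fin N0) => B n nB Pn; rewrite leqNgt; apply/negP => Nn;
    have [] // := PQ B n _ nB Pn; lia.
apply: (@thinU N0 _ (Q i) (fun B n => P B n && ~~ Q i B n)).
- by move=> B n _ _ ->; case: (Q i B n).
- exact: tQ (mem_head _ _).
apply: IH => [B n NB nB /andP[/(PQ _ _ NB nB)[j]]|j js].
  by rewrite inE => /orP[/eqP -> -> //|js Qj _]; exists j.
by apply: tQ; rewrite inE js orbT.
Qed.

Lemma count_window (P : pred nat) a W (s : nat) : 0 < s ->
  (forall n n', P n -> P n' -> a <= n -> n < n' -> n' < a + W -> n' - n < s) ->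
  count P (iota a W) <= s.
Proof.
move=> s0 gap.
case: (boolP (has P (iota a W))) => [hP|]; last by rewrite has_count -eqn0Ngt => /eqP ->.
set n0 := nth 0 (iota a W) (find P (iota a W)).
have Pn0 : P n0 by exact: nth_find.
have fW : find P (iota a W) < W by rewrite -{2}(size_iota a W) -has_find.
have n0E : n0 = a + find P (iota a W) by rewrite /n0 nth_iota.
rewrite -size_filter -[leqRHS](size_iota n0); apply: uniq_leq_size; first by rewrite filter_uniq ?iota_uniq.
move=> n; rewrite mem_filter !mem_iota => /andP[Pn /andP[an nW]].
have n0n : n0 <= n.
  rewrite leqNgt; apply/negP => nn0; have := @before_find _ 0 P (iota a W) (n - a).
  rewrite nth_iota; last by lia.
  by rewrite subnKC// Pn => H; suff: true = false by []; apply: H; lia.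
case: (ltngtP n0 n) n0n => // [lt _|<- _]; last by lia.
have := gap n0 n Pn0 Pn; lia.
Qed.

Lemma count_windows (P : pred nat) N B W s : 0 < W ->
  (forall a, N < a -> count P (iota a W) <= s) ->
  cnt P B <= N + (B %/ W).+1 * s.
Proof.
move=> W0 win; case: (leqP B N) => [BN|/ltnW NB].
  by rewrite (leq_trans (cnt_leB _ _))// (leq_trans BN)// leq_addr.
rewrite /cnt -{1}(subnKC NB) iotaD count_cat leq_add//; first exact: cnt_leB.
apply: (@leq_trans (((B - N) %/ W).+1 * s)); last by rewrite leq_mul2r ltnS leq_div2r ?leq_subr ?orbT.
have : B - N <= ((B - N) %/ W).+1 * W by rewrite {1}(divn_eq (B - N) W) mulSn addnC leq_add2r ltnW// ltn_pmod.
have : N < 1 + N by [].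
move: (B - N) (((B - N) %/ W).+1) (1 + N) => T k.
elim: k T => [|k IH] T a aN.
  by rewrite mul0n leqn0 => /eqP ->.
case: (leqP T W) => [TW _|/ltnW WT Tk].
  rewrite mulSn (leq_trans _ (leq_addr _ _))// (leq_trans _ (win a aN))//.
  by rewrite -(subnKC TW) iotaD count_cat leq_addr.
rewrite -(subnKC WT) iotaD count_cat mulSn leq_add ?win// IH//; first by lia.
by move: Tk; rewrite mulSn -leq_subLR.
Qed.

(** All members of [P] in a window of length [W] beyond [N] lie within [s] of the first one. A
    window thus contains at most [s] of them and the density is at most [s / W], with [W]
    arbitrary. *)
Lemma thin_gap s (P : nat -> pred nat) : 0 < s ->
  (forall W, exists N, forall B n n', N <= n -> n < n' <= B -> n' < n + W ->
     P B n -> P B n' -> n' - n < s) -> thin P.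
Proof.
move=> s0 gap [|k]; first by exists 0 => B; rewrite mul0n.
have [N NP] := gap (2 * k.+1 * s).
exists (2 * (k.+1 * N + k.+1 * s)) => B BN.
have W0 : 0 < 2 * k.+1 * s by rewrite !muln_gt0 s0.
(* The last window may run past [B], where the hypothesis says nothing. *)
have : cnt (fun n => P B n && (n <= B)) B <= N + (B %/ (2 * k.+1 * s)).+1 * s.
  apply: count_windows => // a Na; apply: count_window => // n n' /andP[Pn nB] /andP[Pn' n'B] an nn' n'a.
  apply: (NP B n n') => //; [exact: leq_trans (ltnW Na) an|by rewrite nn'|].
  by apply: leq_trans n'a _; rewrite leq_add2r.
have : cnt (P B) B <= cnt (fun n => P B n && (n <= B)) B by apply: cnt_le => n /andP[_ ->] ->.
have : (B %/ (2 * k.+1 * s)) * (2 * k.+1 * s) <= B by exact: leq_divM.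
move: (B %/ _) (cnt _ _) (cnt _ _) => x y z; rewrite mulSn; nia.
Qed.

(** * Squarefree parts and square classes *)

(** The condition ranges over all [d], which excludes [q = 0]: every square divides 0. *)
Definition sqfree (q : nat) : Prop := forall d, d ^ 2 %| q -> d = 1.

Lemma sqfree_gt0 q : sqfree q -> 0 < q.
Proof. by move=> sq; rewrite lt0n; apply/eqP => q0; have := sq 0; rewrite q0 dvdn0 => /(_ isT). Qed.

Lemma sqfree_decomp n : 0 < n -> exists q m, [/\ 0 < m, sqfree q & n = q * m ^ 2].
Proof.
move=> n0.
have ex : exists m, (0 < m) && (m ^ 2 %| n) by exists 1; rewrite exp1n dvd1n.
have bd m : (0 < m) && (m ^ 2 %| n) -> m <= n.
  move=> /andP[m0 /(dvdn_leq n0)]; apply: leq_trans; rewrite -mulnn; exact: leq_pmulr.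
case: (ex_maxnP ex bd) => m /andP[m0 /dvdnP[q nE]] mmax.
exists q, m; split => // d /dvdnP[e qE].
have dm : (d * m) ^ 2 %| n by rewrite nE qE expnMn -mulnA dvdn_mull.
have d0 : 0 < d by case: d qE dm => // ; move: n0; rewrite nE => + qE; rewrite qE; lia.
have := mmax (d * m); rewrite muln_gt0 d0 m0 dm => /(_ isT).
by rewrite -{2}(mul1n m) leq_pmul2r// => ?; apply/eqP; rewrite eqn_leq d0 andbT.
Qed.

(** After division of [a] and [b] by their gcd, [a ^ 2] is coprime to [b ^ 2] and so divides [q'],
    which forces [a = 1]; likewise [b = 1]. *)
Lemma sqfree_uniq a b q q' : 0 < a -> 0 < b -> sqfree q -> sqfree q' ->
  a ^ 2 * q = b ^ 2 * q' -> q = q'.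
Proof.
move=> a0 b0 sq sq' E.
have g0 : 0 < gcdn a b by rewrite gcdn_gt0 a0.
have [a' aE] := dvdnP (dvdn_gcdl a b); have [b' bE] := dvdnP (dvdn_gcdr a b).
have co : coprime a' b'.
  have : gcdn (a' * gcdn a b) (b' * gcdn a b) = 1 * gcdn a b by rewrite -aE -bE mul1n.
  by rewrite -muln_gcdl => /eqP; rewrite eqn_pmul2r.
have E' : a' ^ 2 * q = b' ^ 2 * q'.
  apply/eqP; rewrite -(@eqn_pmul2l (gcdn a b ^ 2)) ?expn_gt0 ?g0//.
  have : (a' * gcdn a b) ^ 2 * q = (b' * gcdn a b) ^ 2 * q' by rewrite -aE -bE.
  rewrite -!mulnn; move: (gcdn a b) => g; lia.
have a1 : a' = 1.
  apply: sq'; rewrite -(@Gauss_dvdr _ (b' ^ 2)) ?coprimeXl ?coprimeXr//.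
  by rewrite -E' dvdn_mulr.
have b1 : b' = 1.
  apply: sq; rewrite -(@Gauss_dvdr _ (a' ^ 2)) ?coprimeXl ?coprimeXr// 1?coprime_sym//.
  by rewrite E' dvdn_mulr.
by move: E'; rewrite a1 b1 !exp1n !mul1n.
Qed.

Lemma square_class_eq (x y : int) : x != 0%R -> y != 0%R ->
  (square_class x = square_class y) <->
  (exists s t : int, [/\ s != 0%R, t != 0%R & (s ^+ 2 * x = t ^+ 2 * y)%R]).
Proof.
move=> x0 y0; rewrite /square_class.
have xq : (x%:~R : rat)%R != 0%R by rewrite intr_eq0.
have yq : (y%:~R : rat)%R != 0%R by rewrite intr_eq0.
rewrite !insubT /=; split.
  case=> /eqP; rewrite -/(_ == _ %[mod _]) eqmodE => /asboolP[[q q0] /=] E.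
  exists (denq q), (numq q); rewrite denq_neq0 numq_eq0; split => //.
  apply: (@intr_inj rat); rewrite !expr2 !intrM E -{3}(divq_num_den q).
  by field; rewrite intr_eq0 denq_neq0.
move=> [s [t [s0 t0 E]]]; congr Some; apply/eqP; rewrite -/(_ == _ %[mod _]) eqmodE; apply/asboolP.
have q0 : (t%:~R / s%:~R : rat)%R != 0%R by rewrite mulf_neq0 ?invr_eq0 ?intr_eq0.
exists (exist (fun x : rat => x != 0%R) _ q0) => /=.
have sq0 : (s%:~R ^+ 2 : rat)%R != 0%R by rewrite expf_neq0 ?intr_eq0.
apply: (mulfI sq0); rewrite exprMn exprVn mulrA [(_ * (t%:~R ^+ 2 / _))%R]mulrC mulfVK//.
by rewrite -!rmorphXn -!rmorphM /= E.
Qed.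

(** Once the factors [X] are removed the constant coefficient is nonzero, and any root [n] divides
    it. *)
Lemma poly_int_neq0 (f : {poly int}) : f != 0%R ->
  exists N, forall n : nat, N <= n -> (f.[n%:Z])%R != 0%R.
Proof.
elim/poly_ind: f => [|p c IH]; first by rewrite eqxx.
case: (eqVneq c 0%R) => [->|c0 _].
  rewrite addr0 mulf_eq0 polyX_eq0 orbF => /IH[N NP]; exists N.+1 => n Nn.
  by rewrite hornerMX mulf_neq0 ?NP 1?ltnW//; case: n Nn.
exists `|c|.+1%N => n cn; rewrite hornerMXaddC; apply/eqP => E.
have : (n%:Z %| c)%Z by apply/dvdzP; exists (- p.[n%:Z])%R; move: E; lia.
rewrite dvdzE /= => /dvdn_leq; rewrite absz_gt0 c0 => /(_ isT); lia.
Qed.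

(** Outside the exceptional sets the square part of [h n] is at most [M]. If two such values at [x]
    and [y] share a class, their squarefree parts agree, and [my ^ 2 * h x = mx ^ 2 * h y] is one of
    the [M ^ 2] excluded collisions. So the remaining [n] have distinct classes, and [image_size] is
    at least their number. *)
Lemma thin_good (f : {poly int}) (c : int) (g h : {poly int}) :
  f != 0%R -> f = (c%:P * g ^+ 2 * h)%R ->
  (forall k, exists M, small k (fun _ n => `[< exists2 m, M < m & ((m%:Z ^+ 2)%R %| h.[n%:Z]%R)%Z >])) ->
  (forall u v, 0 < u -> 0 < v ->
     thin (fun _ n => `[< exists2 n', 0 < n' /\ n' <> n & (u%:Z * h.[n%:Z] = v%:Z * h.[n'%:Z])%R >])) ->
  forall k, exists B0, forall B, B0 <= B -> k * (B - image_size f B) <= B.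
Proof.
move=> f0 fE A curve k.
have [N NP] := poly_int_neq0 f0.
have nz n : N <= n -> [/\ c != 0%R, (g.[n%:Z])%R != 0%R & (h.[n%:Z])%R != 0%R].
  move=> /NP; rewrite fE !hornerM hornerC !mulf_eq0 !negb_or.
  by move=> /andP[/andP[? /andP[? _]] ?].
have [M [B1 HM]] := A k.*2.
pose bad n := `[< exists2 m, M < m & ((m%:Z ^+ 2)%R %| h.[n%:Z]%R)%Z >].
pose coll n := `[< exists u v n', [/\ 0 < u, u <= M, 0 < v, v <= M & [/\ 0 < n', n' <> n & ((u ^ 2)%:Z * h.[n%:Z] = (v ^ 2)%:Z * h.[n'%:Z])%R]] >].
have cthin : thin (fun _ n => (n < N) || coll n).
  apply: (@thinU 0 _ (fun _ n => n < N) (fun _ => coll)) => //.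
    by apply: (@thin_fin N) => B n _ /ltnW.
  apply: (@thin_bigU _ [seq (u, v) | u <- iota 1 M, v <- iota 1 M] 0 _
    (fun uv _ n => `[< exists2 n', 0 < n' /\ n' <> n & ((uv.1 ^ 2)%:Z * h.[n%:Z] = (uv.2 ^ 2)%:Z * h.[n'%:Z])%R >])).
    move=> B n _ _ /asboolP[u [v [n' [u0 uM v0 vM [n'0 n'n E]]]]].
    exists (u, v); first by apply/allpairsP; exists (u, v); rewrite !mem_iota !add1n !ltnS u0 uM v0 vM.
    by apply/asboolP; exists n'.
  move=> [u v] /allpairsP[[x y] /= [xM yM [-> ->]]].
  move: xM yM; rewrite !mem_iota => /andP[x0 _] /andP[y0 _].
  by apply: curve; rewrite expn_gt0 ?x0 ?y0.
have [B2 HB2] := cthin k.*2.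
exists (maxn B1 B2) => B; rewrite geq_max => /andP[/HM bB /HB2 cB].
pose good n := ~~ bad n && ~~ ((n < N) || coll n).
have lo : cnt good B <= image_size f B.
  rewrite /image_size cntE -(size_map (fun n : nat => square_class (f.[n%:Z])%R)).
  apply: (@uniq_leq_size _ _ (enum_fset _)).
    rewrite map_inj_in_uniq ?filter_uniq ?iota_uniq// => x y.
    rewrite !mem_filter !mem_iota => /andP[/andP[xb xc] /andP[x0 _]] /andP[/andP[yb yc] /andP[y0 _]].
    move: xc yc => /norP[+ xc] /norP[+ _]; rewrite -!leqNgt => xN yN E.
    case: (eqVneq x y) => // xy; exfalso; move/negP: xc; apply; apply/asboolP.
    have [cn gx hx] := nz _ xN; have [_ gy hy] := nz _ yN.
    move/square_class_eq : E => [||s [t [s0 t0 E]]]; [exact: NP|exact: NP|].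
    have [|qx [mx [mx0 sqx hxE]]] := @sqfree_decomp `|(h.[x%:Z])%R|%N; first by rewrite absz_gt0.
    have [|qy [my [my0 sqy hyE]]] := @sqfree_decomp `|(h.[y%:Z])%R|%N; first by rewrite absz_gt0.
    have mM z m q : ~~ bad z -> `|(h.[z%:Z])%R|%N = q * m ^ 2 -> m <= M.
      move=> zb zE; rewrite leqNgt; apply/negP => Mm; move/negP: zb; apply; apply/asboolP.
      by exists m => //; rewrite dvdzE zE abszX /= dvdn_mull.
    have E2 : ((s * g.[x%:Z]) ^+ 2 * h.[x%:Z] = (t * g.[y%:Z]) ^+ 2 * h.[y%:Z])%R.
      apply: (mulfI cn); move: E; rewrite fE !hornerM !hornerC => E.
      have aux (s' t' c' a b u v : int) : (s' ^+ 2 * (c' * (a * a) * u) = t' ^+ 2 * (c' * (b * b) * v) -> c' * ((s' * a) ^+ 2 * u) = c' * ((t' * b) ^+ 2 * v))%R.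
        by move=> H; transitivity (s' ^+ 2 * (c' * (a * a) * u))%R; [ring|rewrite H; ring].
      exact: aux E.
    have qq : qx = qy.
      apply: (@sqfree_uniq (`|(s * g.[x%:Z])%R|%N * mx) (`|(t * g.[y%:Z])%R|%N * my)) => //.
      - by rewrite muln_gt0 mx0 absz_gt0 mulf_neq0.
      - by rewrite muln_gt0 my0 absz_gt0 mulf_neq0.
      have := congr1 absz E2; rewrite !abszM hxE hyE -!mulnn; clear; lia.
    exists my, mx, y; split => //; [exact: mM yb hyE|exact: mM xb hxE|split => //].
      by move=> yx; rewrite yx eqxx in xy.
    (* Squarefree parts only see absolute values, so the signs are compared separately. *)
    have sg : (Num.sg (h.[x%:Z]) = Num.sg (h.[y%:Z]))%R.
      have sgE (a z : int) : a != 0%R -> Num.sg (a ^+ 2 * z)%R = Num.sg z.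
        by move=> a0; rewrite sgrM (gtr0_sg (x := (a ^+ 2)%R)) ?mul1r// exprn_even_gt0.
      by have := congr1 Num.sg E2; rewrite !sgE ?mulf_neq0.
    rewrite (numEsg (h.[x%:Z])%R) (numEsg (h.[y%:Z])%R) sg mulrCA [RHS]mulrCA; congr (_ * _)%R.
    rewrite -!abszE hxE hyE qq -!mulnn; clear; lia.
  by move=> _ /mapP[n + ->]; rewrite mem_filter => /andP[_ nB]; apply: in_imfset.
have := @cnt_leU predT good (fun n => ~~ good n) B (fun n _ _ => orbN _).
have := @cnt_leU (fun n => ~~ good n) bad (fun n => (n < N) || coll n) B.
have -> : cnt predT B = B by rewrite /cnt count_predT size_iota.
have H1 : forall n : nat, 0 < n <= B -> ~~ good n -> bad n || ((n < N) || coll n).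
  by move=> n _; rewrite /good negb_and !negbK.
move=> /(_ H1); move: bB cB lo; rewrite -/bad -!muln2.
move: (cnt bad B) (cnt (fun n => _ || _) B) (cnt (fun n => ~~ _) B) (cnt good B) (image_size f B).
clear; nia.
Qed.

(** * Square factors of polynomial values *)

Lemma horner_taylor (h : {poly int}) (x d : int) :
  exists c, (h.[x + d] = h.[x] + h^`().[x] * d + d ^+ 2 * c)%R.
Proof.
elim/poly_ind: h => [|p c [e IH]]; first by exists 0%R; rewrite deriv0 !horner0 mulr0 mul0r !addr0.
exists (e * (x + d) + p^`().[x])%R.
rewrite derivD derivM derivX derivC addr0 mulr1 !hornerMXaddC hornerD hornerM hornerX IH.
ring.
Qed.

Lemma horner_diff (h : {poly int}) (x y : int) : ((x - y)%R %| (h.[x] - h.[y])%R)%Z.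
Proof.
have [c E] := horner_taylor h y (x - y); apply/dvdzP; exists (h^`().[y] + (x - y) * c)%R.
have xE : x = (y + (x - y))%R by ring.
by rewrite {1}xE E; ring.
Qed.

(* A certificate that [h] has no repeated root. *)
Definition separated (h : {poly int}) : Prop :=
  exists (N : int) (U V : {poly int}), N != 0%R /\ (U * h + V * h^`() = N%:P)%R.

Lemma pfactor_dvd_mul p e w (x y : nat) : prime p -> 0 < y ->
  p ^ e %| x * y -> ~~ (p ^ w.+1 %| y) -> p ^ (e - w) %| x.
Proof.
move=> pp y0; case: (posnP x) => [->|x0]; first by rewrite dvdn0.
by rewrite !pfactor_dvdn ?muln_gt0 ?x0// lognM//; lia.
Qed.

(** By Taylor, [h y - h x = (y - x) * t], where [t] is the derivative at [x] modulo [y - x]. If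
    [p ^ (w + 1)] divided [t], it would divide both [h] and its derivative at [x], hence [N]. So [t]
    absorbs at most [p ^ w] of the factor [p ^ e]. *)
Lemma hensel (h U V : {poly int}) (N : int) p e w (x y : int) :
  prime p -> (U * h + V * h^`() = N%:P)%R -> ~~ (p ^ w.+1 %| `|N|) -> w < e ->
  ((p ^ e)%:Z %| h.[x]%R)%Z -> ((p ^ e)%:Z %| h.[y]%R)%Z -> ((p ^ w.+1)%:Z %| (y - x)%R)%Z ->
  ((p ^ (e - w))%:Z %| (y - x)%R)%Z.
Proof.
move=> pp E pN we hx hy xy.
have [c yE] := horner_taylor h x (y - x).
have {}yE : (h.[y] - h.[x] = (y - x) * (h^`().[x] + (y - x) * c))%R.
  by rewrite {1}(_ : y = x + (y - x))%R ?yE; ring.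
set t := (h^`().[x] + (y - x) * c)%R in yE.
have pt : ~~ (p ^ w.+1 %| `|t|).
  apply: contra pN => pt; have := congr1 (fun q => q.[x])%R E.
  rewrite hornerC hornerD !hornerM => <-.
  rewrite -[p ^ _]/(`|Posz (p ^ w.+1)|) -dvdzE.
  have ptz : ((p ^ w.+1)%:Z %| t)%Z by rewrite dvdzE.
  apply: rpredD; first by apply: dvdz_mull; apply: dvdz_trans hx; rewrite dvdzE /= dvdn_exp2l.
  apply: dvdz_mull; rewrite (_ : h^`().[x] = t - (y - x) * c)%R; last by rewrite /t; ring.
  by apply: rpredB => //; apply: dvdz_mulr.
have t0 : 0 < `|t| by rewrite lt0n; apply: contra pt => /eqP ->; rewrite dvdn0.
rewrite dvdzE /=; apply: (pfactor_dvd_mul pp t0) pt.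
by rewrite -abszM -yE -[p ^ _]/(`|Posz (p ^ e)|) -dvdzE rpredB.
Qed.

Lemma dvdz_subnat (m x y : nat) : x <= y -> (m%:Z %| (y%:Z - x%:Z)%R)%Z = (x == y %[mod m]).
Proof. by move=> xy; rewrite subzn// dvdzE /= eq_sym eqn_mod_dvd. Qed.

Lemma count_classes (P : pred nat) m a W (s : seq nat) :
  (forall n, P n -> n %% m \in s) ->
  (forall x y, P x -> P y -> a <= x -> x < y -> y < a + W -> x != y %[mod m]) ->
  count P (iota a W) <= size s.
Proof.
move=> Ps inj; rewrite -size_filter -(size_map (modn^~ m)).
apply: uniq_leq_size; last by move=> _ /mapP[n + ->]; rewrite mem_filter => /andP[/Ps].
rewrite map_inj_in_uniq ?filter_uniq ?iota_uniq// => x y.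
rewrite !mem_filter !mem_iota => /andP[Px /andP[ax xW]] /andP[Py /andP[ay yW]] E.
by case: (ltngtP x y) => // lt; [have := inj x y Px Py ax lt yW|have := inj y x Py Px ay lt xW]; rewrite E eqxx.
Qed.

(** Inside the window, two roots congruent modulo [p ^ (w + 1)] coincide by [hensel]. The bound does
    not involve [e], so the density of roots falls as [e] grows. *)
Lemma count_prime_power (h U V : {poly int}) (N : int) p e w a :
  prime p -> (U * h + V * h^`() = N%:P)%R -> ~~ (p ^ w.+1 %| `|N|) -> w < e ->
  count (fun n => (p ^ e)%:Z %| h.[n%:Z]%R)%Z (iota a (p ^ (e - w))) <= p ^ w.+1.
Proof.
move=> pp E pN we; rewrite -[leqRHS](size_iota 0).
apply: (@count_classes _ (p ^ w.+1)) => [n _|x y hx hy ax xy yW].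
  by rewrite mem_iota ltn_pmod// expn_gt0 prime_gt0.
apply/negP => xym; have := hensel pp E pN we hx hy.
rewrite !dvdz_subnat ?(ltnW xy)// => /(_ xym); rewrite eq_sym eqn_mod_dvd ?(ltnW xy)// => /dvdn_leq.
by move: (p ^ _) yW => z; clear -ax xy; lia.
Qed.

Lemma count_roots_mod (h : {poly int}) p : prime p -> ~~ (p %| `|lead_coef h|) ->
  exists s : seq nat, size s <= size h /\ (forall n : nat, (p%:Z %| h.[n%:Z]%R)%Z -> n %% p \in s).
Proof.
move=> pp pl.
pose s := [seq n <- iota 0 p | (p%:Z %| h.[n%:Z]%R)%Z]; exists s; split; last first.
  move=> n hn; rewrite mem_filter mem_iota leq0n add0n ltn_pmod ?prime_gt0// andbT.
  have := horner_diff h n%:Z (n %% p)%:Z.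
  rewrite (_ : n%:Z - (n %% p)%:Z = (n %/ p)%:Z * p%:Z)%R; last by rewrite {1}(divn_eq n p) PoszD PoszM; ring.
  move=> /(dvdz_trans (dvdz_mull _ (dvdzz _))) H.
  by rewrite -(subKr (h.[n%:Z])%R (h.[(n %% p)%:Z])%R) rpredB.
pose hp : {poly 'F_p} := map_poly intr h.
have z0 (z : int) : ((z%:~R : 'F_p) == 0)%R = (p%:Z %| z)%Z.
  rewrite dvdzE /=; case: (intP z) => [|m|m]; rewrite ?abszN ?rmorph0 ?eqxx ?dvdn0// ?rmorphN ?oppr_eq0 /=;
  by rewrite -pmulrn -(dvdn_pcharf (pchar_Fp pp)).
have hp0 : (hp != 0)%R.
  apply/eqP => /(congr1 (fun q : {poly 'F_p} => q`_(size h).-1)%R); rewrite coef_map coef0 => /eqP.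
  by rewrite z0 dvdzE (negbTE pl).
rewrite -(size_map (fun n : nat => n%:R : 'F_p)%R).
have sz : size hp <= size h by exact: size_poly.
apply: leq_trans sz; apply: ltnW; apply: max_poly_roots => //.
  apply/allP => _ /mapP[n + ->]; rewrite mem_filter => /andP[hn _].
  rewrite rootE (_ : n%:R = (n%:Z)%:~R)%R// horner_map /= z0//.
rewrite map_inj_in_uniq ?filter_uniq ?iota_uniq// => x y.
rewrite !mem_filter !mem_iota !add0n => /andP[_ /= xp] /andP[_ /= yp] /(congr1 val) /=.
by rewrite !val_Fp_nat// !modn_small.
Qed.

Lemma count_prime_sq (h U V : {poly int}) (N : int) p a :
  prime p -> (U * h + V * h^`() = N%:P)%R -> ~~ (p %| `|N|) -> ~~ (p %| `|lead_coef h|) ->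
  count (fun n => (p ^ 2)%:Z %| h.[n%:Z]%R)%Z (iota a (p ^ 2)) <= size h.
Proof.
move=> pp E pN pl; have [s [sh sP]] := count_roots_mod pp pl.
apply: leq_trans sh; apply: (@count_classes _ p) => [n hn|x y hx hy ax xy yW].
  by apply: sP; apply: dvdz_trans hn; rewrite dvdzE /= dvdn_exp.
apply/negP => xym; have := @hensel h U V N p 2 0 _ _ pp E _ isT hx hy.
rewrite expn1 pN !dvdz_subnat ?(ltnW xy)// => /(_ isT xym); rewrite eq_sym eqn_mod_dvd ?(ltnW xy)// => /dvdn_leq.
by move: (p ^ _) yW => z; clear -ax xy; lia.
Qed.

Lemma sum_div_sq B M T : 0 < M -> M * \sum_(p <- iota M.+1 T) B %/ p ^ 2 <= B.
Proof.
move=> M0; set S := \sum_(p <- _) _.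
(* The induction carries the telescoping bound [S <= B * (1 / M - 1 / (M + T))], written without
   denominators. *)
suff H : S * (M * (M + T)) <= B * T.
  case: (posnP T) => [T0|T0]; first by rewrite /S T0 /= big_nil muln0.
  rewrite -(leq_pmul2r T0); apply: leq_trans H; clear; nia.
rewrite {}/S; elim: T => [|T IH]; first by rewrite big_nil mul0n.
rewrite -(addn1 T) iotaD big_cat big_seq1 /=.
set S := \sum_(p <- _) _ in IH *; set q := B %/ _.
have Hq : q * ((M + T).+1 * (M + T).+1) <= B by rewrite /q mulnn -addSn leq_divM.
have a0 : 0 < (M + T) * (M + T).+1 by rewrite muln_gt0 addn_gt0 M0.
rewrite -(leq_pmul2r a0).
have aE : M + (T + 1) = (M + T).+1 by rewrite addn1 addnS.
rewrite aE; set a := M + T in IH Hq a0 *.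
have H1 : S * M * a * (a.+1 * a.+1) <= B * T * (a.+1 * a.+1) by rewrite leq_mul2r -(mulnA S) IH orbT.
have H2 : q * (a.+1 * a.+1) * (M * a) <= B * (M * a) by rewrite leq_mul2r Hq orbT.
have H3 : B * T <= B * a by rewrite leq_mul2l /a leq_addl orbT.
have MT : M = a - T by rewrite /a addnK.
have Ta : T <= a by rewrite /a leq_addl.
apply: (@leq_trans (B * T * (a.+1 * a.+1) + B * (M * a))); first by lia.
rewrite MT; move: (a - T) (subnK Ta) H3 => z zE H3; rewrite -zE; rewrite -zE in H3; nia.
Qed.

Lemma small_bigU (I : eqType) (s : seq I) k (P : nat -> pred nat) (Q : I -> nat -> pred nat) :
  (forall B n, 0 < n <= B -> P B n -> exists2 i, i \in s & Q i B n) ->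
  {in s, forall i, small (k * size s) (Q i)} -> small k P.
Proof.
move=> PQ sQ.
have [B0 HB] : exists B0, forall B, B0 <= B -> forall i, i \in s -> k * size s * cnt (Q i B) B <= B.
  move: (k * size s) sQ {PQ} => m; elim: s => [|i s IH] H; first by exists 0.
  have [|B1 H1] := IH; first by move=> j js; apply: H; rewrite inE js orbT.
  have [B2 H2] := H i (mem_head _ _).
  exists (maxn B1 B2) => B; rewrite geq_max => /andP[/H1 {}H1 /H2 {}H2] j.
  by rewrite inE => /orP[/eqP ->|/H1].
exists B0 => B /HB {}HB.
have := @cnt_bigU _ s _ (fun i => Q i B) B (PQ B).
case: (posnP (size s)) => [/size0nil ->|s0]; first by rewrite big_nil leqn0 => /eqP ->; rewrite muln0.
move=> H; rewrite -(leq_pmul2l s0); apply: (@leq_trans (k * size s * \sum_(i <- s) cnt (Q i B) B)).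
  by rewrite mulnA (mulnC (size s)) leq_mul2l H orbT.
rewrite big_distrr /= big_seq.
apply: (@leq_trans (\sum_(i <- s | i \in s) B)); first by apply: leq_sum => i /HB.
by rewrite -big_seq big_const_seq count_predT iter_addn_0 mulnC.
Qed.

(** This isolates the primes for which one solution per root and per prime is already too many. [K]
    is arbitrary because the elementary count stops at a small multiple of [B]. *)
Definition large_square_thin (h : {poly int}) : Prop := forall K,
  thin (fun B n => `[< exists2 p, prime p /\ B < p * K & ((p ^ 2)%:Z %| h.[n%:Z]%R)%Z >]).

(** Three ranges of primes. For [p <= M1], divisibility by a high power [p ^ e] is rare. For
    [M1 < p <= B / M1], the roots modulo [p ^ 2] give at most [(B / p ^ 2 + 1) * d] integers each,
    in total at most [2 * d * B / M1]. Larger primes are left to [large_square_thin]. Outside these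
    sets [m] is a product of bounded powers of primes up to [M1]. *)
Lemma square_divisor_small (h : {poly int}) :
  (h != 0)%R -> separated h -> large_square_thin h ->
  forall k, exists M, small k (fun _ n => `[< exists2 m, M < m & ((m%:Z ^+ 2)%R %| h.[n%:Z]%R)%Z >]).
Proof.
move=> h0 [N [U [V [N0 E]]]] A3 k.
(* Primes above [M1] divide neither [N] nor the leading coefficient, and the term [16 * k * d] makes
   the middle range contribute at most [B / (8 * k)]. *)
pose d := size h; pose M1 := `|N| + `|lead_coef h| + 4 * (k.*2.*2 * d) + 1.
have NM p : M1 < p -> ~~ (p %| `|N|).
  by move=> Mp; apply/negP => /dvdn_leq; rewrite absz_gt0 N0 => /(_ isT); rewrite leqNgt (leq_ltn_trans _ Mp)// /M1 -!addnA leq_addr.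
have lM p : M1 < p -> ~~ (p %| `|lead_coef h|).
  move=> Mp; apply/negP => /dvdn_leq; rewrite absz_gt0 lead_coef_eq0 h0 => /(_ isT); rewrite leqNgt (leq_ltn_trans _ Mp)// /M1.
  by rewrite addnAC -!addnA addnCA leq_addr.
have A1 p : prime p -> exists e, small (k.*2 * M1.+1) (fun _ n => ((p ^ e)%:Z %| h.[n%:Z]%R)%Z).
  move=> pp; have [w pw] : exists w, ~~ (p ^ w.+1 %| `|N|).
    exists `|N|; apply/negP => /dvdn_leq; rewrite absz_gt0 N0 => /(_ isT).
    by rewrite leqNgt ltnW// ltn_expl ?prime_gt1.
  pose c := k.*2 * M1.+1 * p ^ w.+1.
  (* The roots have density about [p ^ (w + 1) / p ^ (2 * (c + 1))]; the inequality [p ^ x > x]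
     brings it below the required bound. *)
  exists (w + 2 * c.+1); exists (2 * c.+1) => B cB.
  have := @count_windows (fun n => ((p ^ (w + 2 * c.+1))%:Z %| h.[n%:Z]%R)%Z) 0 B (p ^ (2 * c.+1)) (p ^ w.+1).
  rewrite expn_gt0 prime_gt0// add0n => /(_ isT) H.
  apply: leq_trans (leq_mul (leqnn _) (H _)) _.
    move=> a _; have := @count_prime_power h U V N p (w + 2 * c.+1) w a pp E pw.
    by rewrite addKn; apply; rewrite -addn1 leq_add2l.
  rewrite mulnCA mulnC -/c.
  have : B %/ p ^ (2 * c.+1) * (2 * c.+1) <= B.
    apply: leq_trans (leq_divM B (p ^ (2 * c.+1))); rewrite leq_mul2l ltnW ?orbT//.
    exact/ltn_expl/prime_gt1.
  by move: (B %/ _) => z; clear -cB; nia.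
have /boolp.choice [e He] p : exists e, prime p -> small (k.*2 * M1.+1) (fun _ n => ((p ^ e)%:Z %| h.[n%:Z]%R)%Z).
  by case: (boolP (prime p)) => [/A1[e]|_]; [exists e|exists 0].
(* The summand 1 makes every factor at least 1, whatever [e p] is at a non-prime [p]. *)
exists (\prod_(p <- iota 0 M1.+1) (p ^ e p + 1)).
pose P1 (B n : nat) := `[< exists2 p, (p <= M1) && prime p & ((p ^ e p)%:Z %| h.[n%:Z]%R)%Z >].
pose P2 (B n : nat) := `[< exists2 p, [/\ prime p, M1 < p & p * M1 <= B] & ((p ^ 2)%:Z %| h.[n%:Z]%R)%Z >].
pose P3 (B n : nat) := `[< exists2 p, prime p /\ B < p * M1 & ((p ^ 2)%:Z %| h.[n%:Z]%R)%Z >].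
have [N' HN'] := poly_int_neq0 h0.
apply: (@smallU k 0 _ (fun B n => P1 B n) (fun B n => (n < N') || (P2 B n || P3 B n))).
- move=> B n _ nB /asboolP[m Mm mh]; case: (ltnP n N') => nN /=; first by rewrite orbT.
  case: (boolP (P1 B n)) => //= /asboolPn nP1.
  case: (boolP (P2 B n)) => //= /asboolPn nP2.
  case: (boolP (P3 B n)) => //= /asboolPn nP3.
  exfalso; have hn := HN' _ nN.
  have m0 : 0 < m by apply: leq_ltn_trans Mm.
  have pM p : prime p -> p %| m -> p <= M1.
    move=> pp pm; rewrite leqNgt; apply/negP => Mp.
    have ph : ((p ^ 2)%:Z %| h.[n%:Z]%R)%Z by apply: dvdz_trans mh; rewrite dvdzE abszX /= dvdn_exp2r.
    case: (leqP (p * M1) B) => pB; first by apply: nP2; exists p.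
    by apply: nP3; exists p.
  move: Mm; rewrite ltnNge => /negP; apply.
  rewrite {1}(prod_prime_decomp m0) prime_decompE big_map /=.
  rewrite (perm_big [seq p <- iota 0 M1.+1 | p \in primes m]); last first.
    apply: uniq_perm; rewrite ?filter_uniq ?iota_uniq ?primes_uniq// => p.
    rewrite mem_filter mem_iota add0n leq0n ltnS; case: (boolP (p \in _)) => //.
    by rewrite mem_primes => /and3P[pp _ /(pM _ pp) ->].
  rewrite big_filter big_mkcond; apply: leq_prod => p _; case: ifP => [|_]; last by rewrite addn1.
  rewrite mem_primes => /and3P[pp _ pm]; apply: leq_trans (leq_addr _ _).
  rewrite leq_exp2l ?prime_gt1// ltnW//ltnNge; apply/negP => ep; apply: nP1.
  exists p; first by rewrite pM.
  apply: dvdz_trans mh; rewrite dvdzE abszX /=; apply: (@dvdn_trans (p ^ logn p m)).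
    exact: dvdn_exp2l.
  by apply: dvdn_trans (pfactor_dvdnn p m) _; rewrite dvdn_exp.
- apply: (@small_bigU _ (iota 0 M1.+1) _ _ (fun p _ n => prime p && ((p ^ e p)%:Z %| h.[n%:Z]%R)%Z)).
    by move=> B n _ /asboolP[p /andP[pM pp] ph]; exists p; rewrite ?mem_iota ?pp.
  move=> p _; rewrite size_iota; case: (boolP (prime p)) => [/He//|_].
  exact: (@small0 0).
apply: (@smallU _ 0 _ (fun _ n => n < N') (fun B n => P2 B n || P3 B n)) => //.
  by apply: (@thin_fin N') => B n _ /ltnW.
apply: (@smallU _ 0 _ P2 P3) => //; last exact: A3.
set k8 := (k.*2.*2).*2.
have M10 : 0 < M1 by rewrite /M1 addn1.
exists 0 => B _.
pose T := B %/ M1.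
have := @cnt_bigU _ [seq p <- iota M1.+1 T | prime p] (P2 B) (fun p n => ((p ^ 2)%:Z %| h.[n%:Z]%R)%Z) B.
have H0 n : 0 < n <= B -> P2 B n -> exists2 i : nat, i \in [seq p <- iota M1.+1 T | prime p] & ((i ^ 2)%:Z %| h.[n%:Z]%R)%Z.
  move=> _ /asboolP[p [pp Mp pB] ph]; exists p => //; rewrite mem_filter pp mem_iota Mp addSn ltnS.
  by rewrite (leq_trans _ (leq_addl _ _))// leq_divRL.
move=> /(_ H0) {}H0.
have H1 : cnt (P2 B) B <= (\sum_(p <- iota M1.+1 T) B %/ p ^ 2 + T) * d.
  apply: leq_trans H0 _; rewrite big_filter.
  apply: (@leq_trans (\sum_(p <- iota M1.+1 T) ((B %/ p ^ 2).+1 * d))).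
    rewrite big_mkcond big_seq [leqRHS]big_seq; apply: leq_sum => p.
    rewrite mem_iota => /andP[Mp _]; case: ifP => // pp; rewrite -[leqRHS]add0n.
    apply: count_windows => [|a _]; first by rewrite expn_gt0 prime_gt0.
    exact: (@count_prime_sq h U V N p a pp E (NM _ Mp) (lM _ Mp)).
  rewrite -big_distrl leq_mul2r; apply/orP; right => /=.
  rewrite (eq_bigr (fun p => B %/ p ^ 2 + 1)); last by move=> p _; rewrite addn1.
  by rewrite big_split /= sum1_size size_iota.
have H2 := @sum_div_sq B M1 T M10.
have H3 : M1 * T <= B by rewrite mulnC leq_divM.
move: (\sum_(p <- _) _) H1 H2 => S H1 H2.
have kM : 2 * (k8 * d) <= M1 by rewrite /M1 /k8 -!muln2; clear; nia.
move: H1 kM H2 H3; clear; nia.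
Qed.

(** * Integer points close to curves *)

Local Open Scope ring_scope.

(** The integers different from [x] stay at distance at least some [d > 0] from it; [N] exceeds
    [|C| / d]. *)
Lemma close_int (R : realType) (x C : R) :
  exists N : nat, forall (n : nat) (w : int), (N <= n)%N -> `|w%:~R - x| * n%:R <= C -> w%:~R = x.
Proof.
have [d [d0 dP]] : exists d : R, 0 < d /\ forall w : int, w%:~R != x -> d <= `|w%:~R - x|.
  have /andP[fl fr] := floor_itv x.
  case: (eqVneq (Num.floor x)%:~R x) => [<-|ne].
    exists 1; split => // w; rewrite eqr_int => wf.
    by rewrite -intrB -intr_norm -[1]/(1%:~R) ler_int -gtz0_ge1 normr_gt0 subr_eq0.
  have fl' : (Num.floor x)%:~R < x by rewrite lt_neqAle ne.
  exists (Num.min (x - (Num.floor x)%:~R) ((Num.floor x + 1)%:~R - x)); split.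
    by rewrite lt_min !subr_gt0 fl'.
  move=> w _; rewrite ge_min; case: (leP w (Num.floor x)) => wf.
    rewrite ler0_norm ?subr_le0; first by rewrite opprB lerD2l lerN2 ler_int wf.
    by rewrite (le_trans _ fl)// ler_int.
  have wf1 : (Num.floor x + 1)%:~R <= w%:~R :> R by rewrite ler_int -[(_ <= _)]/(_ <= _) lezD1.
  rewrite ger0_norm ?subr_ge0; first by rewrite lerD2r wf1 orbT.
  by apply: ltW; apply: lt_le_trans wf1.
exists (Num.truncn (`|C| / d)).+1 => n w Nn H; apply/eqP/negPn/negP => /dP dw.
have : `|C| / d < n%:R.
  by apply: lt_le_trans (_ : (Num.truncn (`|C| / d)).+1%:R <= _); rewrite ?truncnS_gt// ler_nat.
rewrite ltr_pdivrMr// mulrC => Cn; have := le_lt_trans (ler_norm C) Cn.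
by rewrite ltNge (le_trans _ H)// ler_wpM2r.
Qed.

(** Let [(n, m)] and [(n + k, m')] be points of [S] with [n] large. The integer [m' - m] is within
    [O(1 / n)] of [al * k], hence equal to it. Then the integer [k * m - (m' - m) * n] is within
    [O(1 / n)] of [k * be], hence equal to it, and [m = al * n + be] exactly, which is excluded. So
    large members are never at bounded distance, whether [al] is rational or not. *)
Lemma thin_linear (R : realType) (S : nat -> int -> Prop) (al be C : R) :
  (forall n m, S n m -> `|m%:~R - al * n%:R - be| * n%:R <= C) ->
  (exists N, forall n m, S n m -> m%:~R = al * n%:R + be -> (n <= N)%N) ->
  thin (fun _ n => `[< exists m, S n m >]).
Proof.
move=> close [N0 exact0]; apply: (@thin_gap 1) => // W.
have H k : exists N, forall n m m', (N <= n)%N -> S n m -> S (n + k.+1)%N m' -> False.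
  have [N1 H1] := close_int (al * k.+1%:R) (C + C).
  have [N2 H2] := close_int (k.+1%:R * be) (k.+1%:R * C).
  exists (maxn N0.+1 (maxn N1 N2)) => n m m'; rewrite !geq_max => /and3P[n0 n1 n2] Sm Sm'.
  have E1 : (m' - m)%:~R = al * k.+1%:R.
    apply: (H1 n) => //; rewrite intrB.
    have -> : m'%:~R - m%:~R - al * k.+1%:R =
       (m'%:~R - al * (n + k.+1)%:R - be) - (m%:~R - al * n%:R - be) :> R by rewrite natrD; ring.
    apply: le_trans (_ : (`|m'%:~R - al * (n + k.+1)%:R - be| + `|m%:~R - al * n%:R - be|) * n%:R <= _).
      by rewrite ler_wpM2r// ler_normB.
    rewrite mulrDl lerD ?close//; apply: le_trans (close _ _ Sm').
    by rewrite ler_wpM2l// ler_nat leq_addr.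
  have E2 : (k.+1%:Z * m - (m' - m) * n%:Z)%:~R = k.+1%:R * be.
    apply: (H2 n) => //; rewrite intrB !intrM E1.
    have -> : (k.+1%:Z)%:~R * m%:~R - al * k.+1%:R * (n%:Z)%:~R - k.+1%:R * be = k.+1%:R * (m%:~R - al * n%:R - be) :> R.
      by rewrite !pmulrn; ring.
    by rewrite normrM ger0_norm// -mulrA ler_wpM2l// close.
  have := exact0 _ _ Sm; rewrite leqNgt n0 => E; suff: false by []; apply: E.
  have k0 : k.+1%:R != 0 :> R by rewrite pnatr_eq0.
  apply: (mulfI k0); move: E2; rewrite intrB !intrM E1 => E2.
  rewrite mulrDr -E2 !pmulrn; ring.
have /boolp.choice[Nk HN] := H.
exists (\max_(k < W) Nk k) => B n n' Nn nn' n'W /asboolP[m Sm] /asboolP[m' Sm'].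
case/andP: nn' => nn' _; exfalso.
have kW : ((n' - n).-1 < W)%N by lia.
have E : n' = (n + (n' - n).-1.+1)%N by lia.
apply: (HN (n' - n).-1 n m m' _ Sm); last by rewrite -E.
by apply: leq_trans Nn; exact: (leq_bigmax (Ordinal kW)).
Qed.

Lemma poly_bound (R : realDomainType) (p : {poly R}) e (x : R) : (size p <= e.+1)%N -> 1 <= x ->
  `|p.[x]| <= (\sum_(i < size p) `|p`_i|) * x ^+ e.
Proof.
move=> sp x1; rewrite horner_coef (le_trans (ler_norm_sum _ _ _))// mulr_suml ler_sum// => i _.
rewrite normrM ler_wpM2l// normrX ger0_norm ?(le_trans ler01)//.
by rewrite ler_weXn2l// -ltnS (leq_trans (ltn_ord i)).
Qed.

Lemma poly_growth (R : realType) (p : {poly R}) e : size p = e.+1 ->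
  exists N : nat, forall x : R, N%:R <= x -> `|lead_coef p| / 2 * x ^+ e <= `|p.[x]|.
Proof.
case: e => [|e] sp.
  exists 0%N => x _; have /size_poly1P[c c0 ->] : size p == 1%N by rewrite sp.
  rewrite lead_coefC hornerC mulr1 ler_pdivrMr// mulr_natr mulr2n lerDl//.
have p0 : lead_coef p != 0 by rewrite lead_coef_eq0 -size_poly_eq0 sp.
have l0 : 0 < `|lead_coef p| by rewrite normr_gt0.
pose r := p - lead_coef p *: 'X^(e.+1).
have sr : (size r <= e.+1)%N.
  apply/leq_sizeP => j ej; rewrite coefB coefZ coefXn.
  case: (ltngtP e.+1 j) ej => // [ej _|<- _]; last by rewrite mulr1 lead_coefE sp subrr.
  by rewrite mulr0 subr0 nth_default// sp.
pose C := \sum_(i < size r) `|r`_i|.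
exists (Num.truncn (2 * C / `|lead_coef p|)).+1 => x Nx.
have x1 : 1 <= x by rewrite (le_trans _ Nx)// ler1n.
have x0 : 0 < x by rewrite (lt_le_trans ltr01).
have -> : p = r + lead_coef p *: 'X^(e.+1) by rewrite subrK.
rewrite lead_coefDr ?lead_coefZ ?lead_coefXn ?mulr1; last first.
  by rewrite size_scale// size_polyXn ltnS.
rewrite hornerD hornerZ hornerXn.
have H1 := poly_bound sr x1.
have H2 : C * 2 <= `|lead_coef p| * x.
  have : 2 * C / `|lead_coef p| <= x by rewrite (le_trans _ Nx)// ltW// truncnS_gt.
  by rewrite ler_pdivrMr// mulrC [x * _]mulrC.
have H3 : `|lead_coef p * x ^+ e.+1| = `|lead_coef p| * x * x ^+ e.
  by rewrite normrM normrX (ger0_norm (ltW x0)) exprS mulrA.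
rewrite -/C in H1; rewrite addrC; apply: le_trans (lerB_normD _ _); rewrite H3 lerBrDr.
apply: (le_trans (lerD (lexx _) H1)).
rewrite exprS mulrA -mulrDl ler_wpM2r ?exprn_ge0 ?(ltW x0)//.
set A := `|lead_coef p| in H2 *; lra.
Qed.

Lemma poly_real_neq0 (R : realType) (p : {poly R}) : p != 0 ->
  exists N : nat, forall x : R, N%:R <= x -> p.[x] != 0.
Proof.
move=> p0; have sp : size p = (size p).-1.+1 by rewrite prednK// size_poly_gt0.
have [N HN] := poly_growth sp.
exists N.+1 => x Nx; rewrite -normr_gt0; apply: lt_le_trans (HN x _); last first.
  by rewrite (le_trans _ Nx)// ler_nat.
rewrite mulr_gt0 ?divr_gt0 ?normr_gt0 ?lead_coef_eq0// exprn_gt0//.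
by rewrite (lt_le_trans _ Nx)// ltr0n.
Qed.

(** The cofactor of [y - x] in [y ^ (e + 2) - x ^ (e + 2)] contains the terms [x ^ (e + 1)] and
    [x * y ^ e]. *)
Lemma exprB_ge (R : realDomainType) (x y : R) e : 0 <= x -> 0 <= y ->
  `|y - x| * (x * (x ^+ e + y ^+ e)) <= 2 * `|y ^+ e.+2 - x ^+ e.+2|.
Proof.
move=> x0 y0; rewrite subrXX normrM [leRHS]mulrCA ler_wpM2l//.
have S0 (i : 'I_e.+2) : 0 <= y ^+ (e.+2.-1 - i) * x ^+ i by rewrite mulr_ge0 ?exprn_ge0.
rewrite ger0_norm; last by apply: sumr_ge0 => i _; exact: S0.
rewrite mulr2n mulrDl mul1r mulrDr lerD//.
  rewrite (bigD1 (@ord_max e.+1)) //= subnn expr0 mul1r -exprS lerDl.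
  by apply: sumr_ge0 => i _; exact: S0.
rewrite (bigD1 (lift ord0 ord0)) //= /bump /= addn0 subn1 /= expr1 mulrC lerDl.
by apply: sumr_ge0 => i _; exact: S0.
Qed.

Lemma coef_XaddCn (R : comNzRingType) (c : R) n :
  (('X + c%:P) ^+ n.+1)`_n = c *+ n.+1 /\ (('X + c%:P) ^+ n.+1)`_n.+1 = 1.
Proof.
elim: n => [|n [IH1 IH2]].
  by rewrite expr1 !coefD !coefX !coefC /= add0r addr0.
have s : size (('X + c%:P) ^+ n.+1) = n.+2.
  by rewrite -[c]opprK polyCN size_exp_XsubC.
rewrite exprS mulrDl; split; rewrite coefD coefXM coefCM /= ?IH1 ?IH2.
  by rewrite mulr1 -mulrSr.
by rewrite nth_default ?s// mulr0 addr0.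
Qed.

(** Minus the mean of the roots: in the variable [X + poly_center P] the second highest coefficient
    vanishes. *)
Definition poly_center (R : fieldType) (P : {poly R}) : R :=
  P`_(size P).-2 / (lead_coef P *+ (size P).-1).

Lemma poly_centerE (R : numFieldType) (P : {poly R}) e : size P = e.+3 ->
  exists2 r : {poly R}, (size r <= e.+1)%N &
    P = lead_coef P *: (('X + (poly_center P)%:P) ^+ e.+2 + r).
Proof.
move=> sP; have l0 : lead_coef P != 0 by rewrite lead_coef_eq0 -size_poly_eq0 sP.
exists ((lead_coef P)^-1 *: P - ('X + (poly_center P)%:P) ^+ e.+2); last first.
  by rewrite [X in _ *: X]addrC subrK scalerA mulfV// scale1r.
have [c1 c2] := coef_XaddCn (poly_center P) e.+1.
apply/leq_sizeP => j ej; rewrite coefB coefZ.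
case: (ltngtP j e.+1) ej => // [ej _|-> _]; last first.
  rewrite c1 /poly_center sP /=; apply/eqP; rewrite subr_eq0; apply/eqP.
  have e0 : e.+2%:R != 0 :> R by rewrite pnatr_eq0.
  by rewrite -mulr_natr -[lead_coef P *+ _]mulr_natr invfM mulrA mulfVK// mulrC.
case: (ltngtP j e.+2) ej => // [ej _|-> _].
  rewrite !nth_default ?sP// ?mulr0 ?subrr//.
  by rewrite -[poly_center P]opprK polyCN size_exp_XsubC.
by rewrite c2 lead_coefE sP mulVf ?subrr// -[X in P`_X]/(e.+3.-1) -sP -lead_coefE.
Qed.

Lemma exists_root (R : realType) (x : R) e : 0 < x -> exists2 y : R, 0 < y & y ^+ e.+1 = x.
Proof.
move=> x0; exists (x `^ (e.+1%:R)^-1); first exact: powR_gt0.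
by rewrite -powR_mulrn ?powR_ge0// -powRrM mulVf ?powRr1 ?(ltW x0)// pnatr_eq0.
Qed.

(** Let [d = e + 2], [y = m + cQ] and [x = al * (n + cP)]. Completing the power on both sides leaves
    [y ^ d - x ^ d] of order [x ^ e + y ^ e], two degrees lower. Dividing by the cofactor of [y - x]
    gives [|y - x| * x = O(1)], as [thin_linear] requires. The last two hypotheses dispose of small
    [m] and of points lying exactly on the asymptote. *)
Lemma thin_curve (R : realType) (P Q : {poly R}) e (S : nat -> nat -> Prop) :
  size P = e.+3 -> size Q = e.+3 -> 0 < lead_coef P / lead_coef Q ->
  (forall n m, S n m -> P.[n%:R] = Q.[m%:R]) ->
  (forall M, exists N, forall n m, S n m -> (m <= M)%N -> (n <= N)%N) ->
  (forall al be, 0 < al -> al ^+ e.+2 = lead_coef P / lead_coef Q ->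
     be = al * poly_center P - poly_center Q ->
     exists N, forall n m, S n m -> m%:R = al * n%:R + be -> (n <= N)%N) ->
  thin (fun _ n => `[< exists m, S n m >]).
Proof.
move=> sP sQ lPQ SPQ Sfin Sex.
have [al al0 alE] := exists_root e.+1 lPQ.
set cP := poly_center P in Sex; set cQ := poly_center Q in Sex.
have [rP srP PE] := poly_centerE sP; have [rQ srQ QE] := poly_centerE sQ.
rewrite -/cP in PE; rewrite -/cQ in QE.
have lP0 : lead_coef P != 0 by rewrite lead_coef_eq0 -size_poly_eq0 sP.
have lQ0 : lead_coef Q != 0 by rewrite lead_coef_eq0 -size_poly_eq0 sQ.
have eqPQ n m : S n m -> (m%:R + cQ) ^+ e.+2 - (al * (n%:R + cP)) ^+ e.+2 = al ^+ e.+2 * rP.[n%:R] - rQ.[m%:R].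
  move=> /SPQ; rewrite PE QE !hornerE => E.
  rewrite exprMn; apply: (mulfI lQ0); rewrite !mulrBr.
  have aE : lead_coef Q * al ^+ e.+2 = lead_coef P by rewrite alE mulrC divfK.
  rewrite !(mulrA (lead_coef Q) (al ^+ e.+2)) aE.
  apply/eqP; rewrite subr_eq addrAC eq_sym subr_eq -mulrDr addrC -mulrDr; apply/eqP.
  exact: E.
pose KP := (\sum_(i < size rP) `|rP`_i|); pose KQ := (\sum_(i < size rQ) `|rQ`_i|).
have KP0 : 0 <= KP by apply: sumr_ge0.
have KQ0 : 0 <= KQ by apply: sumr_ge0.
(* Beyond these bounds [n + cP >= n / 2] and [m + cQ >= m / 2]. *)
pose N0 := (Num.truncn (2 * `|cP|)).+1; pose M0 := (Num.truncn (2 * `|cQ|)).+1.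
have N0c : 2 * `|cP| <= N0%:R by rewrite ltW// truncnS_gt.
have M0c : 2 * `|cQ| <= M0%:R by rewrite ltW// truncnS_gt.
have [N1 HN1] := Sfin M0.
pose S' n (z : int) := exists2 m, z = m%:Z & [/\ S n m, (N0 <= n)%N & (M0 <= m)%N].
apply: (@thinU 0 _ (fun _ n => (n <= maxn N0 N1)%N) (fun _ n => `[< exists z, S' n z >])).
- move=> B n _ _ /asboolP[m Sm].
  case: (leqP n (maxn N0 N1)) => //=; rewrite gtn_max => /andP[n0 n1].
  apply/asboolP; exists m%:Z; exists m => //; split => //; first exact: ltnW.
  by rewrite leqNgt; apply/negP => /ltnW /(HN1 _ _ Sm); rewrite leqNgt n1.
- by apply: (@thin_fin (maxn N0 N1)) => B n _.
pose C := 2 * (al ^+ e.+2 * KP * (2 / al) ^+ e + KQ * 2 ^+ e) * (2 / al).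
apply: (@thin_linear R S' al (al * cP - cQ) C); last first.
  have [N HN] := Sex al _ al0 alE erefl; exists N => n z [m -> [Sm _ _]].
  exact: HN.
move=> n z [m -> [Sm n0 m0]]; rewrite -pmulrn.
set x := al * (n%:R + cP); set y := m%:R + cQ.
have xn : n%:R <= 2 / al * x.
  rewrite /x mulrA mulfVK ?gt_eqF//.
  have : 2 * `|cP| <= n%:R by rewrite (le_trans N0c)// ler_nat.
  have := lerNnormlW (lexx `|cP|); lra.
have ym : m%:R <= 2 * y.
  have : 2 * `|cQ| <= m%:R by rewrite (le_trans M0c)// ler_nat.
  have := lerNnormlW (lexx `|cQ|); rewrite /y; lra.
have n1 : 1 <= n%:R :> R by rewrite ler1n (leq_trans _ n0).
have m1 : 1 <= m%:R :> R by rewrite ler1n (leq_trans _ m0).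
have x0 : 0 < x by move: xn; rewrite -ler_pdivrMl ?divr_gt0//; apply: lt_le_trans; rewrite mulr_gt0 ?invr_gt0 ?divr_gt0 ?(lt_le_trans ltr01 n1).
have y0 : 0 < y by lra.
have H1 := poly_bound srP n1; have H2 := poly_bound srQ m1.
have H := exprB_ge e (ltW x0) (ltW y0); rewrite eqPQ// in H.
have -> : m%:R - al * n%:R - (al * cP - cQ) = y - x by rewrite /x /y; ring.
rewrite -/KP -/KQ in H1 H2.
have z0 : 0 < x ^+ e + y ^+ e by rewrite addr_gt0 ?exprn_gt0.
have H3 : `|al ^+ e.+2 * rP.[n%:R] - rQ.[m%:R]| <= (al ^+ e.+2 * KP * (2 / al) ^+ e + KQ * 2 ^+ e) * (x ^+ e + y ^+ e).
  apply: (le_trans (ler_normB _ _)); rewrite normrM (ger0_norm (exprn_ge0 _ (ltW al0))).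
  have H4 : n%:R ^+ e <= (2 / al) ^+ e * x ^+ e by rewrite -exprMn lerXn2r ?nnegrE// mulr_ge0 ?divr_ge0 ?ltW.
  have H5 : m%:R ^+ e <= 2 ^+ e * y ^+ e by rewrite -exprMn lerXn2r ?nnegrE// mulr_ge0// ltW.
  rewrite mulrDl lerD//.
    rewrite -2!mulrA ler_wpM2l ?exprn_ge0 ?(ltW al0)// (le_trans H1)// ler_wpM2l// (le_trans H4)//.
    by rewrite ler_wpM2l ?exprn_ge0 ?divr_ge0 ?(ltW al0)// lerDl exprn_ge0// ltW.
  rewrite -mulrA (le_trans H2)// ler_wpM2l// (le_trans H5)//.
  by rewrite ler_wpM2l ?exprn_ge0// lerDr exprn_ge0// ltW.
have H6 : `|y - x| * x <= 2 * (al ^+ e.+2 * KP * (2 / al) ^+ e + KQ * 2 ^+ e).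
  rewrite -(ler_pM2r z0) -[leLHS]mulrA (le_trans H)// -[leRHS]mulrA ler_wpM2l//.
rewrite /C; apply: (@le_trans _ _ (`|y - x| * (2 / al * x))); first by rewrite ler_wpM2l.
by rewrite mulrCA mulrC ler_wpM2r// divr_ge0// ltW.
Qed.

Lemma poly_int_fiber (h : {poly int}) (k : int) : (1 < size h)%N ->
  exists N, forall n : nat, (N <= n)%N -> h.[n%:Z] != k.
Proof.
move=> sh; have [|N HN] := @poly_int_neq0 (h - k%:P).
  apply/eqP => /eqP; rewrite subr_eq0 => /eqP hk; move: sh; rewrite hk size_polyC.
  by case: (k != 0).
by exists N => n /HN; rewrite hornerD hornerN hornerC subr_eq0.
Qed.

Lemma bounded_choice (P : nat -> nat -> Prop) M :
  (forall m, exists N, forall n, (N <= n)%N -> ~ P n m) ->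
  exists N, forall n m, P n m -> (m <= M)%N -> (n <= N)%N.
Proof.
move=> /boolp.choice[N HN]; exists (\max_(m < M.+1) N m) => n m Pnm mM.
rewrite leqNgt; apply/negP => Nn; apply: (HN m n) Pnm; apply: leq_trans (ltnW Nn).
by rewrite (leq_trans _ (leq_bigmax (Ordinal (mM : (m < M.+1)%N)))).
Qed.

Lemma poly_center_scale (R : fieldType) (P : {poly R}) (k : R) : k != 0 ->
  poly_center (k *: P) = poly_center P.
Proof.
by move=> k0; rewrite /poly_center size_scale// coefZ lead_coefZ -[(k * _) *+ _]mulr_natr -[lead_coef P *+ _]mulr_natr -[k * lead_coef P * _]mulrA -mulf_div divff ?mul1r.
Qed.

Lemma separated_no_common_root (R : realType) (h : {poly int}) (x : R) : separated h ->
  (map_poly intr h).[x] = 0 -> (map_poly intr h)^`().[x] = 0 -> False.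
Proof.
move=> [N [U [V [N0 E]]]] h0 h'0.
have := congr1 (fun p => (map_poly (intr : int -> R) p).[x]) E.
rewrite rmorphD !rmorphM /= map_polyC /= hornerC hornerD !hornerM -deriv_map h0 h'0 !mulr0 addr0.
by move/esym/eqP; rewrite intr_eq0 (negbTE N0).
Qed.

Lemma horner_intr (R : realType) (h : {poly int}) (n : nat) :
  (map_poly (intr : int -> R) h).[n%:R] = (h.[n%:Z])%:~R.
Proof. by rewrite pmulrn horner_map. Qed.

Lemma size_map_intr (R : realType) (h : {poly int}) : size (map_poly (intr : int -> R) h) = size h.
Proof. by rewrite size_map_inj_poly//; exact: intr_inj. Qed.

(** The asymptote has slope [al] with [al ^ d = u / v], where [d] is the degree of [h]. For [u = v]
    it is the diagonal, which is excluded. Otherwise arbitrarily large points on it force the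
    identity [u * h = v * h(al X + be)]. At the fixed point [- c] of the affine map this gives
    [h(- c) = 0]; since [- c] is not a double root, differentiating gives [u = v * al]. So
    [al ^ d = al], [al = 1] and [u = v]. *)
Lemma thin_collision (R : realType) (h : {poly int}) (u v : nat) :
  (2 < size h)%N -> separated h -> (0 < u)%N -> (0 < v)%N ->
  thin (fun _ n => `[< exists2 n', (0 < n')%N /\ n' <> n & u%:Z * h.[n%:Z] = v%:Z * h.[n'%:Z] >]).
Proof.
move=> sh seph u0 v0.
pose hR := map_poly (intr : int -> R) h.
have shR : size hR = size h by exact: size_map_intr.
have shE : size h = (size h - 3).+3 by lia.
have uR : u%:R != 0 :> R by rewrite pnatr_eq0 -lt0n.
have vR : v%:R != 0 :> R by rewrite pnatr_eq0 -lt0n.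
have lh : lead_coef hR != 0 by rewrite lead_coef_eq0 -size_poly_eq0 shR shE.
have lE : lead_coef (u%:R *: hR) / lead_coef (v%:R *: hR) = u%:R / v%:R.
  by rewrite !lead_coefZ -mulf_div divff ?mulr1.
apply: (@thin_sub 0 _ (fun _ n => `[< exists m, [/\ (0 < m)%N, m <> n & u%:Z * h.[n%:Z] = v%:Z * h.[m%:Z]] >])).
  by move=> B n _ _ /asboolP[m [m0 mn] E]; apply/asboolP; exists m.
apply: (@thin_curve R (u%:R *: hR) (v%:R *: hR) (size h - 3)).
- by rewrite size_scale// shR.
- by rewrite size_scale// shR.
- by rewrite lE divr_gt0// ltr0n.
- move=> n m [_ _ E]; rewrite !hornerZ !horner_intr.
  by have := congr1 (intr : int -> R) E; rewrite !intrM -!pmulrn.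
- move=> M; apply: bounded_choice => m.
  have [|N HN] := @poly_int_fiber (u%:Z *: h) (v%:Z * h.[m%:Z]).
    by rewrite size_scale ?(ltnW sh)// eqz_nat -lt0n.
  by exists N => n /HN /eqP + [_ _ E]; rewrite hornerZ.
move=> al be al0; rewrite lE !poly_center_scale//; set c := poly_center hR => alE beE.
case: (eqVneq u v) => [uv|uv].
  have al1 : al = 1.
    by apply/eqP; rewrite -(@pexpr_eq1 _ al (size h - 3).+2) ?(ltW al0)// alE uv divff.
  exists 0%N => n m [_ mn _] /eqP; rewrite beE al1 !mul1r subrr addr0 eqr_nat => /eqP.
  by move/mn.
pose F := u%:R *: hR - ((v%:R *: hR) \Po (al *: 'X + be%:P)).
have F0 : F != 0.
  apply/eqP => F0.
  have xE : al * - c + be = - c by rewrite beE; ring.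
  have E1 := congr1 (fun p => p.[- c]) F0.
  have E2 := congr1 (fun p => p^`().[- c]) F0.
  move: E1 E2; rewrite /F deriv0 derivB deriv_comp derivZ derivZ derivD derivZ derivX derivC addr0.
  rewrite alg_polyC !hornerE !horner_comp !hornerE xE => /eqP.
  rewrite -mulrBl mulf_eq0 subr_eq0 eqr_nat (negbTE uv) /= => /eqP h0.
  rewrite mulrAC -mulrBl => /eqP; rewrite mulf_eq0 => /orP[|/eqP h'0]; last first.
    exact: (separated_no_common_root seph h0 h'0).
  rewrite subr_eq0 => /eqP uE.
  have : al ^+ (size h - 3).+2 = al by rewrite alE uE mulrAC divff ?mul1r.
  rewrite -{2}(mulr1 al) exprS => /(mulfI (lt0r_neq0 al0)) /eqP.
  rewrite pexpr_eq1 ?(ltW al0)// => /eqP al1; move: uE; rewrite al1 mulr1 => /eqP.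
  by rewrite eqr_nat (negbTE uv).
have [N HN] := poly_real_neq0 F0; exists N => n m [_ _ E] mE.
rewrite leqNgt; apply/negP => Nn.
have Nn' : N%:R <= n%:R :> R by rewrite ler_nat ltnW.
have /negP := HN _ Nn'; apply.
rewrite /F !hornerE horner_comp !hornerE -mE -/hR !horner_intr subr_eq0.
by have := congr1 (intr : int -> R) E; rewrite !intrM -!pmulrn => ->.
Qed.

(** * Squares of primes of order at least [B]: products, and degrees 1 and 2 *)

Lemma large_square_thin_dvd (h : {poly int}) (k : int) :
  large_square_thin (k *: h) -> large_square_thin h.
Proof.
move=> A K; apply: thin_sub (A K) => B n _ _ /asboolP[p [pp pB] ph].
by apply/asboolP; exists p => //; rewrite hornerZ dvdz_mull.
Unshelve. exact: 0%N.
Qed.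

(** Once [B >= |N| * K], the prime exceeds [|N|] and cannot divide both values, so its square
    divides one of them. *)
Lemma large_square_thinM (h1 h2 U V : {poly int}) (N : int) :
  N != 0 -> U * h1 + V * h2 = N%:P ->
  large_square_thin h1 -> large_square_thin h2 -> large_square_thin (h1 * h2).
Proof.
move=> N0 E A1 A2 K.
apply: (@thinU (`|N| * K)%N) (A1 K) (A2 K) => B n NB nB /asboolP[p [pp pB]].
rewrite hornerM => ph.
have pN : ~~ (p%:Z %| N)%Z.
  rewrite dvdzE /=; apply/negP => /dvdn_leq; rewrite absz_gt0 N0 => /(_ isT) pN.
  by move: pB; rewrite ltnNge (leq_trans _ NB)// leq_mul2r pN orbT.
have p1 : ~~ (p%:Z %| h1.[n%:Z])%Z || ~~ (p%:Z %| h2.[n%:Z])%Z.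
  rewrite -negb_and; apply: contra pN => /andP[d1 d2].
  have := congr1 (fun q => q.[n%:Z]) E; rewrite hornerC hornerD !hornerM => <-.
  by rewrite rpredD ?dvdz_mull.
have aux (x y : int) : ~~ (p%:Z %| x)%Z -> ((p ^ 2)%:Z %| x * y)%Z -> ((p ^ 2)%:Z %| y)%Z.
  by rewrite !dvdzE /= abszM => px; rewrite Gauss_dvdr// coprimeXl// prime_coprime.
case/orP: p1 => p1; apply/orP; [right|left]; apply/asboolP; exists p => //; first exact: aux p1 ph.
by apply: aux p1 _; rewrite mulrC.
Qed.

Lemma horner_bound (h : {poly int}) e : (size h <= e.+1)%N ->
  exists C : nat, forall n : nat, (0 < n)%N -> (`|h.[n%:Z]| <= C * n ^ e)%N.
Proof.
move=> sh; exists (\sum_(i < size h) absz (h`_i)%R)%N => n n0.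
have := @poly_bound int h e n%:Z sh; rewrite lez_nat n0 => /(_ isT).
rewrite -lez_nat abszE PoszM => /le_trans; apply.
rewrite (_ : (n ^ e)%N%:Z = n%:Z ^+ e); last by rewrite -natz natrX natz.
rewrite ler_wpM2r ?exprn_ge0//.
by rewrite (big_morph Posz PoszD (erefl _)) ler_sum// => i _; rewrite abszE.
Qed.

Lemma large_square_thin_linear (h : {poly int}) : size h = 2%N -> large_square_thin h.
Proof.
move=> sh K; have [|N HN] := @poly_int_neq0 h; first by rewrite -size_poly_eq0 sh.
have [C HC] := @horner_bound h 1 (eq_leq sh).
apply: (@thin_fin (maxn N (C * K ^ 2))) => B n /andP[n0 nB] /asboolP[p [pp pB] ph].
rewrite leqNgt gtn_max; apply/negP => /andP[Nn nC].
have := HN n (ltnW Nn); rewrite -absz_gt0 => hn.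
move: ph; rewrite dvdzE /= => /(dvdn_leq hn) /leq_trans /(_ (HC n n0)); rewrite expn1 => pC.
move: pB nC pC; rewrite -!mulnn; clear - n0 nB.
have [->|C0] := posnP C; first nia.
have [->|K0] := posnP K; first nia.
move=> pB nC pC.
have : (B * B < p * K * (p * K))%N by rewrite ltn_mul.
have : (p * p * (K * K) <= C * n * (K * K))%N by rewrite leq_mul2r pC orbT.
have : (C * (K * K) * n <= B * B)%N by rewrite (leq_trans (leq_mul (ltnW nC) nB))// leq_mul2r nB orbT.
lia.
Qed.

(** If [q] and the leading coefficient have opposite signs, [n] is bounded. Otherwise [thin_curve]
    applies, its gap argument replacing the theory of Pell equations; arbitrarily large points on
    the asymptote would make [h = q * (al X + be) ^ 2], with a double root. *)
Lemma thin_quadratic_twist (R : realType) (h : {poly int}) (q : int) :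
  size h = 3%N -> separated h -> q != 0 ->
  thin (fun _ n => `[< exists p : nat, h.[n%:Z] = q * p%:Z ^+ 2 >]).
Proof.
move=> sh seph q0.
pose hR := map_poly (intr : int -> R) h.
have shR : size hR = 3%N by rewrite size_map_intr.
have qR : q%:~R != 0 :> R by rewrite intr_eq0.
pose Q : {poly R} := q%:~R *: 'X^2.
have sQ : size Q = 3%N by rewrite size_scale// size_polyXn.
have lQ : lead_coef Q = q%:~R by rewrite lead_coefZ lead_coefXn mulr1.
have lh : lead_coef hR = (h`_2)%:~R by rewrite lead_coefE shR coef_map.
have h20 : h`_2 != 0 by rewrite -[2%N]/(3.-1) -sh -lead_coefE lead_coef_eq0 -size_poly_eq0 sh.
have hE n : h.[n%:Z] = h`_0 + h`_1 * n%:Z + h`_2 * n%:Z ^+ 2.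
  by rewrite horner_coef sh !big_ord_recl big_ord0 /= expr0 expr1 mulr1 addr0 addrA.
case: (ltrP 0 (h`_2 * q)) => hq; last first.
  apply: (@thin_fin (absz (h`_0)%R + absz (h`_1)%R)%N) => B n /andP[n0 _] /asboolP[p E].
  rewrite leqNgt; apply/negP => nlt; move: E; rewrite hE => E.
  have {}E : h`_2 * (h`_0 + h`_1 * n%:Z + h`_2 * n%:Z ^+ 2) = h`_2 * q * p%:Z ^+ 2 by rewrite E; ring.
  have : h`_2 * q * p%:Z ^+ 2 <= 0 by rewrite mulr_le0_ge0// exprn_ge0.
  rewrite -E leNgt => /negP; apply.
  move: h20 nlt n0; clear; move: h`_2 h`_1 h`_0 => a b c a0 nlt n0.
  have H1 : `|c + b * n%:Z| < n%:Z * n%:Z.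
    rewrite (le_lt_trans (ler_normD _ _))// normrM -!abszE; nia.
  have H2 : n%:Z * n%:Z <= `|a| * (n%:Z * n%:Z).
    by rewrite -[leLHS]mul1r ler_wpM2r// -gtz0_ge1 normr_gt0.
  have sgE : a * (c + b * n%:Z + a * n%:Z ^+ 2) = `|a| * (Num.sg a * (c + b * n%:Z) + `|a| * (n%:Z * n%:Z)).
    by rewrite {1 2}(numEsg a) expr2 mulrDr; have := esym (numEsg a); case: sgrP a0 => //; lia.
  rewrite sgE mulr_gt0 ?normr_gt0//.
  have : `|Num.sg a * (c + b * n%:Z)| < `|a| * (n%:Z * n%:Z).
    by rewrite normrM normr_sg a0 mul1r (lt_le_trans H1).
  move: (Num.sg a * _) (`|a| * _) => x y; lia.
have := @thin_curve R hR Q 0 (fun n p => h.[n%:Z] = q * p%:Z ^+ 2) shR sQ; apply.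
- rewrite lh lQ; have : 0 < (h`_2 * q)%:~R :> R by rewrite ltr0z.
  rewrite intrM => H.
  have -> : (h`_2)%:~R / q%:~R = (h`_2)%:~R * q%:~R / q%:~R ^+ 2 :> R by field.
  by rewrite divr_gt0// exprn_even_gt0.
- move=> n p E; by rewrite horner_intr E /Q hornerZ hornerXn intrM rmorphXn /= -pmulrn.
- move=> M; apply: bounded_choice => m.
  have [|N HN] := @poly_int_fiber h (q * m%:Z ^+ 2); first by rewrite sh.
  by exists N => n /HN /eqP.
move=> al be al0; rewrite lh lQ; set c := poly_center hR => alE.
have -> : poly_center Q = 0 by rewrite /poly_center sQ /= coefZ coefXn mulr0 mul0r.
rewrite subr0 => beE.
pose F := hR - (Q \Po (al *: 'X + be%:P)).
have F0 : F != 0.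
  apply/eqP => F0.
  have xE : al * - c + be = 0 by rewrite beE; ring.
  have E1 := congr1 (fun p => p.[- c]) F0.
  have E2 := congr1 (fun p => p^`().[- c]) F0.
  move: E1 E2; rewrite /F /Q deriv0 derivB deriv_comp derivZ derivXn derivD derivZ derivX derivC addr0.
  rewrite alg_polyC !hornerE !horner_comp !hornerE xE /= ?expr0n ?mulr0 ?mul0r ?subr0 => h0.
  rewrite -addrA xE addr0 mulr0 mul0r subr0 => h'0.
  exact: (separated_no_common_root seph h0 h'0).
have [N HN] := poly_real_neq0 F0; exists N => n m E mE.
rewrite leqNgt; apply/negP => Nn.
have Nn' : N%:R <= n%:R :> R by rewrite ler_nat ltnW.
have /negP := HN _ Nn'; apply.
have lE : (al *: 'X + be%:P).[n%:R] = m%:R by rewrite hornerD hornerZ hornerX hornerC mE.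
by rewrite /F /Q hornerD hornerN horner_comp lE horner_intr E hornerZ hornerXn intrM rmorphXn /= -pmulrn subrr.
Qed.

Lemma large_square_thin_quadratic (R : realType) (h : {poly int}) :
  size h = 3%N -> separated h -> large_square_thin h.
Proof.
move=> sh seph K; have [|N HN] := @poly_int_neq0 h; first by rewrite -size_poly_eq0 sh.
have [C HC] := @horner_bound h 2 (eq_leq sh).
pose s : seq int := [seq i%:Z | i <- iota 1 (C * K ^ 2)] ++ [seq - i%:Z | i <- iota 1 (C * K ^ 2)].
apply: (@thinU 0 _ (fun _ n => (n <= N)%N)
   (fun _ n => `[< exists2 q, q \in s & exists p : nat, h.[n%:Z] = q * p%:Z ^+ 2 >])).
- move=> B n _ /andP[n0 nB] /asboolP[p [pp pB] /dvdzP[q hE]].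
  case: (leqP n N) => //= Nn; apply/asboolP; exists q; last first.
    by exists p; rewrite hE -natz natrX natz.
  have := HN n (ltnW Nn); rewrite -absz_gt0 => hn; have := HC n n0.
  rewrite hE abszM /= => qC.
  have q0 : (0 < `|q|)%N by move: hn; rewrite hE abszM muln_gt0 => /andP[].
  have qCK : (`|q| <= C * K ^ 2)%N.
    rewrite -!mulnn in qC *.
    have pK : (B * B < p * K * (p * K))%N by rewrite ltn_mul.
    have p0 : (0 < p * p)%N by rewrite muln_gt0 prime_gt0.
    rewrite -(leq_pmul2r p0).
    have H1 : (C * (n * n) <= C * (B * B))%N by rewrite leq_mul2l leq_mul// orbT.
    have H2 : (C * (B * B) <= C * (p * K * (p * K)))%N by rewrite leq_mul2l (ltnW pK) orbT.
    apply: (leq_trans qC (leq_trans H1 (leq_trans H2 _))); clear; lia.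
  rewrite mem_cat; apply/orP; case: (lerP 0 q) => q00; [left|right]; apply/mapP; exists `|q|%N.
  + by rewrite mem_iota q0 add1n ltnS.
  + by rewrite gez0_abs.
  + by rewrite mem_iota q0 add1n ltnS.
  + by rewrite ltz0_abs// opprK.
- by apply: (@thin_fin N).
apply: (@thin_bigU _ s 0 _ (fun q _ n => `[< exists p : nat, h.[n%:Z] = q * p%:Z ^+ 2 >])).
  by move=> B n _ _ /asboolP[q qs [p E]]; exists q => //; apply/asboolP; exists p.
move=> q qs; apply: (@thin_quadratic_twist R) => //.
move: qs; rewrite mem_cat => /orP[] /mapP[i]; rewrite mem_iota => /andP[i0 _] ->.
  by rewrite eqz_nat -lt0n.
by rewrite oppr_eq0 eqz_nat -lt0n.
Qed.

(** * Prime numbers *)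

Local Open Scope nat_scope.

Lemma prod_primes_dvd (s : seq nat) n : uniq s -> (forall p, p \in s -> prime p /\ p %| n) ->
  \prod_(p <- s) p %| n.
Proof.
elim: s => [|p s IH] /=; first by rewrite big_nil dvd1n.
move=> /andP[ps us] H; rewrite big_cons Gauss_dvd.
  have [_ ->] := H p (mem_head _ _); apply: IH => // q qs; apply: H; by rewrite inE qs orbT.
have [pp _] := H p (mem_head _ _).
rewrite prime_coprime//; apply/negP => pd; move/negP: ps; apply.
move: pd; elim: s us H {IH} => [|q s IH] /=; first by rewrite big_nil dvdn1 => _ _ /eqP p1; rewrite p1 in pp.
move=> /andP[_ us] H; rewrite big_cons Euclid_dvdM// => /orP[pq|pd]; last first.
  by rewrite inE IH ?orbT// => r; rewrite inE => /orP[/eqP ->|rs]; apply: H; rewrite !inE ?eqxx ?rs ?orbT.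
have [qp _] : prime q /\ q %| n by apply: H; rewrite !inE eqxx orbT.
by move: pq; rewrite dvdn_prime2// => /eqP ->; rewrite mem_head.
Qed.

Lemma bin_central_le m : 'C(m.*2, m) <= 4 ^ m.
Proof.
rewrite -[4]/(2 ^ 2) -expnM mul2n; have := expnDn 1 1 m.*2.
rewrite addn1 => ->; rewrite (bigD1 (inord m)) //= !exp1n !muln1 inordK ?leq_addr//.
by rewrite -addnn ltnS leq_addr.
Qed.

(** Chebyshev's argument: every prime in [(m, 2 m]] divides the central binomial coefficient, which
    is at most [4 ^ m]. *)
Lemma primes_between m : 0 < m -> m ^ count prime (iota m.+1 m) <= 4 ^ m.
Proof.
move=> m0; apply: leq_trans (bin_central_le m).
set s := [seq p <- iota m.+1 m | prime p].
have us : uniq s by rewrite filter_uniq ?iota_uniq.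
apply: (@leq_trans (\prod_(p <- s) p)).
  rewrite -size_filter -/s; have : all (leq m) s.
    by apply/allP => p; rewrite mem_filter mem_iota => /andP[_ /andP[/ltnW]].
  elim: s {us} => [|p s IH] /=; first by rewrite big_nil.
  by move=> /andP[mp /IH H]; rewrite big_cons expnS leq_mul.
apply: dvdn_leq; first by rewrite bin_gt0 -addnn leq_addr.
apply: prod_primes_dvd => // p; rewrite mem_filter mem_iota => /andP[pp /andP[mp p2]]; split => //.
have p2m : p <= m.*2 by move: p2; rewrite addSn ltnS addnn.
have fd : p %| (m.*2)`! by rewrite dvdn_fact// prime_gt0.
have mm : m <= m.*2 by rewrite -addnn leq_addr.
have fm : ~~ (p %| m`!).
  elim: (m) mp {fd p2 p2m mm s us m0} => [|i IH] ip; first by rewrite fact0 dvdn1; case: eqP pp => // ->.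
  rewrite factS Euclid_dvdM// negb_or IH ?(ltnW ip)// andbT.
  by apply/negP => /dvdn_leq; move: ip; clear; lia.
move: fd; rewrite -(bin_fact mm) -addnn addnK Euclid_dvdM// => /orP[//|].
by rewrite Euclid_dvdM// orbb (negbTE fm).
Qed.

Lemma primes_thin : thin (fun _ => prime).
Proof.
case=> [|k]; first by exists 0 => B; rewrite mul0n.
(* For [m >= 2 ^ j0] a power of 2, the interval [(m, 2 m]] contains at most [2 m / j0] primes. *)
pose j0 := 8 * k.+1.
have dy J : j0 * cnt prime (2 ^ (j0 + J)) <= j0 * 2 ^ j0 + 2 * 2 ^ (j0 + J).
  elim: J => [|J IH]; first by rewrite addn0 (leq_trans _ (leq_addr _ _))// leq_mul2l cnt_leB orbT.
  set m := 2 ^ (j0 + J) in IH *.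
  have m0 : 0 < m by rewrite expn_gt0.
  have -> : 2 ^ (j0 + J.+1) = m + m by rewrite addnS expnS mul2n addnn.
  have -> : cnt prime (m + m) = cnt prime m + count prime (iota m.+1 m) by rewrite /cnt iotaD count_cat add1n.
  have := primes_between m0; rewrite {1}/m -[4]/(2 ^ 2) -!expnM leq_exp2l// => H.
  have : j0 * count prime (iota m.+1 m) <= 2 * m by apply: leq_trans H; rewrite leq_mul2r leq_addr orbT.
  move: IH; clear; lia.
exists (2 * k.+1 * 2 ^ j0 + 2 ^ j0) => B BB.
have B0 : 0 < B by apply: leq_trans BB; rewrite addn_gt0 expn_gt0 orbT.
have jB : j0 <= trunc_log 2 B by rewrite trunc_log_max// (leq_trans _ BB)// leq_addl.
have /andP[lo hi] := trunc_log_bounds (isT : 1 < 2) B0.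
have := dy ((trunc_log 2 B).+1 - j0); rewrite subnKC ?(leqW jB)// => H.
have H1 : cnt prime B <= cnt prime (2 ^ (trunc_log 2 B).+1).
  by rewrite -(subnKC (ltnW hi)) /cnt iotaD count_cat leq_addr.
have H2 : j0 * cnt prime B <= j0 * 2 ^ j0 + 4 * B.
  apply: leq_trans (leq_trans H _); first by rewrite leq_mul2l H1 orbT.
  by rewrite expnS leq_add2l; move: lo; clear; lia.
move: BB H2; rewrite /j0; move: (2 ^ _) (cnt _ _) => x y; clear; nia.
Qed.

Fixpoint subprods (s : seq nat) : seq nat :=
  if s is p :: s' then subprods s' ++ map (muln p) (subprods s') else [:: 1].

Lemma size_subprods s : size (subprods s) = 2 ^ size s.
Proof. by elim: s => //= p s IH; rewrite size_cat size_map IH expnS mul2n addnn. Qed.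

Lemma mem_subprods s q : sqfree q -> (forall p, p \in s -> prime p) -> (forall p, prime p -> p %| q -> p \in s) ->
  q \in subprods s.
Proof.
elim: s q => [|p s IH] q sq sp qs /=.
  rewrite inE; case: (ltngtP q 1) => // [|q1].
    by rewrite ltnS leqNgt sqfree_gt0.
  by have := qs _ (pdiv_prime q1) (pdiv_dvd q).
have pp : prime p by apply: sp; exact: mem_head.
have sp' r : r \in s -> prime r by move=> rs; apply: sp; rewrite inE rs orbT.
rewrite mem_cat; case: (boolP (p %| q)) => [/dvdnP[q' qE]|pq]; last first.
  by rewrite IH// => r rp rq; have := qs r rp rq; rewrite inE => /orP[/eqP rE|//]; move: pq; rewrite -rE rq.
apply/orP; right; apply/mapP; exists q'; last by rewrite qE mulnC.
apply: IH => //.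
  by move=> d dq; apply: sq; rewrite qE dvdn_mulr.
move=> r rp rq; have := qs r rp; rewrite qE dvdn_mulr// => /(_ isT); rewrite inE => /orP[/eqP rE|//].
have : p ^ 2 %| q by rewrite qE -mulnn dvdn_pmul2r ?prime_gt0// -rE.
by move=> /sq p1; rewrite p1 in pp.
Qed.

(** Erdos's argument: each [n <= 4 ^ x] is [q * m ^ 2] with [m <= 2 ^ x] and [q] one of the [2 ^ t]
    squarefree products of the [t] primes up to [4 ^ x], so [4 ^ x <= 2 ^ t * 2 ^ x]. *)
Lemma many_primes x : x <= cnt prime (4 ^ x).
Proof.
pose ps := [seq p <- iota 1 (4 ^ x) | prime p].
have : 4 ^ x <= 2 ^ (size ps + x).
  rewrite -{1}(size_iota 1 (4 ^ x)).
  apply: (@leq_trans (size [seq q * m ^ 2 | q <- subprods ps, m <- iota 1 (2 ^ x)])).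
    apply: uniq_leq_size; first exact: iota_uniq.
    move=> n; rewrite mem_iota add1n ltnS => /andP[n0 nx].
    have [q [m [m0 sq nE]]] := sqfree_decomp n0.
    apply/allpairsP; exists (q, m); split => //=; last first.
      rewrite mem_iota m0 add1n ltnS -leq_sqr -expnM mulnC expnM (leq_trans _ nx)//.
      by rewrite nE leq_pmull// sqfree_gt0.
    apply: mem_subprods => //; first by move=> p; rewrite mem_filter => /andP[].
    move=> p pp pq; rewrite mem_filter pp mem_iota prime_gt0// add1n ltnS.
    apply: leq_trans nx; rewrite nE; apply: leq_trans (dvdn_leq (sqfree_gt0 sq) pq) _.
    by rewrite leq_pmulr// expn_gt0 m0.
  by rewrite size_allpairs size_subprods size_iota expnD.
rewrite -[4]/(2 ^ 2) -expnM leq_exp2l// mul2n -addnn leq_add2r => /leq_trans; apply.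
by rewrite addnn -mul2n expnM cntE.
Qed.

(** The explicit upper bound serves to keep the product of the sieving primes below the length of
    the interval being sieved. *)
Lemma exists_primes c r : exists s : seq nat,
  [/\ size s = r, uniq s & forall p, p \in s -> [/\ prime p, c < p & p <= 4 ^ (r + c)]].
Proof.
have H := many_primes (r + c); pose s := [seq p <- iota 1 (4 ^ (r + c)) | prime p && (c < p)].
have rs : r <= size s.
  rewrite size_filter -(leq_add2r c) (leq_trans H)//.
  apply: (@leq_trans (cnt (fun p => prime p && (c < p)) (4 ^ (r + c)) + cnt (fun p => p <= c) (4 ^ (r + c)))).
    by apply: cnt_leU => p _ -> /=; case: leqP.
  by rewrite leq_add2l; apply: cnt_fin.
exists (take r s); split; first by rewrite size_takel.
  by rewrite take_uniq// filter_uniq ?iota_uniq.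
move=> p /mem_take; rewrite mem_filter mem_iota add1n ltnS => /andP[/andP[-> ->] /andP[_ ->]].
by [].
Qed.

(** * Square values of cubics over finite fields *)

(** Here [l] is the order of the field, [s] the second moment of [card_const_cubic_sq], and [o] the
    number of constants of the form [b * v ^ 6]. While [s] is at most [l ^ 3 / 2 + O(l ^ 2)], each
    of these constants adds an excess of [49 / 128 * l ^ 2]; as [o >= 17], [49 * o > 576]. *)
Lemma second_moment_arith (l s o : nat) :
  64 * l * (l * l) + o * (49 * (l * l)) <= 128 * s -> s <= l * (3 * l + l * (l + 3)./2) ->
  l.-1 <= 6 * o -> 99 < l -> False.
Proof.
move=> lo tot cO F100.
have H : 2 * (l * (3 * l + l * (l + 3)./2)) <= l * l * l + 9 * (l * l).
  have : 2 * (l + 3)./2 <= l + 3 by lia.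
  by move: (_./2) => z zl; nia.
have H2 : 49 * o * (l * l) <= 576 * (l * l) by lia.
rewrite leq_pmul2r in H2; last by rewrite muln_gt0; lia.
lia.
Qed.

Section SquareCounts.
Variable F : finFieldType.
Hypothesis F2 : (2%:R : F)%R != 0%R.
Local Open Scope ring_scope.
Implicit Types x y z u v c : F.

Definition is_sq z := [exists y, y ^+ 2 == z].

Lemma is_sqP z : reflect (exists y, y ^+ 2 = z) (is_sq z).
Proof. by apply: (iffP existsP) => [[y /eqP]|[y /eqP]]; exists y. Qed.

Lemma is_sqX y : is_sq (y ^+ 2). Proof. by apply/is_sqP; exists y. Qed.
Lemma is_sq0 : is_sq 0. Proof. by apply/is_sqP; exists 0; rewrite expr0n. Qed.
Lemma is_sqM x y : is_sq x -> is_sq y -> is_sq (x * y).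
Proof. by move=> /is_sqP[a <-] /is_sqP[b <-]; rewrite -exprMn is_sqX. Qed.
Lemma is_sqV x : is_sq x -> is_sq x^-1.
Proof. by move=> /is_sqP[a <-]; rewrite -exprVn is_sqX. Qed.

Lemma is_sq_mul2r x y : y != 0 -> is_sq (x * y ^+ 2) = is_sq x.
Proof.
move=> y0; apply/idP/idP => [/is_sqM/(_ (is_sqX y^-1))|/is_sqM]; last by apply; exact: is_sqX.
by rewrite exprVn mulfK// expf_neq0.
Qed.

Lemma card_le_fibers (T : finType) (A : {set T}) (B : {set F}) (phi : T -> F) k :
  (forall t, t \in A -> phi t \in B) -> (forall x, #|[set t in A | phi t == x]| <= k)%N ->
  (#|A| <= k * #|B|)%N.
Proof.
move=> AB fib; rewrite -sum1_card (partition_big phi (mem B)) //= mulnC -sum_nat_const.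
apply: leq_sum => x _; apply: leq_trans (fib x); rewrite -sum1_card.
by rewrite (eq_bigl (mem [set t in A | phi t == x]))// => t; rewrite !inE.
Qed.

Lemma card_roots (A : {set F}) (p : {poly F}) k : p != 0 -> (size p <= k.+1)%N ->
  (forall x, x \in A -> root p x) -> (#|A| <= k)%N.
Proof.
move=> p0 sp Ap; rewrite cardE -ltnS (leq_trans _ sp)//; apply: max_poly_roots => //.
  by apply/allP => x; rewrite mem_enum => /Ap.
exact: enum_uniq.
Qed.

Lemma sq_opp_neq y : y != 0 -> y != - y.
Proof. by move=> y0; rewrite -subr_eq0 opprK -mulr2n -mulr_natr mulf_neq0. Qed.

Lemma card_sq_nz : (2 * #|[set z | is_sq z && (z != 0%R)]| = #|F|.-1)%N.
Proof.
have -> : #|F|.-1 = #|[set y : F | y != 0]|.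
  have -> : [set y : F | y != 0] = ~: [set 0] by apply/setP => y; rewrite !inE.
  by rewrite cardsC1.
rewrite -[RHS]sum1_card (partition_big (fun y => y ^+ 2) (mem [set z | is_sq z && (z != 0%R)])); last first.
  by move=> y; rewrite !inE is_sqX => y0; rewrite expf_neq0.
rewrite mulnC -sum_nat_const; apply: eq_bigr => z; rewrite inE => /andP[/is_sqP[y <-] y20].
have y0 : y != 0 by apply: contraNneq y20 => ->; rewrite expr0n.
rewrite sum1_card -[LHS](_ : #|[set y; - y]| = _).
  apply: eq_card => x; rewrite !inE unfold_in /= !inE eqf_sqr andbC.
  by case: eqVneq => [->|_] //=; rewrite ?y0//; case: eqVneq => // ->; rewrite oppr_eq0 y0.
by rewrite cards2 sq_opp_neq.
Qed.

Lemma card_sq : (2 * #|[set z | is_sq z]| = #|F|.+1)%N.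
Proof.
have -> : [set z | is_sq z] = 0 |: [set z | is_sq z && (z != 0%R)].
  by apply/setP => z; rewrite !inE; case: eqVneq => [->|_]; rewrite ?is_sq0 ?andbT.
rewrite cardsU1 !inE eqxx andbF mulnDr card_sq_nz.
have : (0 < #|F|)%N by apply/card_gt0P; exists 0.
by case: #|F| => // n _; rewrite add2n.
Qed.

Lemma card_nonsq : (2 * #|[set z | ~~ is_sq z]| = #|F|.-1)%N.
Proof.
have := cardsC [set z | is_sq z]; have -> : ~: [set z | is_sq z] = [set z | ~~ is_sq z] by apply/setP => z; rewrite !inE.
have := card_sq; rewrite -cardsT; lia.
Qed.

(** Multiplication by [x] maps the nonzero squares into the non-squares, and the two sets have equal
    size; so [y = x * z] with [z] a square. *)
Lemma nonsqM x y : ~~ is_sq x -> ~~ is_sq y -> is_sq (x * y).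
Proof.
move=> nx ny; have x0 : x != 0 by apply: contraNneq nx => ->; exact: is_sq0.
have sub : [set x * z | z in [set z | is_sq z && (z != 0%R)]] \subset [set z | ~~ is_sq z].
  apply/fintype.subsetP => _ /imsetP[z + ->]; rewrite !inE => /andP[zs z0]; apply: contra nx => xz.
  by have := is_sqM xz (is_sqV zs); rewrite mulfK.
have eqc : #|[set x * z | z in [set z | is_sq z && (z != 0%R)]]| = #|[set z | ~~ is_sq z]|.
  rewrite card_imset; last exact: mulfI.
  have := card_sq_nz; have := card_nonsq; lia.
have := subset_cardP eqc sub => /(_ y); rewrite inE ny => /imsetP[z]; rewrite inE => /andP[zs _] ->.
by rewrite mulrA -expr2 is_sqM ?is_sqX.
Qed.

Lemma card_linear_sq (c d : F) : c != 0 -> (2 * #|[set x | is_sq (c * x + d)%R]| = #|F|.+1)%N.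
Proof.
move=> c0; rewrite -card_sq; congr (2 * _)%N.
rewrite -(card_imset _ (f := fun x => c * x + d)); last by move=> x y /addIr /(mulfI c0).
apply: eq_card => z; rewrite inE; apply/imsetP/idP => [[x + ->]|zs]; first by rewrite inE.
by exists ((z - d) / c); rewrite ?inE mulrC divfK// subrK.
Qed.

(* If [u] is not a square and [x = x1 u] as below, then [f (u * x) = u ^ 3 * f x] for
   [f x = x ^ 3 + a x + b], so exactly one of [f x], [f (u * x)] is a square. *)
Lemma card_cubic_sq (a b k : F) : a != 0 -> b != 0 -> k != 0 -> (30 <= #|F|)%N ->
  (16 * #|[set x | is_sq (k * (x ^+ 3 + a * x + b))%R]| <= 15 * #|F|)%N.
Proof.
move=> a0 b0 k0 F30.
pose f x := x ^+ 3 + a * x + b.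
pose NS := [set x | ~~ is_sq (k * f x)%R].
have c_eq : (#|[set x | is_sq (k * f x)%R]| + #|NS| = #|F|)%N.
  by rewrite -[RHS](cardsC [set x | is_sq (k * f x)%R]); congr (_ + _)%N; apply: eq_card => x; rewrite !inE.
suff : (#|F| <= 16 * #|NS|)%N.
  rewrite -[X in (16 * X <= _)%N]/(#|[set x | is_sq (k * f x)%R]|).
  by move: c_eq; move: #|[set x | _]| #|NS| #|F|; clear; lia.
pose U := [set u | ~~ is_sq u && (u != -1)].
have cU : (#|F|.-1 <= 2 * #|U|.+1)%N.
  rewrite -card_nonsq leq_mul2l /=; apply: (@leq_trans #|(-1)%R |: U|).
    by apply: subset_leq_card; apply/fintype.subsetP => z; rewrite !inE => ->; rewrite orbN.
  by rewrite cardsU1 -add1n leq_add2r leq_b1.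
(* The solution [x] of [f (u * x) = u ^ 3 * f x], after cancelling [1 - u]. *)
pose x1 u := - (b / a) * (1 + (u ^+ 2 + u)^-1).
have Uu u : u \in U -> [/\ u != 0, u + 1 != 0 & ~~ is_sq u].
  rewrite inE => /andP[nu u1]; split => //; first by apply: contraNneq nu => ->; exact: is_sq0.
  by rewrite addr_eq0.
have fE u : u \in U -> f (u * x1 u) = u ^+ 3 * f (x1 u).
  move=> /Uu[u0 u1 _]; rewrite /f /x1.
  have -> : u ^+ 2 + u = u * (u + 1) by ring.
  by field; rewrite a0 u0 u1.
have rE x : ('X^3 + a *: 'X + b%:P).[x] = f x by rewrite !hornerD hornerXn hornerZ hornerX hornerC.
have dich u : u \in U -> [|| x1 u \in NS, u * x1 u \in NS | root ('X^3 + a *: 'X + b%:P) (x1 u)].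
  move=> uU; have [u0 _ nu] := Uu _ uU.
  rewrite !inE; case: (boolP (is_sq (k * f (x1 u)))) => //= s1.
  case: (boolP (is_sq (k * f (u * x1 u)))) => //= s2.
  rewrite rootE rE; apply: contraNT nu => f0.
  have := is_sqM s1 s2; rewrite fE//.
  have -> : k * f (x1 u) * (k * (u ^+ 3 * f (x1 u))) = u * (u * k * f (x1 u)) ^+ 2 by ring.
  by rewrite is_sq_mul2r// !mulf_neq0.
have p1E c u : (c *: ('X^2 + 'X) + 1%:P).[u] = c * (u ^+ 2 + u) + 1.
  by rewrite hornerD hornerZ hornerD hornerXn hornerX hornerC.
have p2E c u : ('X^2 + c *: 'X + c%:P).[u] = u ^+ 2 + c * u + c.
  by rewrite !hornerD hornerZ hornerXn hornerX hornerC.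
have fib1 x : (#|[set u in U | x1 u == x]| <= 2)%N.
  apply: (@card_roots _ ((x * a / b + 1) *: ('X^2 + 'X) + 1%:P)).
  - apply/eqP => /(congr1 (fun p : {poly F} => p.[0])); rewrite p1E expr0n addr0 mulr0 add0r horner0 => /eqP.
    by rewrite oner_eq0.
  - rewrite (leq_trans (size_polyD _ _))// geq_max (leq_trans (size_polyC_leq1 _)) ?andbT// (leq_trans (size_scale_leq _ _))//.
    by rewrite (leq_trans (size_polyD _ _))// size_polyXn size_polyX.
  move=> u; rewrite inE => /andP[/Uu[u0 u1 _] /eqP <-]; rewrite rootE p1E /x1.
  have -> : u ^+ 2 + u = u * (u + 1) by ring.
  apply/eqP; field; by rewrite a0 b0 u0 u1.
have fib2 x : (#|[set u in U | (u * x1 u)%R == x]| <= 2)%N.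
  apply: (@card_roots _ ('X^2 + (1 + x * a / b) *: 'X + (1 + x * a / b)%:P)).
  - by rewrite -size_poly_eq0 -addrA size_polyDl ?size_polyXn// (leq_ltn_trans (size_polyD _ _))// gtn_max
      (leq_ltn_trans (size_scale_leq _ _)) ?size_polyX// (leq_ltn_trans (size_polyC_leq1 _)).
  - by rewrite -addrA size_polyDl ?size_polyXn// (leq_ltn_trans (size_polyD _ _))// gtn_max
      (leq_ltn_trans (size_scale_leq _ _)) ?size_polyX// (leq_ltn_trans (size_polyC_leq1 _)).
  move=> u; rewrite inE => /andP[/Uu[u0 u1 _] /eqP <-]; rewrite rootE p2E /x1.
  have -> : u ^+ 2 + u = u * (u + 1) by ring.
  apply/eqP; field; by rewrite a0 b0 u0 u1.
pose Rt := [set x | root ('X^3 + a *: 'X + b%:P) x].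
have cR : (#|Rt| <= 3)%N.
  have s4 : size ('X^3 + a *: 'X + b%:P) = 4%N.
    by rewrite -addrA size_polyDl ?size_polyXn// (leq_ltn_trans (size_polyD _ _))// gtn_max
      (leq_ltn_trans (size_scale_leq _ _)) ?size_polyX// (leq_ltn_trans (size_polyC_leq1 _)).
  apply: (@card_roots _ ('X^3 + a *: 'X + b%:P)); rewrite ?s4//.
    by rewrite -size_poly_eq0 s4.
  by move=> x; rewrite inE.
have sub3 : (#|U| <= #|[set u in U | x1 u \in NS]| + #|[set u in U | (u * x1 u)%R \in NS]| + #|[set u in U | x1 u \in Rt]|)%N.
  apply: (@leq_trans #|[set u in U | x1 u \in NS] :|: [set u in U | (u * x1 u)%R \in NS] :|: [set u in U | x1 u \in Rt]|).
    apply: subset_leq_card; apply/fintype.subsetP => u uU; have := dich u uU.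
    move=> /or3P[] H; rewrite !finset.in_setU; apply/orP; [left; apply/orP; left|left; apply/orP; right|right].
    - by rewrite finset.in_set uU.
    - by rewrite finset.in_set uU.
    - by rewrite finset.in_set uU finset.in_set.
  by rewrite (leq_trans (leq_card_setU _ _))// leq_add2r leq_card_setU.
have fibsub (T : finType) (A : {set T}) (phi : T -> F) x (Q : pred T) :
   (#|[set t in [set t in A | Q t] | phi t == x]| <= #|[set t in A | phi t == x]|)%N.
  by apply: subset_leq_card; apply/fintype.subsetP => t; rewrite !inE => /andP[/andP[-> _] ->].
have c1 : (#|[set u in U | x1 u \in NS]| <= 2 * #|NS|)%N.
  by apply: (@card_le_fibers _ _ _ x1) => [u|x]; [rewrite inE => /andP[]|rewrite (leq_trans (fibsub _ _ _ _ _))].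
have c2 : (#|[set u in U | (u * x1 u)%R \in NS]| <= 2 * #|NS|)%N.
  by apply: (@card_le_fibers _ _ _ (fun u => u * x1 u)) => [u|x]; [rewrite inE => /andP[]|rewrite (leq_trans (fibsub _ _ _ _ _))].
have c3 : (#|[set u in U | x1 u \in Rt]| <= 2 * #|Rt|)%N.
  by apply: (@card_le_fibers _ _ _ x1) => [u|x]; [rewrite inE => /andP[]|rewrite (leq_trans (fibsub _ _ _ _ _))].
(* With [l] the order of [F]: [(l - 3) / 2 <= #|U| <= 4 * #|NS| + 6], so
   [16 * #|NS| >= 2 * (l - 15) >= l] as [l >= 30]. *)
move: cU sub3 c1 c2 c3 cR F30; clear; lia.
Qed.

(** The points [x1 u] of the previous argument require [a != 0]; here a second moment over all
    constants [c] is used. If [x ^ 3 != y ^ 3], the values at [x] and [y] are both squares or both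
    non-squares for about half of the [c], so the sum of [D c ^ 2 + G c ^ 2] is at most
    [l ^ 3 / 2 + O(l ^ 2)]. Each term is at least [l ^ 2 / 2], and much more if [G c < l / 16]; but
    [G] takes the value [G b] at all [b * v ^ 6], which are at least [(l - 1) / 6] constants. *)
Lemma card_const_cubic_sq (b k : F) : b != 0 -> k != 0 -> (100 <= #|F|)%N ->
  (16 * #|[set x | is_sq (k * (x ^+ 3 + b))%R]| <= 15 * #|F|)%N.
Proof.
move=> b0 k0 F100.
pose D c := #|[set x | is_sq (k * (x ^+ 3 + c))%R]|.
pose G c := #|[set x | ~~ is_sq (k * (x ^+ 3 + c))%R]|.
pose l := #|F|.
have DG c : (D c + G c = l)%N.
  by rewrite /D /G /l -(cardsC [set x | is_sq (k * (x ^+ 3 + c))%R]); congr (_ + _)%N; apply: eq_card => x; rewrite !inE.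
pose con (x y c : F) := is_sq (k * (x ^+ 3 + c)) == is_sq (k * (y ^+ 3 + c)).
have conE c : (\sum_x \sum_y con x y c = D c * D c + G c * G c)%N.
  have sD : (\sum_(x : F) is_sq (k * (x ^+ 3 + c))%R = D c)%N.
    by rewrite /D -sum1_card [RHS]big_mkcond; apply: eq_bigr => x _; rewrite inE; case: is_sq.
  have sG : (\sum_(x : F) ~~ is_sq (k * (x ^+ 3 + c))%R = G c)%N.
    by rewrite /G -sum1_card [RHS]big_mkcond; apply: eq_bigr => x _; rewrite inE; case: is_sq.
  rewrite -{1}sD -{1}sG !big_distrl -big_split; apply: eq_bigr => x _.
  rewrite -sD -sG !big_distrr -big_split; apply: eq_bigr => y _; rewrite /con.
  by case: (is_sq _); case: (is_sq _).
have up x y : (\sum_c con x y c <= if (x ^+ 3 == y ^+ 3)%R then l else (l + 3)./2)%N.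
  have -> : (\sum_c con x y c = #|[set c | con x y c]|)%N.
    by rewrite -sum1_card [RHS]big_mkcond; apply: eq_bigr => c _; rewrite inE; case: ifP.
  case: (eqVneq (x ^+ 3) (y ^+ 3)) => xy; first exact: max_card.
  (* Agreement makes the product, hence the quotient, of the two values a square, and the quotient
     is an injective homography in [c]. *)
  have sub : [set c | con x y c] \subset (- y ^+ 3)%R |: [set c | (c != - y ^+ 3)%R && is_sq ((x ^+ 3 + c) / (y ^+ 3 + c))%R].
    apply/fintype.subsetP => c; rewrite !inE => cxy; case: eqVneq => //= cy.
    have yc : y ^+ 3 + c != 0 by rewrite addrC addr_eq0.
    have -> : (x ^+ 3 + c) / (y ^+ 3 + c) = (k * (x ^+ 3 + c)) * (k * (y ^+ 3 + c)) * ((k * (y ^+ 3 + c))^-1) ^+ 2.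
      by field; rewrite k0 yc.
    rewrite is_sq_mul2r ?invr_eq0 ?mulf_neq0//.
    move: cxy; rewrite /con; case: (boolP (is_sq (k * (x ^+ 3 + c)))) => sx /eqP; case: (boolP (is_sq (k * (y ^+ 3 + c)))) => // sy _.
      exact: is_sqM.
    exact: nonsqM.
  have inj : {in [set c | (c != - y ^+ 3)%R && is_sq ((x ^+ 3 + c) / (y ^+ 3 + c))%R] &, injective (fun c => (x ^+ 3 + c) / (y ^+ 3 + c))}.
    move=> c c'; rewrite !inE => /andP[cy _] /andP[c'y _] /eqP.
    rewrite eqr_div 1?addrC ?addr_eq0// 1?addrC ?addr_eq0// => /eqP E; apply/eqP.
    have : (x ^+ 3 - y ^+ 3) * (c' - c) = 0.
      have -> : (x ^+ 3 - y ^+ 3) * (c' - c) = (x ^+ 3 + c) * (y ^+ 3 + c') - (x ^+ 3 + c') * (y ^+ 3 + c) by ring.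
      by rewrite E subrr.
    by move/eqP; rewrite mulf_eq0 subr_eq0 (negbTE xy) subr_eq0 /= eq_sym.
  have c1 := subset_leq_card sub.
  have c2 : (#|[set c | (c != - y ^+ 3)%R && is_sq ((x ^+ 3 + c) / (y ^+ 3 + c))%R]| <= #|[set z | is_sq z]|)%N.
    rewrite -(card_in_imset inj); apply: subset_leq_card; apply/fintype.subsetP => _ /imsetP[c + ->].
    by rewrite !inE => /andP[].
  move: c1; rewrite cardsU1; have := card_sq; rewrite -/l; move: c2.
  move: #|[set c | con x y c]| #|[set c | _ && _]| #|[set z | is_sq z]| => p q r; case: (_ \notin _) => /=; clear; lia.
have cub y : (#|[set x | x ^+ 3 == y ^+ 3]| <= 3)%N.
  apply: (@card_roots _ ('X^3 - (y ^+ 3)%:P)); rewrite ?size_XnsubC//.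
    by rewrite -size_poly_eq0 size_XnsubC.
  by move=> x; rewrite inE rootE !hornerE subr_eq0.
have tot : (\sum_c (D c * D c + G c * G c) <= l * (3 * l + l * (l + 3)./2))%N.
  rewrite (eq_bigr _ (fun c _ => esym (conE c))) exchange_big /=.
  apply: (@leq_trans (\sum_(x : F) (3 * l + l * (l + 3)./2))%N); last by rewrite sum_nat_const.
  apply: leq_sum => x _; rewrite exchange_big /=.
  apply: (@leq_trans (\sum_(y : F) ((x ^+ 3 == y ^+ 3)%R * l + (l + 3)./2))%N).
    apply: leq_sum => y _; apply: leq_trans (up x y) _.
    by case: ifP => _ /=; rewrite ?mul1n ?leq_addr.
  rewrite big_split /= sum_nat_const leq_add2r -big_distrl /= leq_mul2r; apply/orP; right.
  apply: leq_trans (cub x); rewrite -sum1_card [leqRHS]big_mkcond; apply: leq_sum => y _.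
  by rewrite inE eq_sym; case: ifP.
(* Passing from [x] to [v ^ 2 * x] multiplies the value by the square [(v ^ 3) ^ 2]. *)
have scale v : v != 0 -> G (b * v ^+ 6) = G b.
  move=> v0; rewrite /G -[RHS](card_imset _ (f := fun x => v ^+ 2 * x)); last exact/mulfI/expf_neq0.
  apply: eq_card => x; rewrite inE.
  have E y : k * ((v ^+ 2 * y) ^+ 3 + b * v ^+ 6) = k * (y ^+ 3 + b) * (v ^+ 3) ^+ 2 by ring.
  apply/idP/imsetP => [xs|[y + ->]]; last by rewrite inE E is_sq_mul2r ?expf_neq0.
  have v2 : v ^+ 2 != 0 by rewrite expf_neq0.
  have vx : v ^+ 2 * (x / v ^+ 2) = x by rewrite mulrC divfK.
  exists (x / v ^+ 2); last by rewrite vx.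
  by rewrite inE -(@is_sq_mul2r _ (v ^+ 3)) ?expf_neq0// -E vx.
pose O := [set b * v ^+ 6 | v in [set v : F | v != 0%R]].
have cO : (l.-1 <= 6 * #|O|)%N.
  have -> : l.-1 = #|[set v : F | v != 0%R]|.
    have -> : [set y : F | y != 0%R] = ~: [set 0%R] by apply/setP => y; rewrite !inE.
    by rewrite cardsC1.
  apply: (@card_le_fibers _ _ _ (fun v => b * v ^+ 6)) => [v vF|x]; first exact: imset_f.
  apply: (@card_roots _ (b *: 'X^6 - x%:P)).
  - by rewrite -size_poly_eq0 size_polyDl ?size_scale ?size_polyXn// size_polyN (leq_ltn_trans (size_polyC_leq1 _)).
  - by rewrite size_polyDl ?size_scale ?size_polyXn// size_polyN (leq_ltn_trans (size_polyC_leq1 _)).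
  by move=> v; rewrite inE => /andP[_ /eqP <-]; rewrite rootE hornerD hornerN hornerZ hornerXn hornerC subrr.
have OG c : c \in O -> G c = G b by move=> /imsetP[v]; rewrite inE => v0 ->; exact: scale.
suff GB : (l <= 16 * G b)%N.
  rewrite -[X in (16 * X <= _)%N]/(D b) -/l; move: (DG b) GB; clear; lia.
rewrite leqNgt; apply/negP => GB.
have DG2 c : (l * l <= 2 * (D c * D c + G c * G c))%N.
  rewrite -(DG c); move: (D c) (G c) => d g; clear.
  have : (2 * (d * g) <= d * d + g * g)%N.
    by case: (leqP d g) => [|/ltnW] H; rewrite -(subnKC H); move: (_ - _)%N => z; lia.
  lia.
(* If [G c < l / 16], then [D c ^ 2 + G c ^ 2] is at least [(15 ^ 2 + 1) / 16 ^ 2 * l ^ 2 = 113 /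
   128 * l ^ 2]. *)
have DG3 c : c \in O -> (113 * (l * l) <= 64 * (2 * (D c * D c + G c * G c)))%N.
  move=> cO'; have := DG c; rewrite (OG _ cO'); move: (D c) (G b) GB => d g gl; clear -gl => E.
  have dg : (15 * g <= d)%N by lia.
  by rewrite -E -(subnKC dg); move: (d - _)%N => z; clear; lia.
have lo : (64 * l * (l * l) + #|O| * (49 * (l * l)) <= 128 * \sum_c (D c * D c + G c * G c))%N.
  rewrite -[X in (X + _ <= _)%N]mulnA [X in (_ * X + _ <= _)%N](_ : _ = \sum_(c : F) (l * l))%N; last by rewrite sum_nat_const.
  rewrite -sum_nat_const [X in (_ + X <= _)%N]big_mkcond !big_distrr -big_split /=.
  apply: leq_sum => c _; case: ifP => [/DG3|_]; have := DG2 c; move: (_ * _ + _)%N (l * l)%N => p q; clear; lia.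
move: lo tot cO F100; rewrite -/l.
move=> lo tot cO F100; exact: second_moment_arith lo tot cO F100.
Qed.

End SquareCounts.

(** * Cubic polynomials *)

Local Open Scope ring_scope.

Definition depressed_cubic (R : comNzRingType) (a b x : R) : R := x ^+ 3 + a * x + b.

(* The polynomial [s * H (nu + q t) / q] in [t], where [H nu = q * h0]. *)
Definition cubic_quot (R : comNzRingType) (a s nu q h0 t : R) : R :=
  s * (h0 + (3 * nu ^+ 2 + a) * t + 3 * nu * q * t ^+ 2 + q ^+ 2 * t ^+ 3).

Lemma cubic_quotE (R : comNzRingType) (a b s nu q h0 t : R) :
  depressed_cubic a b nu = q * h0 ->
  q * cubic_quot a s nu q h0 t = s * depressed_cubic a b (nu + q * t).
Proof.
move=> H; have -> : depressed_cubic a b (nu + q * t) = depressed_cubic a b nu +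
    q * ((3 * nu ^+ 2 + a) * t + 3 * nu * q * t ^+ 2 + q ^+ 2 * t ^+ 3).
  by rewrite /depressed_cubic; ring.
by rewrite H /cubic_quot; ring.
Qed.

Lemma rmorph_depressed_cubic (R S : comNzRingType) (f : {rmorphism R -> S}) a b x :
  f (depressed_cubic a b x) = depressed_cubic (f a) (f b) (f x).
Proof. by rewrite /depressed_cubic !(rmorphXn, rmorphD, rmorphM). Qed.

Lemma rmorph_cubic_quot (R S : comNzRingType) (f : {rmorphism R -> S}) a s nu q h0 t :
  f (cubic_quot a s nu q h0 t) = cubic_quot (f a) (f s) (f nu) (f q) (f h0) (f t).
Proof. by rewrite /cubic_quot !(rmorph_nat, rmorphXn, rmorphD, rmorphM). Qed.

(** The discriminant condition keeps the roots modulo [l] simple. The conditions on [b] and [a] put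
    the reduction into one of the two cases of the square count, [a = 0] being decided over the
    integers. *)
Definition sieving_prime (a b : int) (l : nat) : bool :=
  [&& prime l, (100 <= l)%N, ~~ (l%:Z %| 4 * a ^+ 3 + 27 * b ^+ 2)%Z, ~~ (l%:Z %| b)%Z &
      (a == 0) || ~~ (l%:Z %| a)%Z].

Lemma sieving_prime_large (a b : int) : b != 0 -> 4 * a ^+ 3 + 27 * b ^+ 2 != 0 ->
  exists c, forall l, prime l -> (c < l)%N -> sieving_prime a b l.
Proof.
move=> b0 d0; set d := 4 * _ + _ in d0.
exists (100 + `|d| + `|b| + `|a|)%N => l pl cl.
have ndvd (x : int) : x != 0 -> (`|x| < l)%N -> ~~ (l%:Z %| x)%Z.
  move=> x0 xl; rewrite dvdzE /=; apply/negP => /dvdn_leq; rewrite absz_gt0 x0 => /(_ isT).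
  by rewrite leqNgt xl.
have [d1 [b1 [a1 l1]]] : (`|d| < l /\ `|b| < l /\ `|a| < l /\ 100 <= l)%N by move: cl; clear; lia.
rewrite /sieving_prime pl l1 -/d (ndvd _ d0 d1) (ndvd _ b0 b1) /=.
by case: (eqVneq a 0) => //= a0; exact: ndvd.
Qed.

Lemma Fp_intr_eq0 (l : nat) (z : int) : prime l -> ((z%:~R : 'F_l) == 0) = (l%:Z %| z)%Z.
Proof.
move=> pl; rewrite dvdzE /=; case: (intP z) => [|m|m]; rewrite ?abszN ?rmorph0 ?eqxx ?dvdn0// ?rmorphN ?oppr_eq0 /=;
by rewrite -pmulrn -(dvdn_pcharf (pchar_Fp pl)).
Qed.

Lemma count_Fp (l : nat) (P : pred 'F_l) : prime l ->
  count (fun t : nat => P t%:R) (iota 0 l) = #|[set x | P x]|.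
Proof.
move=> pl; have l1 := prime_gt1 pl.
have E : Zp_trunc (pdiv l) = l.-2 by rewrite /Zp_trunc pdiv_id.
have sE : (l.-2).+2 = l by lia.
have un : uniq [seq (t%:R : 'F_l) | t <- iota 0 l].
  rewrite map_inj_in_uniq ?iota_uniq// => x y; rewrite !mem_iota !add0n => /andP[_ xl] /andP[_ yl].
  by move=> /(congr1 val) /=; rewrite !val_Fp_nat// !modn_small.
have pe : perm_eq [seq (t%:R : 'F_l) | t <- iota 0 l] (enum 'F_l).
  apply: uniq_perm; rewrite ?enum_uniq// => x; rewrite mem_enum inE.
  have /(uniq_min_size un) [] : {subset [seq (t%:R : 'F_l) | t <- iota 0 l] <= enum 'F_l}.
    by move=> z _; rewrite mem_enum.
  - by rewrite -cardE card_Fp// size_map size_iota.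
  - by move=> _ ->; rewrite mem_enum.
rewrite -[LHS](count_map (fun t : nat => t%:R : 'F_l) P) (permP pe).
by rewrite -sum1_count -sum1_card big_enum_cond; apply: eq_bigl => x; rewrite inE.
Qed.

(** The bound has to be uniform in [q]. If [l] divides [q], the quotient is linear in [t] modulo
    [l], with slope [s * (3 * nu ^ 2 + a)] nonzero because [nu] is a simple root. Otherwise
    [z = nu + q * t] turns it into [s / q] times the depressed cubic. *)
Lemma cubic_quot_count (a b s nu h0 : int) (q l : nat) :
  sieving_prime a b l -> s ^+ 2 = 1 -> depressed_cubic a b nu = q%:Z * h0 ->
  (16 * count (fun t : nat => is_sq ((cubic_quot a s nu q%:Z h0 t%:Z)%:~R : 'F_l)) (iota 0 l) <= 15 * l)%N.
Proof.
case/and5P => pl l100 ld lb la s1 H.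
have F2 : (2%:R : 'F_l) != 0.
  by rewrite -(dvdn_pcharf (pchar_Fp pl)); apply/negP => /dvdn_leq; move: l100; clear; lia.
have cF : #|'F_l| = l by rewrite card_Fp.
pose A : 'F_l := a%:~R; pose B : 'F_l := b%:~R; pose S : 'F_l := s%:~R.
pose NU : 'F_l := nu%:~R; pose Q : 'F_l := q%:R; pose H0 : 'F_l := h0%:~R.
have HF : depressed_cubic A B NU = Q * H0.
  by have := congr1 (intr : int -> 'F_l) H; rewrite rmorph_depressed_cubic rmorphM.
have S2 : S ^+ 2 = 1 by rewrite /S -rmorphXn s1.
have S0 : S != 0 by rewrite -sqrf_eq0 S2 oner_eq0.
have B0 : B != 0 by rewrite /B Fp_intr_eq0.
rewrite (eq_count (a2 := fun t : nat => is_sq (cubic_quot A S NU Q H0 t%:R))); last first.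
  by move=> t /=; congr is_sq; rewrite rmorph_cubic_quot.
have -> := @count_Fp l (fun x => is_sq (cubic_quot A S NU Q H0 x)) pl.
case: (eqVneq Q 0) => Q0.
  have C0 : 3 * NU ^+ 2 + A != 0.
    apply/eqP => C0; have : (4 * a ^+ 3 + 27 * b ^+ 2)%:~R = 0 :> 'F_l.
      have hnu : depressed_cubic A B NU = 0 by rewrite HF Q0 mul0r.
      have aE : A = - (3 * NU ^+ 2) by apply/eqP; rewrite -addr_eq0 addrC C0.
      have bE : B = 2 * NU ^+ 3 by rewrite -[RHS]add0r -hnu /depressed_cubic aE; ring.
      have -> : (4 * a ^+ 3 + 27 * b ^+ 2)%:~R = 4 * A ^+ 3 + 27 * B ^+ 2.
        by rewrite !(rmorph_nat, rmorphXn, rmorphD, rmorphM).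
      rewrite bE aE; ring.
    by move/eqP; rewrite Fp_intr_eq0// (negbTE ld).
  have -> : [set x | is_sq (cubic_quot A S NU Q H0 x)] = [set x | is_sq (S * (3 * NU ^+ 2 + A) * x + S * H0)].
    by apply/setP => x; rewrite !inE /cubic_quot Q0; congr is_sq; ring.
  have := card_linear_sq F2 (S * H0) (mulf_neq0 S0 C0).
  rewrite cF; move: #|_| l100; clear; lia.
have -> : #|[set x | is_sq (cubic_quot A S NU Q H0 x)]| = #|[set z | is_sq (S / Q * depressed_cubic A B z)]|.
  rewrite -(card_imset _ (f := fun x => NU + Q * x)); last by move=> x y /addrI /(mulfI Q0).
  have E x : cubic_quot A S NU Q H0 x = S / Q * depressed_cubic A B (NU + Q * x).
    by apply: (mulfI Q0); rewrite (cubic_quotE _ _ HF); field.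
  apply: eq_card => z; rewrite inE; apply/imsetP/idP => [[x + ->]|zs]; first by rewrite inE E.
  have zE : NU + Q * ((z - NU) / Q) = z by field.
  by exists ((z - NU) / Q); rewrite ?zE// inE E zE.
have SQ : S / Q != 0 by rewrite mulf_neq0// invr_eq0.
rewrite -[X in (_ <= _ * X)%N]cF; case/orP: la => [/eqP a0|la].
  have -> : [set z | is_sq (S / Q * depressed_cubic A B z)] = [set z | is_sq (S / Q * (z ^+ 3 + B))].
    by apply/setP => z; rewrite !inE /depressed_cubic /A a0 mul0r addr0.
  by apply: card_const_cubic_sq => //; rewrite cF.
apply: card_cubic_sq => //; first by rewrite /A Fp_intr_eq0.
by rewrite cF (leq_trans _ l100).
Qed.

Lemma cubic_quot_periodic (a s nu h0 : int) (q l t : nat) : prime l ->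
  is_sq ((cubic_quot a s nu q%:Z h0 (t + l)%N%:Z)%:~R : 'F_l) = is_sq ((cubic_quot a s nu q%:Z h0 t%:Z)%:~R : 'F_l).
Proof.
move=> pl; congr is_sq; apply/eqP; rewrite -subr_eq0 -intrB Fp_intr_eq0// PoszD.
apply/dvdzP; exists (s * (3 * nu ^+ 2 + a + 3 * nu * q%:Z * (2 * t%:Z + l%:Z) + q%:Z ^+ 2 * (3 * t%:Z ^+ 2 + 3 * t%:Z * l%:Z + l%:Z ^+ 2))).
rewrite /cubic_quot; ring.
Qed.

(** By the Chinese remainder theorem the local densities [15 / 16] multiply. The factor 2 pays for
    the incomplete period, the product of the primes being at most [T]. *)
Lemma square_sieve (a b s nu h0 : int) (q T : nat) (ls : seq nat) :
  uniq ls -> all (sieving_prime a b) ls -> (\prod_(l <- ls) l <= T)%N ->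
  s ^+ 2 = 1 -> depressed_cubic a b nu = q%:Z * h0 ->
  (16 ^ size ls * count (fun t : nat => `[< exists y, cubic_quot a s nu q%:Z h0 t%:Z = y ^+ 2 >]) (iota 0 T)
    <= 2 * 15 ^ size ls * T)%N.
Proof.
move=> us /allP sls LT s1 H.
have lsp l : l \in ls -> prime l by move=> /sls /and5P[].
pose P l (t : nat) := is_sq ((cubic_quot a s nu q%:Z h0 t%:Z)%:~R : 'F_l).
have [|l lls t|cA pA] := @count_crt_seq ls id P.
- rewrite map_id; elim: ls us sls lsp {LT} => //= l ls IH /andP[nl us] sls lsp.
  rewrite IH// ?andbT.
  + apply/allP => m mls; rewrite prime_coprime ?lsp ?mem_head//.
    by rewrite dvdn_prime2 ?lsp ?mem_head ?inE ?mls ?orbT//; apply: contraNneq nl => ->.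
  + by move=> m mls; apply: sls; rewrite inE mls orbT.
  + by move=> m mls; apply: lsp; rewrite inE mls orbT.
- by rewrite /P cubic_quot_periodic// lsp.
set L := (\prod_(l <- ls) l)%N in LT cA pA.
have L0 : (0 < L)%N by rewrite /L big_seq prodn_cond_gt0// => l /lsp /prime_gt0.
have H1 : (count (fun t : nat => `[< exists y, cubic_quot a s nu q%:Z h0 t%:Z = y ^+ 2 >]) (iota 0 T) <= count (fun x => all (P^~ x) ls) (iota 0 T))%N.
  apply: sub_count => t /asboolP[y E]; apply/allP => l lls; rewrite /P E rmorphXn; exact: is_sqX.
have H2 := @cnt_periodic_le (fun x => all (P^~ x) ls) L 0 T L0 pA.
have H3 : (16 ^ size ls * \prod_(l <- ls) count (P l) (iota 0 l) <= 15 ^ size ls * L)%N.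
  rewrite /L; have : forall l, l \in ls -> (16 * count (P l) (iota 0 l) <= 15 * l)%N.
    by move=> l lls; apply: cubic_quot_count H => //; exact: sls.
  elim: (ls) => [|l ls' IH] hl; first by rewrite !big_nil.
  rewrite !big_cons /= !expnS !(mulnACA _ (_ ^ _)%N) leq_mul//; first by apply: hl; rewrite mem_head.
  by apply: IH => m mls; apply: hl; rewrite inE mls orbT.
rewrite -cA in H3.
have H4 : ((T %/ L).+1 * L <= 2 * T)%N by rewrite mulSn mul2n -addnn leq_add// leq_divM.
apply: (leq_trans (leq_mul (leqnn _) (leq_trans H1 H2))).
rewrite mulnCA; apply: (leq_trans (leq_mul (leqnn _) H3)).
by rewrite mulnCA -[leqRHS]mulnA [leqRHS]mulnCA leq_mul2l H4 orbT.
Qed.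

(* The norm of [x0 + x1 X + x2 X^2] from [R[X]/(X^3 + a X + b)], as the determinant of multiplication. *)
Definition cubic_norm (R : comNzRingType) (a b x0 x1 x2 : R) : R :=
  x0 * ((x0 - a * x2) * (x0 - a * x2) - x1 * (- b * x2 - a * x1))
  - x1 * ((- b * x2) * (x0 - a * x2) - x1 * (- b * x1))
  + x2 * ((- b * x2) * (- b * x2 - a * x1) - (x0 - a * x2) * (- b * x1)).

Lemma cubic_normM (R : comNzRingType) (a b x0 x1 x2 y0 y1 y2 : R) :
  cubic_norm a b x0 x1 x2 * cubic_norm a b y0 y1 y2 =
  cubic_norm a b (x0 * y0 - b * (x1 * y2 + x2 * y1))
    (x0 * y1 + x1 * y0 - a * (x1 * y2 + x2 * y1) - b * (x2 * y2))
    (x0 * y2 + x1 * y1 + x2 * y0 - a * (x2 * y2)).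
Proof. rewrite /cubic_norm; ring. Qed.

(** [R0], [R1], [R2] are the values at [nu] of the element and of its multiples by [X] and [X ^ 2],
    reduced modulo the cubic: the multiplication matrix applied to [(1, nu, nu ^ 2)]. The norm is
    their combination by the cofactors of the first column. *)
Lemma cubic_norm_dvd (a b x0 x1 x2 nu q : int) :
  (q %| depressed_cubic a b nu)%Z -> (q %| x0 + x1 * nu + x2 * nu ^+ 2)%Z ->
  (q %| cubic_norm a b x0 x1 x2)%Z.
Proof.
set H := depressed_cubic _ _ _; set R0 := _ + x2 * _ => qH qR0.
pose R1 := nu * R0 - x2 * H; pose R2 := nu * R1 - x1 * H.
have qR1 : (q %| R1)%Z by rewrite rpredB// dvdz_mull.
have qR2 : (q %| R2)%Z by rewrite rpredB// dvdz_mull.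
have -> : cubic_norm a b x0 x1 x2 =
   ((x0 - a * x2) * (x0 - a * x2) - x1 * (- b * x2 - a * x1)) * R0
   - (x1 * (x0 - a * x2) - x2 * (- b * x2 - a * x1)) * R1
   + (x1 * x1 - x2 * (x0 - a * x2)) * R2.
  by rewrite /R2 /R1 /R0 /H /cubic_norm /depressed_cubic; ring.
by rewrite rpredD ?rpredB// dvdz_mull.
Qed.

(** The divided differences [S0], [S1], [S2] of these values between the roots [m] and [n] also
    vanish modulo [p]. Column operations bring the [R] and the [S] into two columns of the
    determinant, each divisible by [p]. *)
Lemma cubic_norm_dvd_sq (a b x0 x1 x2 m n : int) (p : nat) : prime p ->
  (p%:Z %| depressed_cubic a b m)%Z -> (p%:Z %| x0 + x1 * m + x2 * m ^+ 2)%Z ->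
  (p%:Z %| depressed_cubic a b n)%Z -> (p%:Z %| x0 + x1 * n + x2 * n ^+ 2)%Z ->
  ~~ (p%:Z %| n - m)%Z ->
  (p%:Z * p%:Z %| cubic_norm a b x0 x1 x2)%Z.
Proof.
move=> pp; set H := depressed_cubic _ _ m; set R0 := _ + x2 * m ^+ 2 => qH qR0.
set H' := depressed_cubic _ _ n; set R0' := _ + x2 * n ^+ 2 => qH' qR0' nm.
pose R1 := m * R0 - x2 * H; pose R2 := m * R1 - x1 * H.
pose R1' := n * R0' - x2 * H'; pose R2' := n * R1' - x1 * H'.
have qR1 : (p%:Z %| R1)%Z by rewrite rpredB// dvdz_mull.
have qR2 : (p%:Z %| R2)%Z by rewrite rpredB// dvdz_mull.
have qR1' : (p%:Z %| R1')%Z by rewrite rpredB// dvdz_mull.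
have qR2' : (p%:Z %| R2')%Z by rewrite rpredB// dvdz_mull.
pose S0 := x1 + x2 * (m + n).
pose S1 := (x0 - a * x2) + x1 * (m + n).
pose S2 := (- b * x2 - a * x1) + (x0 - a * x2) * (m + n).
have div (x y z : int) : (p%:Z %| x)%Z -> (p%:Z %| y)%Z -> y - x = (n - m) * z -> (p%:Z %| z)%Z.
  move=> px py E; have : (p%:Z %| (n - m) * z)%Z by rewrite -E rpredB.
  by move: nm; rewrite !dvdzE /= abszM Euclid_dvdM// => /negbTE ->.
have qS0 : (p%:Z %| S0)%Z by apply: (div _ _ _ qR0 qR0'); rewrite /R0 /R0' /S0; ring.
have qS1 : (p%:Z %| S1)%Z.
  by apply: (div _ _ _ qR1 qR1'); rewrite /R1 /R1' /R0 /R0' /S1 /H /H' /depressed_cubic; ring.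
have qS2 : (p%:Z %| S2)%Z.
  by apply: (div _ _ _ qR2 qR2'); rewrite /R2 /R2' /R1 /R1' /R0 /R0' /S2 /H /H' /depressed_cubic; ring.
have -> : cubic_norm a b x0 x1 x2 =
   R0 * S1 * (x0 - a * x2) - R0 * S2 * x1 - R1 * S0 * (x0 - a * x2) + R1 * S2 * x2 + R2 * S0 * x1 - R2 * S1 * x2.
  by rewrite /R2 /R1 /R0 /S0 /S1 /S2 /H /cubic_norm /depressed_cubic; ring.
have t x y z : (p%:Z %| x)%Z -> (p%:Z %| y)%Z -> (p%:Z * p%:Z %| x * y * z)%Z.
  by move=> px py; apply: dvdz_mulr; apply: dvdz_mul.
by apply: rpredB; [apply: rpredD; [apply: rpredD; [apply: rpredB; [apply: rpredB|]|]|]|]; exact: t.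
Qed.

Lemma cubic_norm_bound (a b x0 x1 x2 T : int) : 0 <= T -> `|x0| <= T -> `|x1| <= T -> `|x2| <= T ->
  `|cubic_norm a b x0 x1 x2| <= 6 * (1 + `|a| + `|b|) ^+ 2 * T ^+ 3.
Proof.
move=> T0 H0 H1 H2; set c := 1 + _ + _.
have c1 : 1 <= c by rewrite /c -addrA lerDl addr_ge0.
have e1 : `|x0 - a * x2| <= c * T.
  rewrite (le_trans (ler_normB _ _))// normrM /c !mulrDl mul1r -addrA lerD//.
  by rewrite -[leLHS]addr0 lerD ?mulr_ge0// ler_wpM2l.
have e2 : `|- b * x2 - a * x1| <= c * T.
  rewrite (le_trans (ler_normB _ _))// !normrM normrN.
  have hb := ler_wpM2l (normr_ge0 b) H2; have ha := ler_wpM2l (normr_ge0 a) H1.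
  by rewrite (le_trans (lerD hb ha))// -mulrDl ler_wpM2r// /c; lia.
have e3 x : `|x| <= T -> `|x| <= c * T by move=> xT; rewrite (le_trans xT)// ler_peMl.
have e4 x : `|x| <= T -> `|- b * x| <= c * T.
  by move=> xT; rewrite normrM normrN ler_pM// /c lerDr addr_ge0.
have cT : 0 <= c * T by rewrite mulr_ge0// (le_trans _ c1).
have prod x y : `|x| <= c * T -> `|y| <= c * T -> `|x * y| <= (c * T) * (c * T) by move=> *; rewrite normrM ler_pM.
have mino x y z w : `|x| <= c * T -> `|y| <= c * T -> `|z| <= c * T -> `|w| <= c * T ->
   `|x * y - z * w| <= 2 * ((c * T) * (c * T)).
  by move=> *; rewrite (le_trans (ler_normB _ _))// mulr2n mulrDl mul1r lerD// prod.
have term x y : `|x| <= T -> `|y| <= 2 * ((c * T) * (c * T)) -> `|x * y| <= T * (2 * ((c * T) * (c * T))).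
  by move=> *; rewrite normrM ler_pM.
rewrite /cubic_norm.
have -> : 6 * c ^+ 2 * T ^+ 3 = T * (2 * ((c * T) * (c * T))) + T * (2 * ((c * T) * (c * T))) + T * (2 * ((c * T) * (c * T))) by ring.
apply: (le_trans (ler_normD _ _)); rewrite lerD//; last by apply: term => //; apply: mino => //; [exact: e4|exact: e4].
by apply: (le_trans (ler_normB _ _)); rewrite lerD//; apply: term => //; apply: mino => //; [exact: e3|exact: e4|exact: e3|exact: e4].
Qed.

(** Without rational roots the cubic is irreducible, so a nonzero element has an inverse
    [y0 + y1 X + y2 X ^ 2], and by [cubic_normM] the two norms have product 1. *)
Lemma cubic_norm_neq0 (a b x0 x1 x2 : int) :
  (forall x : rat, depressed_cubic a%:~R b%:~R x != 0) ->
  cubic_norm a b x0 x1 x2 = 0 -> [/\ x0 = 0, x1 = 0 & x2 = 0].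
Proof.
move=> irr N0.
pose A : rat := a%:~R; pose B : rat := b%:~R.
pose H : {poly rat} := 'X^3 + A *: 'X + B%:P.
pose al : {poly rat} := (x0%:~R)%:P + x1%:~R *: 'X + x2%:~R *: 'X^2.
have sH : size H = 4%N.
  by rewrite /H -addrA size_polyDl ?size_polyXn// (leq_ltn_trans (size_polyD _ _))// gtn_max
      (leq_ltn_trans (size_scale_leq _ _)) ?size_polyX// (leq_ltn_trans (size_polyC_leq1 _)).
have irrH : irreducible_poly H.
  apply: cubic_irreducible; first by rewrite sH.
  move=> x; rewrite rootE /H !hornerD hornerXn hornerZ hornerX hornerC; exact: irr.
have qE (c0 c1 c2 : rat) i : (c0%:P + c1 *: 'X + c2 *: 'X^2)`_i = nth 0 [:: c0; c1; c2] i.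
  rewrite !coefD coefC !coefZ coefX coefXn.
  by case: i => [|[|[|i]]] /=; rewrite ?mulr0 ?mulr1 ?addr0 ?add0r// nth_nil.
have alE i : al`_i = nth 0 [:: x0%:~R; x1%:~R; x2%:~R] i by exact: qE.
suff al0 : al = 0.
  have c0 (z : int) i : nth 0 [:: x0%:~R; x1%:~R; x2%:~R] i = z%:~R :> rat -> z = 0.
    by rewrite -alE al0 coef0 => /esym/eqP; rewrite intr_eq0 => /eqP.
  by split; [exact: (c0 _ 0%N)|exact: (c0 _ 1%N)|exact: (c0 _ 2%N)].
apply/eqP; apply: contraT => al0.
have sal : (size al <= 3)%N.
  by apply/leq_sizeP => -[|[|[|i]]]// _; rewrite alE /= nth_nil.
have cop : coprimep H al.
  rewrite irreducible_poly_coprime//; apply/negP => /(dvdp_leq al0).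
  by rewrite sH leqNgt ltnS sal.
have [[U V] /= UV] := Bezout_eq1_coprimepP _ _ cop.
pose be := V %% H.
have Hn0 : H != 0 by rewrite -size_poly_eq0 sH.
have sbe : (size be <= 3)%N by have := ltn_modp V H; rewrite Hn0 sH ltnS.
pose y0 := be`_0; pose y1 := be`_1; pose y2 := be`_2.
have beE : be = y0%:P + y1 *: 'X + y2 *: 'X^2.
  apply/polyP => i; rewrite qE; case: i => [|[|[|i]]] //=.
  by rewrite nth_nil nth_default// (leq_trans sbe).
pose X0 : rat := x0%:~R; pose X1 : rat := x1%:~R; pose X2 : rat := x2%:~R.
pose z0 := X0 * y0 - B * (X1 * y2 + X2 * y1).
pose z1 := X0 * y1 + X1 * y0 - A * (X1 * y2 + X2 * y1) - B * (X2 * y2).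
pose z2 := X0 * y2 + X1 * y1 + X2 * y0 - A * (X2 * y2).
have prodE : al * be = ((X1 * y2 + X2 * y1)%:P + (X2 * y2) *: 'X) * H + (z0%:P + z1 *: 'X + z2 *: 'X^2).
  rewrite beE /al /H /z0 /z1 /z2 -!mul_polyC !(rmorphD, rmorphB, rmorphM, rmorphN) /=; ring.
have : H %| 1 - (z0%:P + z1 *: 'X + z2 *: 'X^2).
  have -> : 1 - (z0%:P + z1 *: 'X + z2 *: 'X^2) = (U + (V %/ H) * al + ((X1 * y2 + X2 * y1)%:P + (X2 * y2) *: 'X)) * H.
    have VE : V = V %/ H * H + be by exact: divp_eq.
    have -> : z0%:P + z1 *: 'X + z2 *: 'X^2 = al * be - ((X1 * y2 + X2 * y1)%:P + (X2 * y2) *: 'X) * H.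
      by rewrite prodE [X in _ = X - _]addrC addrK.
    rewrite -UV {1}VE; ring.
  exact: dvdp_mulIr.
have s3 : (size (1 - (z0%:P + z1 *: 'X + z2 *: 'X^2))%R <= 3)%N.
  apply/leq_sizeP => -[|[|[|i]]]// _.
  by rewrite coefB coef1 qE /= nth_nil subr0.
move=> /dvdp_leq; case: eqVneq => [E _|_ /(_ isT)]; last by rewrite sH leqNgt ltnS s3.
have zE i : nth 0 [:: z0; z1; z2] i = (i == 0%N)%:R.
  by have := congr1 (fun p : {poly rat} => p`_i) E; rewrite coefB coef0 coef1 qE => /eqP; rewrite subr_eq0 => /eqP.
have z0E : z0 = 1 := zE 0%N.
have z1E : z1 = 0 := zE 1%N.
have z2E : z2 = 0 := zE 2%N.
have := cubic_normM A B X0 X1 X2 y0 y1 y2; rewrite -/z0 -/z1 -/z2 z0E z1E z2E.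
have -> : cubic_norm A B X0 X1 X2 = 0.
  by rewrite -[RHS](congr1 (intr : int -> rat) N0) /cubic_norm !(rmorphD, rmorphB, rmorphM, rmorphN).
have n1 : cubic_norm A B 1 0 0 = 1 by rewrite /cubic_norm; ring.
by rewrite mul0r n1 => /esym/eqP; rewrite oner_eq0.
Qed.

Local Open Scope nat_scope.

Lemma eqn_mod_dvdz (m x y : nat) : (m%:Z %| (x%:Z - y%:Z)%R)%Z = (x == y %[mod m]).
Proof. by rewrite -eqz_mod_dvd !modz_nat eqz_nat. Qed.

Lemma exists_cbrt q : exists T, T ^ 3 <= q /\ q < T.+1 ^ 3.
Proof.
have ex : exists T, T ^ 3 <= q by exists 0.
have bd T : T ^ 3 <= q -> T <= q by apply: leq_trans; rewrite -{1}(expn1 T); case: T => // T; rewrite leq_pexp2l.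
case: (ex_maxnP ex bd) => T T3 Tmax; exists T; split => //.
by rewrite ltnNge; apply/negP => /Tmax; rewrite ltnn.
Qed.

(** Pigeonhole modulo [q] on the [(T + 1) ^ 3 > q] triples with entries in [[0, T]]. *)
Lemma small_lattice_vector (q T nu : nat) : 0 < q -> q < T.+1 ^ 3 ->
  exists x0 x1 x2 : int, [/\ (x0 != 0) || (x1 != 0) || (x2 != 0), (`|x0| <= T)%N, (`|x1| <= T)%N, (`|x2| <= T)%N &
    (q%:Z %| x0 + x1 * nu%:Z + x2 * nu%:Z ^+ 2)%Z]%R.
Proof.
move=> q0 qT.
pose f (v : 'I_T.+1 * 'I_T.+1 * 'I_T.+1) : 'I_q := Ordinal (ltn_pmod (v.1.1 + v.1.2 * nu + v.2 * nu ^ 2) q0).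
have /injectivePn[u [v uv fuv]] : ~~ injectiveb f.
  apply/negP => /injectiveP finj; have := leq_card f finj.
  rewrite !card_prod !card_ord; move: qT; rewrite !expnS expn0 muln1; lia.
have E : u.1.1 + u.1.2 * nu + u.2 * nu ^ 2 = v.1.1 + v.1.2 * nu + v.2 * nu ^ 2 %[mod q].
  by have := congr1 val fuv.
exists (u.1.1%:Z - v.1.1%:Z)%R, (u.1.2%:Z - v.1.2%:Z)%R, (u.2%:Z - v.2%:Z)%R.
have b (i j : 'I_T.+1) : `|(i%:Z - j%:Z)%R|%N <= T by have := ltn_ord i; have := ltn_ord j; lia.
split => //.
- rewrite !subr_eq0 !eqz_nat -!negb_and; apply: contra uv => /andP[/andP[/eqP/val_inj E1 /eqP/val_inj E2] /eqP/val_inj E3].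
  by case: u v E1 E2 E3 {fuv E} => [[u1 u2] u3] [[v1 v2] v3] /= -> -> ->.
have -> : (u.1.1%:Z - v.1.1%:Z + (u.1.2%:Z - v.1.2%:Z) * nu%:Z + (u.2%:Z - v.2%:Z) * nu%:Z ^+ 2 =
   (u.1.1 + u.1.2 * nu + u.2 * nu ^ 2)%N%:Z - (v.1.1 + v.1.2 * nu + v.2 * nu ^ 2)%N%:Z)%R.
  by rewrite !PoszD !PoszM; ring.
by rewrite eqn_mod_dvdz; apply/eqP.
Qed.

Lemma sqfree_dvd q d : sqfree q -> (forall p, prime p -> p %| q -> p %| d) -> q %| d.
Proof.
move=> sq H; have q0 := sqfree_gt0 sq.
have [m qE] := dvdnP (dvdn_gcdl q d).
suff m1 : m = 1 by rewrite qE m1 mul1n dvdn_gcdr.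
apply/eqP; case: (ltngtP m 1) => //; first by rewrite ltnS leqn0 => /eqP m0; rewrite qE m0 in q0.
move=> m1; have pp := pdiv_prime m1; set p := pdiv m in pp.
have pm : p %| m by exact: pdiv_dvd.
have pq : p %| q by rewrite qE dvdn_mulr.
have : p ^ 2 %| q by rewrite qE -mulnn dvdn_mul// dvdn_gcd pq H.
by move=> /sq p1; rewrite p1 in pp.
Qed.

Definition is_root_pair (a b : int) (qv : nat * nat) : bool :=
  [&& `[< sqfree qv.1 >], qv.2 < qv.1 & (qv.1%:Z %| depressed_cubic a b qv.2%:Z)%Z].

(* A short vector [x] in the lattice of quadratics vanishing at [nu] modulo [q] has norm [s * q] with [s] bounded,
   by the pigeonhole principle; conversely [q] and, up to a residue modulo a fixed integer, [nu] are recovered from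
   [x] and [s], so there are [O(T ^ 3) = O(Q)] pairs. *)
Lemma count_root_pairs (a b : int) :
  (forall x : rat, depressed_cubic a%:~R b%:~R x != 0)%R ->
  exists C, forall Q (s : seq (nat * nat)), uniq s ->
    {in s, forall qv, is_root_pair a b qv /\ qv.1 <= Q} -> size s <= C * Q.
Proof.
move=> irr; pose C := 6 * (1 + `|a| + `|b|) ^ 2.
exists (27 * (C.+1 * C`!)) => Q s us sP.
have [T [TQ QT]] := exists_cbrt Q.
pose good (qv : nat * nat) (x : int * int * int) := [/\ (x.1.1 != 0) || (x.1.2 != 0) || (x.2 != 0), (`|x.1.1| <= T)%N, (`|x.1.2| <= T)%N, (`|x.2| <= T)%N &
   (qv.1%:Z %| x.1.1 + x.1.2 * qv.2%:Z + x.2 * qv.2%:Z ^+ 2)%Z /\ (exists2 t : nat, (t <= C)%N & `|cubic_norm a b x.1.1 x.1.2 x.2|%N = (qv.1 * t)%N)]%R.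
have ex (qv : nat * nat) : exists x, is_root_pair a b qv -> qv.1 <= Q -> good qv x.
  case: (boolP (is_root_pair a b qv && (qv.1 <= Q))) => [/andP[rp qQ]|n]; last by exists (0, 0, 0)%R => rp qQ; rewrite rp qQ in n.
  case/and3P: rp => /asboolP sq vq qH.
  have [t [tq qt]] := exists_cbrt qv.1.
  have tT : t <= T.
    rewrite leqNgt; apply/negP => Tt; have : T.+1 ^ 3 <= t ^ 3 by rewrite leq_exp2r.
    by move=> /(leq_trans QT); rewrite ltnNge (leq_trans tq).
  have [x0 [x1 [x2 [nz b0 b1 b2 qx]]]] := @small_lattice_vector qv.1 t qv.2 (sqfree_gt0 sq) qt.
  exists ((x0, x1), x2) => _ _; split; rewrite //=; try by apply: leq_trans tT.
  split => //; have := cubic_norm_dvd qH qx; rewrite dvdzE /= => /dvdnP[k kE].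
  exists k; last by rewrite kE mulnC.
  have := @cubic_norm_bound a b x0 x1 x2 t%:Z isT.
  rewrite -!abszE !lez_nat => /(_ b0 b1 b2); rewrite kE => H.
  rewrite -(leq_pmul2r (sqfree_gt0 sq)); apply: (@leq_trans (C * t ^ 3)); last by rewrite leq_mul2l tq orbT.
  by move: H; rewrite /C -!mulnn !expnS; lia.
have /boolp.choice[F HF] := ex.
pose sh (z : int) := `|(z + T%:Z)%R|%N.
(* The code of a pair: its short vector, the cofactor [t] of [q] in the norm, and the root modulo
   [C!]. The vector and [t] determine [q]. *)
pose G (qv : nat * nat) := (sh (F qv).1.1, sh (F qv).1.2, sh (F qv).2, `|cubic_norm a b (F qv).1.1 (F qv).1.2 (F qv).2| %/ qv.1, qv.2 %% C`!).
have shi x y : `|x|%N <= T -> `|y|%N <= T -> sh x = sh y -> x = y by rewrite /sh; lia.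
have Gi : {in s &, injective G}.
  move=> u v us' vs' [E0 E1 E2 E3 E4].
  have [ur uQ] := sP _ us'; have [vr vQ] := sP _ vs'.
  have [nz a0 a1 a2 [ad [t tC tE]]] := HF _ ur uQ.
  have [_ b0 b1 b2 [bd [t' t'C t'E]]] := HF _ vr vQ.
  have FE : F u = F v.
    move: (shi _ _ a0 b0 E0) (shi _ _ a1 b1 E1) (shi _ _ a2 b2 E2).
    by case: (F u) (F v) => [[? ?] ?] [[? ?] ?] /= -> -> ->.
  rewrite -FE in bd t'E E3.
  case/and3P: ur => /asboolP su u21 uH; case/and3P: vr => /asboolP sv v21 vH.
  have t0 : 0 < t.
    rewrite lt0n; apply/eqP => t0; move: tE; rewrite t0 muln0 => /eqP; rewrite absz_eq0 => /eqP N0.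
    by have [z0 z1 z2] := cubic_norm_neq0 irr N0; move: nz; rewrite z0 z1 z2 eqxx.
  have tt' : t = t'.
    move: E3; rewrite {1}tE t'E !mulKn//; exact: sqfree_gt0.
  have qq : u.1 = v.1 by apply/eqP; rewrite -(eqn_pmul2r t0) -tE t'E tt'.
  suff vv : u.2 = v.2 by move: qq vv; case: (u) (v) => [? ?] [? ?] /= -> ->.
  have : u.1 %| `|(v.2%:Z - u.2%:Z)%R|%N.
    apply: sqfree_dvd => // p pp pu; case: (leqP p C) => pC.
      have pf : p %| C`! by rewrite dvdn_fact// prime_gt0.
      have : v.2 == u.2 %[mod p] by rewrite -(modn_dvdm _ pf) -E4 modn_dvdm.
      by rewrite -eqn_mod_dvdz dvdzE.
    (* For [p > C], distinct roots modulo [p] would give [p ^ 2 %| q * t] by [cubic_norm_dvd_sq]; as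
       [0 < t <= C < p], this contradicts the squarefreeness of [q]. *)
    apply: contraT => npd; exfalso.
    have pz (z : int) : (u.1%:Z %| z)%Z -> (p%:Z %| z)%Z by apply: dvdz_trans; rewrite dvdzE.
    have := @cubic_norm_dvd_sq a b (F u).1.1 (F u).1.2 (F u).2 u.2%:Z v.2%:Z p pp (pz _ uH) (pz _ ad).
    rewrite -qq in vH bd; move=> /(_ (pz _ vH) (pz _ bd)); rewrite !dvdzE => /(_ npd).
    rewrite abszM tE /= => /dvdnP[k kE].
    have [m mE] := dvdnP pu.
    have p0 := prime_gt0 pp.
    have : p %| m * t.
      by rewrite -(dvdn_pmul2r p0) mulnAC -mE kE dvdn_mull.
    rewrite Euclid_dvdM// => /orP[pm|/dvdn_leq]; last by move=> /(_ t0); rewrite leqNgt (leq_ltn_trans tC).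
    have : p ^ 2 %| u.1 by rewrite mE -mulnn dvdn_pmul2r.
    by move=> /su p1; rewrite p1 in pp.
  move: u21 v21; rewrite -qq; move: (u.1) (u.2) (v.2) => q x y xq yq.
  case: (ltngtP x y) => // xy /dvdn_leq; rewrite lt0n absz_eq0; clear -xq yq xy; lia.
have sQ0 : 0 < size s -> 0 < T.
  move=> s0; rewrite lt0n; apply/eqP => T0; move: QT; rewrite T0 exp1n ltnS leqn0 => /eqP Q0.
  have [] := sP (nth (0, 0) s 0) (mem_nth _ s0).
  by rewrite Q0 => /and3P[/asboolP /sqfree_gt0 q0 _ _]; rewrite leqNgt q0.
case: (posnP (size s)) => [->//|/sQ0 T0].
rewrite -(size_map G).
pose I := iota 0 (2 * T).+1.
pose L := [seq (u, w) | u <- [seq (u, t) | u <- [seq (u, x2) | u <- [seq (x0, x1) | x0 <- I, x1 <- I], x2 <- I], t <- iota 0 C.+1], w <- iota 0 C`!].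
apply: (@leq_trans (size L)).
  apply: uniq_leq_size; first by rewrite map_inj_in_uniq.
  move=> _ /mapP[u us' ->]; have [ur uQ] := sP _ us'.
  have [nz a0 a1 a2 [ad [t tC tE]]] := HF _ ur uQ.
  case/and3P: ur => /asboolP su _ _.
  have shI z : `|z| <= T -> sh z \in I by rewrite mem_iota /sh; clear; lia.
  rewrite /L /G; apply: allpairs_f; last by rewrite mem_iota ltn_mod fact_gt0.
  apply: allpairs_f; last by rewrite mem_iota tE mulKn ?sqfree_gt0// ltnS.
  by apply: allpairs_f; [apply: allpairs_f|]; exact: shI.
(* There are [(2 T + 1) ^ 3 <= 27 T ^ 3] vectors, [C + 1] cofactors and [C!] residues. *)
rewrite /L !size_allpairs !size_iota; apply: (@leq_trans (27 * T ^ 3 * (C.+1 * C`!))); last first.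
  by rewrite [leqRHS]mulnAC leq_mul2r leq_mul2l TQ !orbT.
rewrite -mulnA leq_mul2r; apply/orP; right; rewrite !expnS expn0 muln1; move: T0; clear; nia.
Qed.

(** * Values of a cubic with small squarefree part *)

Lemma poly_exp_bound : exists A, forall r, r.+1 ^ 4 * 15 ^ r <= A * 16 ^ r.
Proof.
exists (63 ^ 4); elim => [|r IH]; first by rewrite !muln1 leq_exp2r.
(* From [r = 62] on, [((r + 2) / (r + 1)) ^ 4 <= 16 / 15]. *)
case: (leqP r 61) => r61; first by rewrite leq_mul// ?leq_exp2r.
rewrite (expnS 15) (expnS 16) mulnCA [leqRHS]mulnCA.
apply: (@leq_trans (16 * (r.+1 ^ 4 * 15 ^ r))); last by rewrite leq_mul2l IH orbT.
rewrite !mulnA leq_mul2r; apply/orP; right.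
have [x xE] : exists x, r = 62 + x by exists (r - 62); rewrite subnKC.
rewrite xE; clear; nia.
Qed.

(** Since [r] primes up to [4 ^ (r + c)] have product at most [2 ^ (2 * r * (r + c))], this is the
    longest sieve whose period is sure to fit into [2 ^ j]. *)
Lemma sieve_length c j : exists r, 2 * (r * (r + c)) <= j /\ j < 2 * (r.+1 * (r.+1 + c)).
Proof.
have ex : exists r, 2 * (r * (r + c)) <= j by exists 0.
have bd r : 2 * (r * (r + c)) <= j -> r <= j by case: r => // r; nia.
case: (ex_maxnP ex bd) => r rj rmax; exists r; split => //.
by rewrite ltnNge; apply/negP => /rmax; rewrite ltnn.
Qed.

Section CubicTwists.
Variables a b : int.
Hypothesis irr : forall x : rat, (depressed_cubic a%:~R b%:~R x != 0)%R.
Hypothesis disc0 : (4 * a ^+ 3 + 27 * b ^+ 2 != 0)%R.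

Let b0 : (b != 0)%R.
Proof.
apply/eqP => b0; have := irr 0; rewrite b0 /depressed_cubic mulr0 addr0 addr0 expr0n /=.
by [].
Qed.

Definition twist_block (s : int) (j B : nat) (n : nat) : bool :=
  `[< exists q, [/\ sqfree q, q * 2 ^ j <= B, B < q * 2 ^ j.+1 &
        exists y : int, (s * depressed_cubic a b n%:Z = q%:Z * y ^+ 2)%R] >].

(* Write [n = nu + q * t] with [nu < q] and [t] of size [B / q ~ 2 ^ j]; sieving [t] by [r ~ sqrt j] primes saves
   [(15 / 16) ^ r], which beats [j ^ 2]. *)
Lemma twist_block_count : exists A, forall (s : int) j B, (s ^+ 2 = 1)%R ->
  j.+1 ^ 2 * cnt (twist_block s j B) B <= A * B.
Proof.
have [C HC] := count_root_pairs irr.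
have [c Hc] := sieving_prime_large b0 disc0.
have [A HA] := poly_exp_bound.
exists (4 * C * (2 * c.+1) ^ 2 * A) => s j B s1.
have [r [rj jr]] := sieve_length c j.
have [ls [sls uls lsP]] := exists_primes c r.
have LT : \prod_(l <- ls) l <= 2 ^ j.+1.
  apply: (@leq_trans (\prod_(l <- ls) 4 ^ (r + c))).
    by rewrite big_seq [leqRHS]big_seq; apply: leq_prod => l /lsP[].
  rewrite big_const_seq count_predT sls iter_muln_1 -[4]/(2 ^ 2) -!expnM leq_exp2l//.
  by rewrite [(_ + _) * r]mulnC (leq_trans rj).
have sv : all (sieving_prime a b) ls by apply/allP => l /lsP[pl cl _]; exact: Hc.
pose Q := B %/ 2 ^ j.
pose ps := [seq qv <- [seq (q, v) | q <- iota 1 Q, v <- iota 0 Q] | is_root_pair a b qv && (B < qv.1 * 2 ^ j.+1)].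
have ps_size : size ps <= C * Q.
  apply: HC => [|qv]; first by rewrite filter_uniq// allpairs_uniq ?iota_uniq// => -[? ?] [? ?].
  rewrite mem_filter => /andP[/andP[-> _] /allpairsP[[q v] /= [qQ _ ->]]] /=.
  by move: qQ; rewrite mem_iota add1n ltnS => /andP[].
have H1 : cnt (twist_block s j B) B <= \sum_(qv <- ps) cnt (fun n => (n == qv.2 %[mod qv.1]) && `[< exists y : int, (s * depressed_cubic a b n%:Z = qv.1%:Z * y ^+ 2)%R >]) B.
  apply: cnt_bigU => n /andP[n0 nB] /asboolP[q [sq qB Bq [y E]]].
  have q0 := sqfree_gt0 sq.
  have qQ : q <= Q by rewrite /Q leq_divRL// expn_gt0.
  exists (q, n %% q) => /=; last by rewrite modn_mod eqxx; apply/asboolP; exists y.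
  rewrite mem_filter Bq andbT; apply/andP; split; last first.
    by apply: allpairs_f; rewrite mem_iota ?q0 ?add1n ?ltnS// add0n (leq_trans _ qQ)// ltn_pmod.
  apply/and3P; split; [exact/asboolP|exact: ltn_pmod|].
  have qn : (q%:Z %| depressed_cubic a b n%:Z)%Z.
    apply/dvdzP; exists (s * y ^+ 2)%R.
    transitivity (s * (s * depressed_cubic a b n%:Z))%R; first by rewrite mulrA -expr2 s1 mul1r.
    by rewrite E; ring.
  have -> : depressed_cubic a b (n %% q)%:Z = (depressed_cubic a b n%:Z - (n%:Z - (n %% q)%:Z) * (n%:Z ^+ 2 + n%:Z * (n %% q)%:Z + (n %% q)%:Z ^+ 2 + a))%R.
    by rewrite /depressed_cubic; ring.
  rewrite rpredB// dvdz_mulr// eqn_mod_dvdz modn_mod eqxx//.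
have H2 qv : qv \in ps -> 16 ^ r * cnt (fun n => (n == qv.2 %[mod qv.1]) && `[< exists y : int, (s * depressed_cubic a b n%:Z = qv.1%:Z * y ^+ 2)%R >]) B <= 2 * 15 ^ r * 2 ^ j.+1.
  case: qv => q v; rewrite mem_filter /= => /andP[/andP[/and3P[/asboolP sq /= vq /dvdzP[h0 hE]] qB] _].
  have q0 := sqfree_gt0 sq.
  have := @square_sieve a b s v%:Z h0 q (2 ^ j.+1) ls uls sv LT s1; rewrite mulrC in hE.
  move=> /(_ hE); rewrite sls; apply: leq_trans; rewrite leq_mul2l; apply/orP; right.
  rewrite cntE -(size_map (fun n => n %/ q)) -size_filter; apply: uniq_leq_size.
    rewrite map_inj_in_uniq ?filter_uniq ?iota_uniq// => x y.
    rewrite !mem_filter => /andP[/andP[/eqP xv _] _] /andP[/andP[/eqP yv _] _] xy.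
    by rewrite (divn_eq x q) (divn_eq y q) xy xv yv.
  move=> _ /mapP[n + ->]; rewrite !mem_filter !mem_iota add1n ltnS.
  move=> /andP[/andP[/eqP nv /asboolP[y E]] /andP[n0 nB]].
  rewrite add0n leq0n ltn_divLR// [2 ^ _ * q]mulnC (leq_ltn_trans nB qB) andbT.
  rewrite andbT; apply/asboolP; exists y; have qz : (q%:Z != 0 :> int)%R by rewrite eqz_nat -lt0n.
  apply: (mulfI qz); rewrite (cubic_quotE _ _ hE) -E; congr (_ * depressed_cubic _ _ _)%R.
  by rewrite {2}(divn_eq n q) nv (modn_small vq) PoszD PoszM addrC [in RHS]mulrC.
have H3 : 16 ^ r * cnt (twist_block s j B) B <= (C * Q) * (2 * 15 ^ r * 2 ^ j.+1).
  apply: leq_trans (leq_mul (leqnn _) H1) _; rewrite big_distrr /=.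
  apply: (@leq_trans (\sum_(qv <- ps) 2 * 15 ^ r * 2 ^ j.+1)).
    by rewrite big_seq [leqRHS]big_seq; apply: leq_sum => qv; exact: H2.
  by rewrite big_const_seq count_predT iter_addn_0 mulnC leq_mul2r ps_size orbT.
have H4 : 16 ^ r * cnt (twist_block s j B) B <= 4 * C * B * 15 ^ r.
  apply: leq_trans H3 _; have : Q * 2 ^ j <= B by exact: leq_divM.
  rewrite expnS /Q; move: (2 ^ j) (15 ^ r) (B %/ 2 ^ j) => x y z; clear => H.
  have := leq_mul (leqnn (4 * C * y)) H; clear; lia.
(* [j] is at most quadratic in [r], so the weight [(j + 1) ^ 2], which makes the sum over [j]
   converge, is a fourth power of [r] and loses against [(16 / 15) ^ r]. *)
have H5 : j.+1 ^ 2 <= (2 * c.+1) ^ 2 * r.+1 ^ 4.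
  have -> : (2 * c.+1) ^ 2 * r.+1 ^ 4 = (2 * c.+1 * r.+1 ^ 2) ^ 2 by rewrite [in RHS]expnMn -expnM.
  rewrite leq_sqr (leq_trans jr)// -mulnn; clear; nia.
rewrite -(leq_pmul2l (_ : 0 < 16 ^ r)) ?expn_gt0//.
have H6 := HA r.
rewrite mulnCA; apply: (leq_trans (leq_mul H5 H4)).
move: (15 ^ r) (16 ^ r) (r.+1 ^ 4) ((2 * c.+1) ^ 2) H6 => x y z w H.
have := leq_mul (leqnn (w * (4 * C * B))) H; clear; lia.
Qed.

Definition small_twist (s : int) (D B : nat) (n : nat) : bool :=
  `[< exists q, [/\ sqfree q, q * D <= B &
        exists y : int, (s * depressed_cubic a b n%:Z = q%:Z * y ^+ 2)%R] >].

(** Each block [j >= j0] contributes at most [A * B / (j + 1) ^ 2], and all of them together at most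
    [A * B / j0]. *)
Lemma small_twist_small (s : int) k : (s ^+ 2 = 1)%R -> exists D, small k (small_twist s D).
Proof.
move=> s1; have [A HA] := twist_block_count.
pose j0 := (k * A).+1; exists (2 ^ j0); exists 0 => B _.
have H1 : cnt (small_twist s (2 ^ j0) B) B <= \sum_(j <- iota j0 B) cnt (twist_block s j B) B.
  apply: cnt_bigU => n /andP[n0 nB] /asboolP[q [sq qB [y E]]].
  have q0 := sqfree_gt0 sq; have B0 : 0 < B %/ q by rewrite divn_gt0// (leq_trans _ qB)// leq_pmulr// expn_gt0.
  have /andP[lo hi] := trunc_log_bounds (isT : 1 < 2) B0.
  exists (trunc_log 2 (B %/ q)).
    rewrite mem_iota trunc_log_max//=; last by rewrite leq_divRL// mulnC.
    apply: leq_trans (leq_addl _ _); apply: leq_trans (ltn_expl _ (isT : 1 < 2)) _.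
    by rewrite (leq_trans lo)// leq_div.
  apply/asboolP; exists q; split => //; first by rewrite mulnC -leq_divRL.
    by rewrite mulnC -ltn_divLR.
  by exists y.
have H2 : j0 * cnt (small_twist s (2 ^ j0) B) B <= A * B.
  have := @sum_div_sq (A * B) j0 B isT; apply: leq_trans; rewrite leq_mul2l; apply/orP; right.
  apply: leq_trans H1 _; rewrite -[j0.+1]add1n iotaDl big_map; apply: leq_sum => j _.
  by rewrite leq_divRL ?expn_gt0// mulnC HA.
case: (posnP A) => A0; last first.
  rewrite -(leq_pmul2l A0); apply: leq_trans H2; rewrite /j0 mulSn mulnA [A * k]mulnC; exact: leq_addl.
have : j0 * cnt (small_twist s (2 ^ j0) B) B <= 0 by rewrite (leq_trans H2)// A0.
by rewrite leqn0 muln_eq0 /= => /eqP ->; rewrite muln0.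
Qed.

(** The primes between [B / K] and [K0 * B] are few, and each accounts for at most 4 integers
    [n <= B], as [B < p ^ 2]. If [p > K0 * B], the squarefree part of [h n] is at most
    [C * B / K0 ^ 2], so [n] lies in a small twist, whose sign is that of [h n]. *)
Lemma large_square_thin_depressed_cubic (h : {poly int}) :
  size h = 4 -> separated h -> (forall x, h.[x] = depressed_cubic a b x)%R -> large_square_thin h.
Proof.
move=> sh [N [U [V [N0 E]]]] hE K k.
have h0 : (h != 0)%R by rewrite -size_poly_eq0 sh.
have hn (x : int) : (h.[x] != 0)%R.
  rewrite hE; apply: contraTneq (irr x%:~R) => H0; rewrite negbK.
  by have := congr1 (intr : int -> rat) H0; rewrite rmorph_depressed_cubic => ->.
have [C HC] := @horner_bound h 3 (eq_leq sh).
have [D1 S1] := small_twist_small k.*2.*2 (expr1n _ 2).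
have [D2 S2] := small_twist_small k.*2.*2 (sqrrN 1%R).
pose K0 := C * (D1 + D2) + 1.
pose P1 B n := `[< exists2 p, [/\ prime p, p <= K0 * B & B < p * K] & ((p ^ 2)%:Z %| h.[n%:Z]%R)%Z >].
pose P2 B n := `[< exists2 p, prime p /\ K0 * B < p & ((p ^ 2)%:Z %| h.[n%:Z]%R)%Z >].
apply: (@smallU k 0 _ P1 P2).
- move=> B n _ _ /asboolP[p [pp Bp] ph]; case: (leqP p (K0 * B)) => pB; apply/orP; [left|right]; apply/asboolP; exists p => //.
- have [M HM] := primes_thin (k.*2 * (4 * K0)).
  exists (maxn M (maxn (K ^ 2) (maxn (`|N| * K) (`|lead_coef h| * K)))) => B.
  rewrite !geq_max => /and4P[MB KB NB lB].
  have MB' : M <= K0 * B by rewrite (leq_trans MB)// leq_pmull// /K0 addn1.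
  have H1 : cnt (P1 B) B <= cnt prime (K0 * B) * 4.
    pose s := [seq p <- iota 1 (K0 * B) | prime p & B < p * K].
    apply: (@leq_trans (\sum_(p <- s) cnt (fun n => ((p ^ 2)%:Z %| h.[n%:Z]%R)%Z) B)).
      apply: cnt_bigU => n _ /asboolP[p [pp pB Bp] ph]; exists p => //.
      by rewrite mem_filter pp Bp mem_iota prime_gt0.
    apply: (@leq_trans (\sum_(p <- s) 4)).
      rewrite big_seq [leqRHS]big_seq; apply: leq_sum => p; rewrite mem_filter => /andP[/andP[pp Bp] _].
      have big x : 0 < x -> x * K <= B -> ~~ (p %| x).
        move=> x0 xB; apply/negP => /(dvdn_leq x0) px; move: Bp; rewrite ltnNge (leq_trans _ xB)//.
        by rewrite leq_mul2r px orbT.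
      have Np : ~~ (p %| `|N|) by apply: big => //; rewrite absz_gt0.
      have lp : ~~ (p %| `|lead_coef h|) by apply: big => //; rewrite absz_gt0 lead_coef_eq0.
      have := @count_windows (fun n => ((p ^ 2)%:Z %| h.[n%:Z]%R)%Z) 0 B (p ^ 2) 4.
      rewrite expn_gt0 prime_gt0//= add0n divn_small ?mul1n.
        apply=> // a' _; have := @count_prime_sq h U V N p a' pp E Np lp; by rewrite sh.
      have H : B * B < (p * K) * (p * K) by rewrite ltn_mul.
      rewrite -!mulnn in KB *; rewrite ltnNge; apply/negP => pB.
      have : p * p * (K * K) <= B * B by rewrite leq_mul.
      by rewrite leqNgt mulnACA H.
    rewrite big_const_seq count_predT iter_addn_0 mulnC leq_mul2r /= size_filter.
    by apply: sub_count => p /andP[].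
  have := HM _ MB'; move: H1; have : 0 < K0 by rewrite /K0 addn1.
  move: (cnt (P1 B) B) (cnt prime _) => x y K1p xy H.
  rewrite -(leq_pmul2l K1p) (leq_trans _ H)//.
  have := leq_mul (leqnn (K0 * k.*2)) xy; clear; lia.
apply: (@smallU _ 0 _ (small_twist 1 D1) (small_twist (- 1)%R D2)) => //.
move=> B n _ /andP[n0 nB] /asboolP[p [pp pB] ph].
have [|q [m [m0 sq qE]]] := @sqfree_decomp `|(h.[n%:Z])%R|%N; first by rewrite absz_gt0.
have q0 := sqfree_gt0 sq.
(* As [q] is squarefree, [p ^ 2 %| q * m ^ 2] forces [p %| m]. *)
have pm : p <= m.
  apply: dvdn_leq => //; apply: contraT => pm; have co : coprime (p ^ 2) (m ^ 2).
    by rewrite coprimeXl// coprimeXr// prime_coprime.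
  move: ph; rewrite dvdzE /= qE Gauss_dvdl// => /sq p1; by rewrite p1 in pp.
have qD : q * (D1 + D2) <= B.
  have H1 : q * m ^ 2 <= C * B ^ 3.
    by rewrite -qE (leq_trans (HC _ n0))// leq_mul2l leq_exp2r// nB orbT.
  have H2 : (K0 * B) ^ 2 <= m ^ 2 by rewrite leq_sqr ltnW// (leq_trans pB).
  have B0 : 0 < B by exact: leq_trans nB.
  have H3 : q * K0 ^ 2 <= C * B.
    rewrite -(@leq_pmul2r (B ^ 2)) ?expn_gt0 ?B0// -[leqRHS]mulnA -expnS -mulnA -expnMn.
    by apply: leq_trans H1; rewrite leq_mul2l H2 orbT.
  have [C0|C0] := posnP C.
    move: H3; rewrite C0 mul0n leqn0 muln_eq0 expn_eq0 /K0 addn1 /= orbF => /eqP q00.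
    by rewrite q00.
  rewrite -(leq_pmul2l C0); apply: leq_trans H3; rewrite mulnCA leq_mul2l; apply/orP; right.
  by rewrite /K0 -mulnn addn1; clear; nia.
have hsg : (`|h.[n%:Z]| = (q%:Z * m%:Z ^+ 2))%R by rewrite -abszE qE PoszM -mulnn PoszM expr2.
rewrite hE in hsg; case: (lerP 0%R (depressed_cubic a b n%:Z)) => sg; apply/orP; [left|right]; apply/asboolP; exists q; split => //.
- by rewrite (leq_trans _ qD)// leq_mul2l leq_addr orbT.
- by exists (Posz m); rewrite mul1r -hsg ger0_norm.
- by rewrite (leq_trans _ qD)// leq_mul2l leq_addl orbT.
- by exists (Posz m); rewrite mulN1r -hsg ltr0_norm.
Qed.
End CubicTwists.

Local Open Scope ring_scope.

(** * Reduction of a general cubic to a depressed one *)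

Definition depressed_poly (a b : int) : {poly int} := 'X^3 + a *: 'X + b%:P.

Lemma depressed_polyE (a b x : int) : (depressed_poly a b).[x] = depressed_cubic a b x.
Proof. by rewrite /depressed_poly !hornerD hornerXn hornerZ hornerX hornerC. Qed.

Lemma size_depressed_poly (a b : int) : size (depressed_poly a b) = 4%N.
Proof.
by rewrite /depressed_poly -addrA size_polyDl ?size_polyXn// (leq_ltn_trans (size_polyD _ _))// gtn_max
    (leq_ltn_trans (size_scale_leq _ _)) ?size_polyX// (leq_ltn_trans (size_polyC_leq1 _)).
Qed.

Lemma separated_depressed_poly (a b : int) : 4 * a ^+ 3 + 27 * b ^+ 2 != 0 -> separated (depressed_poly a b).
Proof.
move=> d0; exists (4 * a ^+ 3 + 27 * b ^+ 2).
exists (27 * b%:P - 18 * a%:P * 'X), (4 * a%:P ^+ 2 + (6 * a%:P * 'X - 9 * b%:P) * 'X); split => //.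
rewrite /depressed_poly !derivD derivXn derivZ derivX derivC alg_polyC addr0 -mul_polyC.
rewrite !(rmorphD, rmorphM, rmorph_nat, rmorphXn) /=; ring.
Qed.

(** A depressed cubic of discriminant 0 has a rational multiple root: [- 3 b / (2 a)], or 0 when
    [a = 0]. *)
Lemma no_root_disc (a b : int) : (forall x : rat, depressed_cubic a%:~R b%:~R x != 0) ->
  4 * a ^+ 3 + 27 * b ^+ 2 != 0.
Proof.
move=> irr; apply/eqP => d0.
have D : 4 * (a%:~R : rat) ^+ 3 + 27 * (b%:~R : rat) ^+ 2 = 0.
  by have := congr1 (intr : int -> rat) d0; rewrite !(rmorph_nat, rmorphD, rmorphM, rmorphXn).
case: (eqVneq (a%:~R : rat) 0) => a0.
  move: D; rewrite a0 expr0n mulr0 add0r => /eqP; rewrite mulf_eq0 /= sqrf_eq0 => /eqP b0.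
  by have := irr 0; rewrite a0 b0 /depressed_cubic expr0n mulr0 !addr0 eqxx.
have := irr (- 3 * b%:~R / (2 * a%:~R)) => /negP; apply; apply/eqP; rewrite /depressed_cubic.
have -> : (- 3 * b%:~R / (2 * a%:~R)) ^+ 3 + a%:~R * (- 3 * b%:~R / (2 * a%:~R)) + b%:~R =
   - (b%:~R / (8 * a%:~R ^+ 3)) * (4 * a%:~R ^+ 3 + 27 * b%:~R ^+ 2) :> rat by field.
by rewrite D mulr0.
Qed.

(** The affine map sends [[1, Bd]] injectively into [[1, K1 * Bd]], apart from the few [n <= |B|],
    where it may be nonpositive; the longer range only changes [K] into [K * K1]. *)
Lemma large_square_thin_subst (h H : {poly int}) (A B k : int) : 0 < A -> k != 0 ->
  (forall x, k * h.[x] = H.[A * x + B]) -> large_square_thin H -> large_square_thin h.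
Proof.
move=> A0 k0 hH thH K k'.
pose K1 := (`|A| + `|B|)%N.
have K10 : (0 < K1)%N by rewrite /K1 addn_gt0 absz_gt0 gt_eqF.
have [M HM] := thH (K * K1)%N (k'.*2 * K1)%N.
exists (maxn M (2 * (k' * `|B|)))%N => Bd; rewrite geq_max => /andP[MB BB].
pose P n := `[< exists2 p, prime p /\ (Bd < p * K)%N & ((p ^ 2)%N%:Z %| h.[n%:Z])%Z >].
pose PH n := `[< exists2 p, prime p /\ (K1 * Bd < p * (K * K1))%N & ((p ^ 2)%N%:Z %| H.[n%:Z])%Z >].
have H1 : (cnt P Bd <= `|B| + cnt PH (K1 * Bd))%N.
  apply: (@leq_trans (cnt (fun n => n <= `|B|)%N Bd + cnt (fun n => P n && (`|B| < n))%N Bd)).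
    by apply: cnt_leU => n _ ->; case: leqP.
  rewrite leq_add//; first exact: cnt_fin.
  pose f n := absz (A * n%:Z + B).
  have fE n : (`|B| < n)%N -> (f n)%:Z = A * n%:Z + B.
    move=> Bn; rewrite /f gez0_abs//; move: A0 Bn; clear; nia.
  apply: (@cnt_inj _ _ f).
    move=> x y /andP[_ /andP[_ Bx]] /andP[_ /andP[_ By]] /(congr1 Posz); rewrite !fE// => /addIr.
    by move=> /(mulfI (lt0r_neq0 A0)) [].
  move=> n /andP[n0 nB] /andP[/asboolP[p [pp pB] ph] Bn].
  have fn := fE _ Bn; apply/andP; split.
    have : (0 < f n)%N by rewrite -ltz_nat fn; move: A0 Bn; clear; nia.
    move=> ->; rewrite -lez_nat fn /= PoszM /K1 PoszD.
    move: A0 n0 nB; clear; nia.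
  apply/asboolP; exists p; last by rewrite fn -hH dvdz_mull.
  by split => //; rewrite mulnA mulnC ltn_mul2r K10.
have MB' : (M <= K1 * Bd)%N by rewrite (leq_trans MB)// leq_pmull.
have := HM _ MB'; rewrite -/PH => H2.
have H3 : (k'.*2 * cnt PH (K1 * Bd) <= Bd)%N.
  by rewrite -(leq_pmul2l K10) (leq_trans _ H2)// mulnA [(K1 * _)%N]mulnC.
rewrite -/P; move: H1 H3 BB; rewrite -muln2; move: (cnt P _) (cnt PH _) `|B|%N => x y z; clear; nia.
Qed.

(** A rational root splits off a linear factor by Gauss's lemma, and the identity certifying that
    [h] is separated shows the two factors to be coprime. Without a rational root, [27 A ^ 2 h(x)]
    is a depressed cubic evaluated at [3 A x + B]. *)
Lemma large_square_thin_cubic (R : realType) (h : {poly int}) :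
  size h = 4%N -> separated h -> large_square_thin h.
Proof.
move=> sh seph.
have [[x x0]|nr] := pselect (exists x : rat, root (map_poly intr h) x).
  have : 'X - x%:P %| map_poly intr h by rewrite dvdp_XsubCl.
  move=> /dvdpP_rat_int[L [r r0 LE] [Q hE]].
  have L0 : L != 0 by apply/eqP => L0; move: sh; rewrite hE L0 mul0r size_poly0.
  have Q0 : Q != 0 by apply/eqP => Q0; move: sh; rewrite hE Q0 mulr0 size_poly0.
  have sL : size L = 2%N.
    have := size_XsubC x; rewrite LE size_scale// size_map_inj_poly//; exact: intr_inj.
  have sQ : size Q = 3%N.
    by have := sh; rewrite hE size_mul// sL => -[].
  have [N [U [V [N0 E]]]] := seph; rewrite hE derivM in E.
  have sepL : separated L.
    exists N, (U * Q + V * Q^`()), (V * Q); split => //; rewrite -E; ring.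
  have sepQ : separated Q.
    exists N, (U * L + V * L^`()), (V * L); split => //; rewrite -E; ring.
  rewrite hE; apply: (@large_square_thinM L Q (U * Q + V * Q^`()) (V * L^`()) N) => //.
  - by rewrite -E; ring.
  - exact: large_square_thin_linear.
  exact: (@large_square_thin_quadratic R).
wlog A0 : h sh seph nr / 0 < h`_3.
  move=> W; have h30 : h`_3 != 0 by rewrite -[3%N]/(4.-1) -sh -lead_coefE lead_coef_eq0 -size_poly_eq0 sh.
  case: (ltrP 0 h`_3) => h3; first exact: W.
  apply: (@large_square_thin_dvd h (-1)); apply: W.
  - by rewrite size_scale.
  - have [N [U [V [N0 E]]]] := seph; exists N, (- U), (- V); split => //.
    by rewrite -E derivZ !scaleN1r; ring.
  - move=> [x]; rewrite scaleN1r rmorphN rootN => x0; apply: nr; by exists x.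
  by rewrite scaleN1r coefN oppr_gt0 lt_neqAle h30.
set A := h`_3 in A0; pose B := h`_2; pose C := h`_1; pose D := h`_0.
pose a := 9 * A * C - 3 * B ^+ 2; pose b := 27 * A ^+ 2 * D - 9 * A * B * C + 2 * B ^+ 3.
have hP : h = A *: 'X^3 + B *: 'X^2 + C *: 'X + D%:P.
  apply/polyP => i; rewrite !coefD !coefZ !coefXn coefX coefC.
  case: i => [|[|[|[|i]]]] /=; rewrite ?mulr0 ?mulr1 ?addr0 ?add0r//.
  by rewrite nth_default// sh.
have hE x : h.[x] = A * x ^+ 3 + B * x ^+ 2 + C * x + D.
  by rewrite hP !hornerD !hornerZ !hornerXn hornerX hornerC.
have irr (x : rat) : depressed_cubic a%:~R b%:~R x != 0.
  apply/negP => /eqP x0; apply: nr.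
  have A0' : (A%:~R : rat) != 0 by rewrite intr_eq0 gt_eqF.
  exists ((x - B%:~R) / (3 * A%:~R)); rewrite rootE hP !rmorphD /= !map_polyZ /= !map_polyXn map_polyX map_polyC /=.
  rewrite !hornerD !hornerZ !hornerXn hornerX hornerC -(mulrI_eq0 _ (_ : GRing.lreg (27 * A%:~R ^+ 2))); last first.
    by apply/lregP; rewrite mulf_neq0// expf_neq0.
  apply/eqP; rewrite -[RHS]x0 /depressed_cubic /a /b !(rmorph_nat, rmorphXn, rmorphB, rmorphD, rmorphM).
  by field.
have d0 := no_root_disc irr.
have A3 : 3 * A != 0 by rewrite mulf_neq0// gt_eqF.
apply: (@large_square_thin_subst h (depressed_poly a b) (3 * A) B (27 * A ^+ 2)).
- by rewrite mulr_gt0.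
- by rewrite mulf_neq0// expf_neq0// gt_eqF.
- by move=> x; rewrite depressed_polyE hE /depressed_cubic /a /b; ring.
apply: (large_square_thin_depressed_cubic irr d0) => //.
- exact: size_depressed_poly.
- exact: separated_depressed_poly.
exact: depressed_polyE.
Qed.

(** * Belyi maps *)

Lemma exists_left_kernel (F : fieldType) n (M : 'M[F]_(n.+1, n)) : exists2 v : 'rV_n.+1, v != 0 & v *m M = 0.
Proof.
have : kermx M != 0.
  rewrite -mxrank_eq0 mxrank_ker -lt0n subn_gt0 ltnS; exact: rank_leq_col.
by move=> /rowV0Pn[v /sub_kermxP vM v0]; exists v.
Qed.

Lemma dvdp_comp (F : fieldType) (p q r : {poly F}) : p %| q -> p \Po r %| q \Po r.
Proof. by move=> /dvdpP[u ->]; rewrite comp_polyM dvdp_mull. Qed.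

Lemma comp_poly_sub_dvd (F : fieldType) (p q : {poly F}) (x : F) : q - x%:P %| p \Po q - (p.[x])%:P.
Proof.
have : 'X - x%:P %| p - (p.[x])%:P by rewrite dvdp_XsubCl rootE !hornerE subrr.
by move=> /dvdp_comp -/(_ q); rewrite !comp_polyB comp_polyX !comp_polyC.
Qed.

Lemma size_comp_poly_gt1 (F : fieldType) (p q : {poly F}) :
  (1 < size p)%N -> (1 < size q)%N -> (1 < size (p \Po q)%R)%N.
Proof. by have := size_comp_poly p q; move: (size p) (size q) (size _) => a b c; nia. Qed.

(* The values of [F] at its critical points are roots of a polynomial of degree less than [F]. *)
Lemma critical_values_poly (F : {poly rat}) : (1 < size F)%N ->
  exists2 F1 : {poly rat}, (F1 != 0) && (size F1 < size F)%N & F^`() %| F1 \Po F.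
Proof.
move=> sF; have sF' : size F^`() = (size F).-1 := polyorder.size_deriv F.
have F'0 : F^`() != 0 by rewrite -size_poly_eq0 sF'; move: sF; case: (size F) => [|[]].
pose d := (size F).-2.
have dE : size F = d.+2 by rewrite /d; move: sF; case: (size F) => [|[]].
(* The [d + 1] powers [F ^ i] with [i <= d] are dependent in the [d]-dimensional space of
   polynomials modulo the derivative of [F]; a relation between them is [F1]. *)
pose M : 'M[rat]_(d.+1, d) := \matrix_(i < d.+1) poly_rV (F ^+ i %% F^`()).
have [v v0 vM] := exists_left_kernel M.
pose F1 := \poly_(i < d.+1) v 0 (inord i).
exists F1.
  rewrite dE ltnS size_poly andbT; apply: contra v0 => /eqP F10; apply/eqP/rowP => i.
  by have := congr1 (fun p : {poly rat} => p`_i) F10; rewrite coef_poly ltn_ord inord_val mxE coef0.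
have smod i : (size (F ^+ i %% F^`())%R <= d)%N.
  by have := ltn_modp (F ^+ i) F^`(); rewrite F'0 sF' dE.
rewrite /dvdp; apply/eqP.
have -> : (F1 \Po F) %% F^`() = \sum_(i < d.+1) v 0 i *: (F ^+ i %% F^`()).
  rewrite /F1 poly_def linear_sum /= (big_morph (fun p => p %% F^`()) (modpD _) (mod0p _)).
  by apply: eq_bigr => i _; rewrite linearZ /= modpZl inord_val comp_Xn_poly.
transitivity (rVpoly (v *m M)); last by rewrite vM linear0.
rewrite mulmx_sum_row linear_sum /=; apply: eq_bigr => i _.
by rewrite linearZ /= rowK poly_rV_K.
Qed.

(** Belyi's first reduction: [F] sends its roots to 0 and its critical points to roots of [F1],
    which has smaller degree, and the recursion treats [F1]. Divisibility of a power expresses that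
    roots and critical points lie above the rational set [S], which avoids algebraic numbers. *)
Lemma rational_branch_poly (F : {poly rat}) : F != 0 ->
  exists (psi : {poly rat}) (S : seq rat) (k : nat), (1 < size psi)%N /\
    let P := (\prod_(s <- S) (psi - s%:P)) ^+ k in F %| P /\ psi^`() %| P.
Proof.
have [n] := ubnP (size F); elim: n F => // n IH F; rewrite ltnS => sF F0.
case: (leqP (size F) 1) => sF1.
  exists 'X, [::], 0%N; split; first by rewrite size_polyX.
  have s1 : size F == 1%N by rewrite eqn_leq sF1 lt0n size_poly_eq0.
  by rewrite /= expr0 derivX dvdpp dvdp1.
have [F1 /andP[F10 sF1F] dF1] := critical_values_poly sF1.
have [psi [S [k [spsi [dF dpsi]]]]] := IH F1 (leq_trans sF1F sF) F10.
exists (psi \Po F), (psi.[0] :: S), (k + k).+1; split.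
  exact: size_comp_poly_gt1.
rewrite big_cons exprMn /=.
have compE : \prod_(s <- S) ((psi \Po F) - s%:P) = (\prod_(s <- S) (psi - s%:P)) \Po F.
  rewrite (big_morph (fun p => p \Po F) (fun p q => comp_polyM p q F) (comp_polyC 1 F)).
  by apply: eq_bigr => s _; rewrite comp_polyB comp_polyC.
split.
  apply: dvdp_mulr; apply: dvdp_exp => //; rewrite -[X in X %| _]subr0 -polyC0; exact: comp_poly_sub_dvd.
apply: dvdp_mull; rewrite compE deriv_comp.
apply: (@dvdp_trans _ (((\prod_(s <- S) (psi - s%:P)) \Po F) ^+ (k + k))); last by rewrite exprS dvdp_mull.
rewrite exprD -!(rmorphXn (comp_poly F)) /= dvdp_mul//; first exact: dvdp_comp.
by apply: dvdp_trans dF1 _; exact: dvdp_comp.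
Qed.

(** The inequality of means for [m] copies of [x / r] and [n] copies of [(1 - x) / (1 - r)], whose
    arithmetic mean is 1. *)
Lemma AGM_two (R : realFieldType) (m n : nat) (x r : R) : 0 <= x <= 1 -> 0 < r < 1 ->
  r = m%:R / (m + n)%:R -> x ^+ m * (1 - x) ^+ n <= r ^+ m * (1 - r) ^+ n.
Proof.
move=> /andP[x0 x1] /andP[r0 r1] rE.
pose E (i : 'I_(m + n)) := if (i < m)%N then x / r else (1 - x) / (1 - r).
have E0 : {in predT, forall i, 0 <= E i}.
  by move=> i _; rewrite /E; case: ifP => _; rewrite divr_ge0 ?subr_ge0// ltW// subr_gt0.
have [+ _] := leif_AGM E0; rewrite card_ord.
have sumE : \sum_(i in 'I_(m + n)) E i = (m + n)%:R.
  rewrite big_split_ord /=.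
  rewrite (eq_bigr (fun _ => x / r)); last by move=> i _; rewrite /E /= ltn_ord.
  rewrite [X in _ + X](eq_bigr (fun _ => (1 - x) / (1 - r))); last by move=> i _; rewrite /E /= ltnNge leq_addr.
  rewrite !sumr_const !card_ord -[_ *+ m]mulr_natr -[_ *+ n]mulr_natr.
  have mn0 : (m + n)%:R != 0 :> R by apply: contraTneq r0 => mn; rewrite rE mn invr0 mulr0 ltxx.
  have mE : m%:R = r * (m + n)%:R by rewrite rE divfK.
  have nE : n%:R = (1 - r) * (m + n)%:R by rewrite mulrBl mul1r -mE natrD addrC addKr.
  have [rn r1n] : r != 0 /\ 1 - r != 0 by rewrite subr_eq0 [1 == r]eq_sym (gt_eqF r0) (lt_eqF r1).
  by rewrite mE nE; field; rewrite ?rn ?r1n.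
have prodE : \prod_(i in 'I_(m + n)) E i = (x / r) ^+ m * ((1 - x) / (1 - r)) ^+ n.
  rewrite big_split_ord /=.
  rewrite (eq_bigr (fun _ => x / r)); last by move=> i _; rewrite /E /= ltn_ord.
  rewrite [X in _ * X](eq_bigr (fun _ => (1 - x) / (1 - r))); last by move=> i _; rewrite /E /= ltnNge leq_addr.
  by rewrite !prodr_const !card_ord.
rewrite sumE prodE divff ?expr1n; last by apply: contraTneq r0 => mn; rewrite rE mn invr0 mulr0 ltxx.
have r1' : 0 < 1 - r by rewrite subr_gt0.
by rewrite !expr_div_n mulrACA -invfM ler_pdivrMr ?mul1r// mulr_gt0 ?exprn_gt0.
Qed.

Lemma rat_unit_interval (r : rat) : 0 < r < 1 -> exists m n : nat, [/\ (0 < m)%N, (0 < n)%N & r = m%:R / (m + n)%:R].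
Proof.
move=> /andP[r0 r1]; pose m := `|numq r|%N; pose d := `|denq r|%N.
have mE : (m%:R : rat) = (numq r)%:~R by rewrite pmulrn /m gez0_abs// numq_ge0 ltW.
have dE : (d%:R : rat) = (denq r)%:~R by rewrite pmulrn /d gez0_abs// ltW// denq_gt0.
have rE : r = m%:R / d%:R by rewrite mE dE divq_num_den.
have d0 : 0 < d%:R :> rat by rewrite dE ltr0z denq_gt0.
have md : (m < d)%N by move: r1; rewrite rE ltr_pdivrMr// mul1r ltr_nat.
exists m, (d - m)%N; rewrite subn_gt0 md subnKC ?(ltnW md)//; split => //.
by rewrite absz_gt0 numq_eq0 gt_eqF.
Qed.

(** All finite critical values are 0 or 1; the exponent [k] absorbs multiplicities. *)
Definition Belyi_map (phi : {poly rat}) := exists k, phi^`() %| (phi * (phi - 1)) ^+ k.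

Lemma zero_one_dvd (p q : {poly rat}) (x : rat) : p.[x] = 0 \/ p.[x] = 1 ->
  q - x%:P %| (p \Po q) * ((p \Po q) - 1).
Proof.
move=> px; have := comp_poly_sub_dvd p q x; case: px => -> H; last exact: dvdp_mull.
by apply: dvdp_mulr; move: H; rewrite polyC0 subr0.
Qed.

(** The last factor on the right is the derivative of [c * x ^ (m + 1) * (1 - x) ^ (k + 1)], written
    out so that [ring] applies; besides 0 and 1 it can vanish only at [r]. *)
Lemma Belyi_deriv_identity (R : comPzRingType) (x r c : R) (m k : nat) :
  (m.+1 + k.+1)%:R * r = m.+1%:R ->
  (m.+1 + k.+1)%:R * (c * (x ^+ m.+1 * (1 - x) ^+ k.+1) * (x - r)) =
  - (x * (1 - x)) * (c * (x ^+ m * m.+1%:R * (1 - x) ^+ k.+1 - x ^+ m.+1 * ((1 - x) ^+ k * k.+1%:R))).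
Proof.
move=> rE; rewrite mulrBr [in LHS]mulrBr [X in _ - X](_ : _ = c * (x ^+ m.+1 * (1 - x) ^+ k.+1) * ((m.+1 + k.+1)%:R * r)); last by ring.
rewrite rE natrD !exprS; ring.
Qed.

(* With [r = m / (m + k)], the map [x ^ m * (1 - x) ^ k], scaled to take the value [1] at [r], preserves the unit
   interval, sends [0] and [1] to [0], and has no critical point besides [0], [1] and [r]. *)
Lemma Belyi_unit_interval (S : seq rat) : {in S, forall s, 0 <= s <= 1} ->
  exists P : {poly rat}, [/\ (1 < size P)%N, P.[0] = 0 \/ P.[0] = 1, P.[1] = 0 \/ P.[1] = 1,
    {in S, forall s, P.[s] = 0 \/ P.[s] = 1} & Belyi_map P].
Proof.
have [n] := ubnP (size S); elim: n S => // n IH [|r S] /=; rewrite ltnS => sS S01.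
  exists 'X; rewrite size_polyX !hornerX; split; [by []|by left|by right|by []|].
  by exists 0%N; rewrite derivX expr0.
have r01 := S01 r (mem_head _ _).
have S01' : {in S, forall s, 0 <= s <= 1} by move=> s sS'; apply: S01; rewrite inE sS' orbT.
have [r0|r0] := eqVneq r 0.
  have [P [P1 P2 P3 P4 P5]] := IH S sS S01'; exists P; split => // s.
  by rewrite inE => /orP[/eqP ->|/P4//]; rewrite r0.
have [r1|r1] := eqVneq r 1.
  have [P [P1 P2 P3 P4 P5]] := IH S sS S01'; exists P; split => // s.
  by rewrite inE => /orP[/eqP ->|/P4//]; rewrite r1.
have r01' : 0 < r < 1 by move: r01; rewrite !lt_neqAle eq_sym r0 r1.
have [m [k [m0 k0 rE]]] := rat_unit_interval r01'.
have /andP[rp r1p] := r01'; have r1p' : 0 < 1 - r by rewrite subr_gt0.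
pose c := (r ^+ m * (1 - r) ^+ k)^-1.
have c0 : 0 < c by rewrite invr_gt0 mulr_gt0 ?exprn_gt0.
pose B : {poly rat} := c *: ('X ^+ m * (1 - 'X) ^+ k).
have BE x : B.[x] = c * (x ^+ m * (1 - x) ^+ k).
  by rewrite /B hornerZ hornerM !horner_exp hornerD hornerN hornerX hornerC.
have Br : B.[r] = 1 by rewrite BE mulVf// gt_eqF// mulr_gt0 ?exprn_gt0.
have B0 : B.[0] = 0 by rewrite BE expr0n eqn0Ngt m0 mul0r mulr0.
have B1 : B.[1] = 0 by rewrite BE subrr expr0n eqn0Ngt k0 !mulr0.
have B01 x : 0 <= x <= 1 -> 0 <= B.[x] <= 1.
  move=> x01; have /andP[x0 x1] := x01; rewrite BE mulr_ge0 ?(ltW c0)//=; last first.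
    by rewrite mulr_ge0 ?exprn_ge0// subr_ge0.
  by rewrite mulrC ler_pdivrMr ?mul1r ?mulr_gt0 ?exprn_gt0// AGM_two.
(* [B] sends [r] to 1, where the recursive [P] takes the value 0 or 1 anyway, so only the images of
   the rest of the list remain to be treated. *)
have [|s /mapP[x xS ->]|P [P1 P2 P3 P4 [e P5]]] := IH [seq B.[x] | x <- S].
- by rewrite size_map.
- by apply: B01; exact: S01'.
have sB : (1 < size B)%N.
  rewrite ltnNge; apply/negP => /size1_polyC BC; move: Br B0; rewrite BC !hornerC => -> /eqP.
  by rewrite oner_eq0.
exists (P \Po B); split.
- exact: size_comp_poly_gt1.
- by rewrite horner_comp B0.
- by rewrite horner_comp B1.
- move=> s; rewrite inE horner_comp => /orP[/eqP ->|sS']; first by rewrite Br.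
  by apply: P4; exact: map_f.
exists (e + 2)%N; rewrite deriv_comp exprD dvdp_mul//.
  by rewrite -[1](comp_polyC _ B) -comp_polyB -comp_polyM -(rmorphXn (comp_poly B)); exact: dvdp_comp.
have dB0 : B %| (P \Po B) * ((P \Po B) - 1).
  by have := zero_one_dvd B P2; rewrite polyC0 subr0.
have dB1 : 'X - r%:P %| (P \Po B) * ((P \Po B) - 1).
  apply: dvdp_trans (zero_one_dvd B P3); rewrite dvdp_XsubCl rootE hornerD hornerN hornerC Br subrr//.
rewrite expr2; apply: dvdp_trans (dvdp_mul dB0 dB1).
have N0 : (m + k)%:R != 0 :> rat by apply: contraTneq rp => mn; rewrite rE mn invr0 mulr0 ltxx.
have NE : (m + k)%:R * r%:P = m%:R :> {poly rat} by rewrite -polyC_natr -polyCM mulrC rE divfK// polyC_natr.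
rewrite -(@dvdpZr _ (m + k)%:R)// -mul_polyC polyC_natr; apply/dvdpP.
exists (- ('X * (1 - 'X))); rewrite /B derivZ derivM !deriv_exp derivB derivX derivC.
rewrite -!mul_polyC -[_ *+ m]mulr_natr -[_ *+ k]mulr_natr.
have N'E : (m.-1.+1 + k.-1.+1)%:R * r%:P = m.-1.+1%:R :> {poly rat} by rewrite !prednK.
have := @Belyi_deriv_identity {poly rat} 'X r%:P c%:P m.-1 k.-1 N'E; rewrite !prednK// => ->.
ring.
Qed.

Lemma rat_seq_bound (S : seq rat) : exists2 M : rat, 0 < M & {in S, forall s, `|s| <= M}.
Proof.
elim: S => [|r S [M M0 SM]]; first by exists 1.
exists (M + `|r|); first by rewrite ltr_wpDr.
move=> s; rewrite inE => /orP[/eqP ->|/SM sM]; first by rewrite lerDr ltW.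
by rewrite (le_trans sM)// lerDl.
Qed.

Lemma Belyi_finite (S : seq rat) :
  exists P : {poly rat}, [/\ (1 < size P)%N, {in S, forall s, P.[s] = 0 \/ P.[s] = 1} & Belyi_map P].
Proof.
have [M M0 SM] := rat_seq_bound S; pose c := (M *+ 2)^-1.
have c0 : 0 < c by rewrite invr_gt0 mulrn_wgt0.
pose A := c *: ('X + M%:P).
have AE x : A.[x] = c * (x + M) by rewrite hornerZ hornerD hornerX hornerC.
have sA : size A = 2 by rewrite size_scale ?gt_eqF// size_XaddC.
have [s /mapP[x xS ->]|P [P1 _ _ P4 [e P5]]] := @Belyi_unit_interval [seq A.[s] | s <- S].
  have := SM x xS; rewrite ler_norml => /andP[xM Mx].
  rewrite AE mulr_ge0 ?(ltW c0)//=; last by rewrite -lerBlDr sub0r.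
  by rewrite mulrC /c ler_pdivrMr ?mulrn_wgt0// mul1r mulr2n lerD2r.
exists (P \Po A); split; first by rewrite size_comp_poly_gt1 ?sA.
  by move=> s sS; rewrite horner_comp; apply: P4; exact: map_f.
exists e; rewrite deriv_comp derivZ derivD derivX derivC addr0 -scalerAr mulr1 dvdpZl ?gt_eqF//.
by rewrite -[1](comp_polyC _ A) -comp_polyB -comp_polyM -(rmorphXn (comp_poly A)); exact: dvdp_comp.
Qed.

Lemma Belyi_weak (F : {poly rat}) : F != 0 -> exists (phi : {poly rat}) (k : nat),
  [/\ (1 < size phi)%N, F %| (phi * (phi - 1)) ^+ k & phi^`() %| (phi * (phi - 1)) ^+ k].
Proof.
move=> F0; have [psi [S [k [spsi [dF dpsi]]]]] := rational_branch_poly F0.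
have [P [sP PS [e dP]]] := Belyi_finite S.
pose W := (P \Po psi) * ((P \Po psi) - 1).
have dS : \prod_(s <- S) (psi - s%:P) %| W ^+ size S.
  elim: S PS {dF dpsi} => [|s S IH] PS; first by rewrite big_nil dvd1p.
  rewrite big_cons exprS dvdp_mul ?IH//; first by apply: zero_one_dvd; apply: PS; rewrite mem_head.
  by move=> x xS; apply: PS; rewrite inE xS orbT.
have dSk : (\prod_(s <- S) (psi - s%:P)) ^+ k %| W ^+ (size S * k) by rewrite exprM dvdp_exp2r.
exists (P \Po psi), (e + size S * k)%N; rewrite -/W exprD; split; first exact: size_comp_poly_gt1.
  by rewrite dvdp_mull// (dvdp_trans dF).
rewrite deriv_comp dvdp_mul//; last exact: dvdp_trans dpsi dSk.
by rewrite /W -[1](comp_polyC _ psi) -comp_polyB -comp_polyM -(rmorphXn (comp_poly psi)); exact: dvdp_comp.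
Qed.

Lemma dvdp_mup (F : closedFieldType) (p q : {poly F}) : p != 0 -> q != 0 ->
  (forall x, root p x -> (mup x p <= mup x q)%N) -> p %| q.
Proof.
have [n] := ubnP (size p); elim: n p q => // n IH p q; rewrite ltnS => sp p0 q0 pq.
have [/eqP s1|/closed_rootP[x rx]] := boolP (size p == 1).
  by have /eqP/size_poly1P[c c0 ->] := s1; rewrite -[c%:P]mulr1 mul_polyC dvdpZl// dvd1p.
have mx : (0 < mup x p)%N by rewrite -XsubC_dvd// dvdp_XsubCl.
have : 'X - x%:P %| q by rewrite XsubC_dvd// (leq_trans mx)// pq.
have : 'X - x%:P %| p by rewrite dvdp_XsubCl.
move=> /dvdpP[p1 pE] /dvdpP[q1 qE]; subst p q.
have p10 : p1 != 0 by apply: contraNneq p0 => ->; rewrite mul0r.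
have q10 : q1 != 0 by apply: contraNneq q0 => ->; rewrite mul0r.
rewrite dvdp_mul2r ?polyXsubC_eq0//; apply: IH => //.
  by move: sp; rewrite size_Mmonic ?monicXsubC// size_XsubC addn2.
move=> y ry; have := pq y; rewrite rootM ry => /(_ isT).
by rewrite !mupM ?polyXsubC_eq0// leq_add2r.
Qed.

Lemma mup_deriv (F : numFieldType) (p : {poly F}) (x : F) : p != 0 -> root p x ->
  mup x p = (mup x p^`()).+1.
Proof.
move=> p0 rx; have [m [q]] := multiplicity_XsubC p x; rewrite p0 /= => qx pE.
case: m pE => [|m] pE; first by move: rx qx; rewrite pE mulr1 => ->.
have mE : mup x p = m.+1 by rewrite pE mupMr// mup_XsubCX eqxx.
rewrite mE; congr S; symmetry.
have -> : p^`() = (q^`() * ('X - x%:P) + q * m.+1%:R) * ('X - x%:P) ^+ m.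
  by rewrite pE derivM deriv_exp derivXsubC mul1r /= -mulr_natr exprS; ring.
rewrite mupMr ?mup_XsubCX ?eqxx// rootE hornerD !hornerM hornerD hornerN hornerX hornerC subrr mulr0 add0r.
by rewrite -polyC_natr hornerC mulf_neq0// pnatr_eq0.
Qed.

Lemma separable_mup (F : numFieldType) (p : {poly F}) (x : F) : separable_poly p -> (mup x p <= 1)%N.
Proof.
move=> sp; have p0 := separable_poly_neq0 sp.
by rewrite mup_leq// separable_nosquare// size_XsubC.
Qed.

(* [G] is the radical of [phi * (phi - 1)]; its degree is one more than the degree of [phi]. *)
Lemma Belyi (F : {poly rat}) : separable_poly F -> exists (phi G : {poly rat}) (e : nat),
  [/\ (1 < size phi)%N, phi * (phi - 1) = phi^`() * G, F %| G & phi * (phi - 1) %| G ^+ e].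
Proof.
move=> sF; have F0 := separable_poly_neq0 sF.
have [phi [k [sphi dF dphi]]] := Belyi_weak F0.
have sphi' : size phi^`() = (size phi).-1 := polyorder.size_deriv phi.
have phi'0 : phi^`() != 0 by rewrite -size_poly_eq0 sphi'; move: sphi; case: (size phi) => [|[]].
have phi0 : phi != 0 by apply: contraTneq sphi => ->; rewrite size_poly0.
have phi10 : phi - 1 != 0.
  by apply: contraTneq sphi => /eqP; rewrite subr_eq0 => /eqP ->; rewrite size_poly1.
pose W := phi * (phi - 1); have W0 : W != 0 by rewrite mulf_neq0.
pose i (p : {poly rat}) := map_poly (ratr : rat -> algC) p.
have i0 p : p != 0 -> i p != 0 by rewrite /i map_poly_eq0.
have iW : i W = i phi * (i phi - 1) by rewrite /i rmorphM rmorphB rmorph1.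
(* [phi] and [phi - 1] have no common root, and at a root of either one differentiation lowers the
   multiplicity by exactly 1. *)
have mW x : root (i W) x -> mup x (i W) = (mup x (i phi^`())).+1.
  rewrite iW {1}/root hornerM hornerD hornerN hornerC mulf_eq0 subr_eq0 => /orP[/eqP rx|/eqP rx].
    rewrite mupMl; last by rewrite rootE hornerD hornerN hornerC rx sub0r oppr_eq0 oner_eq0.
    by rewrite mup_deriv ?i0 ?rootE ?rx// /i -deriv_map.
  rewrite mupMr; last by rewrite rootE rx oner_eq0.
  have -> : i phi - 1 = i (phi - 1) by rewrite /i rmorphB rmorph1.
  rewrite mup_deriv ?i0//; last by rewrite /i rmorphB rmorph1 rootE hornerD hornerN hornerC rx subrr.
  by rewrite /i deriv_map derivB derivC subr0.
have rW p x : p %| W ^+ k -> root (i p) x -> root (i W) x.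
  move=> pW rx; have : root (i (W ^+ k)) x by apply: root_dvdp rx; rewrite /i dvdp_map.
  by rewrite /i rmorphXn rootE horner_exp expf_eq0 => /andP[].
have dW : phi^`() %| W.
  rewrite -(dvdp_map (ratr : {rmorphism rat -> algC})); apply: dvdp_mup; [exact: i0|exact: i0|].
  by move=> x rx; rewrite mW ?(rW phi^`()).
have /dvdpP[G WE] := dW; rewrite mulrC in WE.
have G0 : G != 0 by apply: contraNneq W0 => G0; rewrite WE G0 mulr0.
have mG x : root (i W) x -> mup x (i G) = 1%N.
  move=> rx; have := mW x rx; rewrite WE /i rmorphM mupM ?i0//= -addn1 => /addnI; exact.
exists phi, G, (size W); split => //.
  rewrite -(dvdp_map (ratr : {rmorphism rat -> algC})); apply: dvdp_mup; [exact: i0|exact: i0|].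
  move=> x rx; rewrite mG ?(rW F)//; apply: separable_mup.
  by rewrite separable_map.
rewrite -(dvdp_map (ratr : {rmorphism rat -> algC})); apply: dvdp_mup; [exact: i0|by rewrite i0// expf_neq0|].
move=> x rx; have iWx : i W != 0 := i0 _ W0.
rewrite mup_geq ?i0 ?expf_neq0// /i rmorphXn.
apply: (@dvdp_trans _ (('X - x%:P) ^+ size W)); last by rewrite dvdp_exp2r// XsubC_dvd ?mG//; exact: i0.
apply: dvdp_exp2l; rewrite -(size_map_poly (ratr : {rmorphism rat -> algC}) W) ltnW//.
by rewrite -(size_exp_XsubC _ x) dvdp_leq// -mup_geq.
Qed.

(** * Radicals and the abc conjecture *)

Local Open Scope nat_scope.

Definition rad (n : nat) := \prod_(p <- primes n) p.

Lemma rad_gt0 n : 0 < rad n.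
Proof. by rewrite /rad big_seq; apply: prodn_cond_gt0 => p; rewrite mem_primes => /andP[/prime_gt0]. Qed.

Lemma rad_dvd n : rad n %| n.
Proof.
case: n => [|n]; first exact: dvdn0.
by apply: prod_primes_dvd; [exact: primes_uniq|move=> p; rewrite mem_primes => /and3P[-> _ ->]].
Qed.

Lemma rad_le m n : 0 < n -> (forall p, prime p -> p %| m -> p %| n) -> rad m <= rad n.
Proof.
move=> n0 mn; apply: dvdn_leq; first exact: rad_gt0.
apply: prod_primes_dvd; first exact: primes_uniq.
move=> p; rewrite mem_primes => /and3P[pp _ pm]; split=> //.
have : p \in primes n by rewrite mem_primes pp n0 mn.
by rewrite /rad => /(big_rem p) ->; rewrite dvdn_mulr.
Qed.

Lemma radM m n : 0 < m -> 0 < n -> rad (m * n) <= rad m * rad n.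
Proof.
move=> m0 n0; apply: dvdn_leq; first by rewrite muln_gt0 !rad_gt0.
apply: prod_primes_dvd; first exact: primes_uniq.
move=> p; rewrite primesM// !mem_primes m0 n0 /= => /orP[] /andP[pp pm]; split=> //.
  by apply: dvdn_mulr; rewrite /rad (big_rem p) ?dvdn_mulr// mem_primes pp m0.
by apply: dvdn_mull; rewrite /rad (big_rem p) ?dvdn_mulr// mem_primes pp n0.
Qed.

(** [k * p ^ 2] and [k * p] have the same prime divisors. *)
Lemma rad_prime_sq p n : prime p -> 0 < n -> p ^ 2 %| n -> rad n * p <= n.
Proof.
move=> pp n0 /dvdnP[k nE]; move: n0; rewrite nE muln_gt0 => /andP[k0 _].
have kp : rad (k * p ^ 2) <= k * p.
  apply: leq_trans (dvdn_leq _ (rad_dvd (k * p))); last by rewrite muln_gt0 k0 prime_gt0.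
  apply: rad_le; first by rewrite muln_gt0 k0 prime_gt0.
  by move=> q pq; rewrite !Euclid_dvdM// orbb.
by apply: leq_trans (leq_mul kp (leqnn p)) _; rewrite -mulnA mulnn.
Qed.

Lemma rad_leq n : 0 < n -> rad n <= n.
Proof. by move=> n0; apply: dvdn_leq n0 (rad_dvd n). Qed.

(* The [abc] conjecture with [eps = 1 / E], raised to the power [E]. *)
Lemma abc_nat (R : realType) E : abc_conjecture R -> 0 < E -> exists C : nat, forall a b c,
  0 < a -> 0 < b -> gcdn a (gcdn b c) = 1 -> a + b = c -> c ^ E <= C * rad (a * b * c) ^ E.+1.
Proof.
move=> abc E0; have e0 : (0 < (E%:R^-1 : R))%R by rewrite invr_gt0 ltr0n.
have [C [C0 HC]] := abc _ e0.
have CE0 : (0 <= C ^+ E)%R by rewrite exprn_ge0// ltW.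
exists (Num.truncn (C ^+ E)%R).+1 => a b c a0 b0 g abcE.
have c0 : 0 < c by rewrite -abcE addn_gt0 a0.
have := HC a b c a0 b0 c0 g abcE; rewrite -[(\prod_(p <- _) _)%R](natr_prod _ _ _ id) -/(rad _).
set r := rad _ => cr.
have : (c%:R ^+ E <= (C * r%:R `^ (1 + E%:R^-1)) ^+ E)%R.
  by rewrite lerXn2r ?nnegrE// ?ltW// mulr_gt0// powR_gt0// ltr0n rad_gt0.
rewrite exprMn -(powR_mulrn E (powR_ge0 _ _)) -powRrM mulrDl mul1r mulVf ?pnatr_eq0 -?lt0n//.
rewrite -[X in (E%:R + X)%R]/(1%:R)%R -natrD addn1 powR_mulrn ?ler0n// => H.
rewrite -(ler_nat R) natrM !natrX; apply: le_trans H _.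
by rewrite ler_wpM2r ?exprn_ge0 ?ler0n// ltW// truncnS_gt.
Qed.

(** After division by the gcd, the primes of the reduced triple are among those of the original
    one. *)
Lemma abc_nat_gcd (R : realType) E : abc_conjecture R -> 0 < E -> exists C : nat, forall a b c,
  0 < a -> 0 < b -> a + b = c -> c ^ E <= gcdn a b ^ E * (C * rad (a * b * c) ^ E.+1).
Proof.
move=> abc E0; have [C HC] := abc_nat abc E0; exists C => a b c a0 b0 abcE.
have g0 : 0 < gcdn a b by rewrite gcdn_gt0 a0.
set g := gcdn a b in g0 *; have [a' aE] := dvdnP (dvdn_gcdl a b : g %| a).
have [b' bE] := dvdnP (dvdn_gcdr a b : g %| b).
have a'0 : 0 < a' by move: a0; rewrite aE muln_gt0 => /andP[].
have b'0 : 0 < b' by move: b0; rewrite bE muln_gt0 => /andP[].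
have co : gcdn a' b' = 1.
  by apply/eqP; rewrite -(eqn_pmul2r g0) mul1n muln_gcdl -aE -bE.
have co3 : gcdn a' (gcdn b' (a' + b')) = 1 by rewrite gcdnA co gcd1n.
have := HC a' b' (a' + b') a'0 b'0 co3 erefl.
have cE : c = (a' + b') * g by rewrite mulnDl -aE -bE.
move=> H; rewrite {1}cE expnMn [leqLHS]mulnC leq_pmul2l ?expn_gt0 ?g0//; apply: leq_trans H _.
rewrite leq_mul2l leq_exp2r// rad_le ?orbT// ?muln_gt0 ?a0 ?b0 -?abcE ?addn_gt0 ?a0//.
by move=> p pp; rewrite abcE aE bE cE !Euclid_dvdM// => /orP[/orP[]|] ->; rewrite ?orbT.
Qed.

Local Open Scope ring_scope.

Lemma rat_poly_clear (p : {poly rat}) :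
  exists (L : nat) (P : {poly int}), (0 < L)%N /\ map_poly intr P = L%:R *: p.
Proof.
have [q [a a0 ->]] := rat_poly_scale p; exists `|a ^+ 2|%N, (a *: q); split.
  by rewrite absz_gt0 expf_neq0.
have -> : `|a ^+ 2|%N%:R = a%:~R ^+ 2 :> rat by rewrite -rmorphXn /= natr_absz ger0_norm ?sqr_ge0.
by rewrite scalerA expr2 mulfK ?intr_eq0// -!mul_polyC rmorphM /= map_polyC.
Qed.

Lemma poly_int_growth (R : realType) (p : {poly int}) : p != 0 ->
  exists N : nat, forall n : nat, (N <= n)%N -> (n ^ (size p).-1 <= 2 * `|p.[n%:Z]|)%N.
Proof.
move=> p0; have sp : size (map_poly (intr : int -> R) p) = (size p).-1.+1.
  by rewrite size_map_intr prednK// size_poly_gt0.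
have [N HN] := poly_growth sp; exists N => n Nn.
have := HN n%:R; rewrite ler_nat Nn => /(_ isT).
rewrite horner_intr => H; rewrite -(ler_nat R) natrX natrM natr_absz intr_norm.
apply: le_trans (_ : 2 * (`|lead_coef (map_poly intr p)| / 2 * n%:R ^+ (size p).-1) <= _); last by rewrite ler_wpM2l.
rewrite mulrA mulrCA divff ?mulr1 ?pnatr_eq0// -[leLHS]mul1r ler_wpM2r ?exprn_ge0//.
rewrite lead_coefE size_map_intr coef_map /= -intr_norm -[1]/(1%:~R) ler_int.
by rewrite -gtz0_ge1 normr_gt0 -lead_coefE lead_coef_eq0.
Qed.

(* Apply [abc] to [Phi n], [Phi n - L] and [L], where [phi = Phi / L] is a Belyi map of degree [N] whose radical is
   [F * H]: since [deg (F * H) = N + 1], the factor [rad (F n)] has to make up for [deg F - 1] powers of [n]. *)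
Lemma abc_rad_bound (R : realType) (F : {poly int}) (C2 : nat) :
  abc_conjecture R -> (2 < size F)%N -> separable_poly (map_poly intr F : {poly rat}) ->
  exists N0 : nat, forall n : nat, (N0 <= n)%N -> (C2 * n ^ (size F - 3) < rad `|F.[n%:Z]|)%N.
Proof.
move=> abc sF sepF; have [phi [G [e [sphi WE /dvdpP[H GE] /dvdpP[Z ZE]]]]] := Belyi sepF.
have F0 : F != 0 by apply: contraTneq sF => ->; rewrite size_poly0.
have sFq : size (map_poly (intr : int -> rat) F) = size F by rewrite size_map_inj_poly//; exact: intr_inj.
pose N := (size phi).-1; have N0 : (0 < N)%N by rewrite /N; move: sphi; case: (size phi) => [|[]].
have sphi' : size phi^`() = N := polyorder.size_deriv phi.
have phi0 : phi != 0 by apply: contraTneq sphi => ->; rewrite size_poly0.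
have phi1 : size (phi - 1) = size phi by rewrite size_polyDl// size_polyN size_poly1.
have phi10 : phi - 1 != 0 by rewrite -size_poly_eq0 phi1 size_poly_eq0.
have phi'0 : phi^`() != 0 by rewrite -size_poly_eq0 sphi' -lt0n.
have G0 : G != 0.
  by apply: contra_eq_neq WE => ->; rewrite mulr0 mulf_neq0.
have H0 : H != 0 by apply: contraNneq G0 => H0; rewrite GE H0 mul0r.
have FQ0 : map_poly (intr : int -> rat) F != 0 by rewrite -size_poly_eq0 sFq size_poly_eq0.
have sG : size G = N.+2.
  have := congr1 (fun p : {poly rat} => size p) WE; rewrite !size_mul// phi1 sphi' -/N.
  have -> : size phi = N.+1 by rewrite prednK// size_poly_gt0.
  by move: (size G) => b; clear -N0; clearbody N; lia.
have sH : size H = (N + 3 - size F)%N.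
  by have := congr1 (fun p : {poly rat} => size p) GE; rewrite size_mul// sFq sG; move: sF; move: (size H) (size F) => a b; clear; clearbody N; lia.
have sH0 : (0 < size H)%N by rewrite size_poly_gt0.
have [L [Phi [L0 PhiE]]] := rat_poly_clear phi.
have [L2 [Hz [L20 HzE]]] := rat_poly_clear H.
have [L3 [Zz [L30 ZzE]]] := rat_poly_clear Z.
have natr0 (m : nat) : (0 < m)%N -> (m%:R : rat) != 0 by rewrite pnatr_eq0 lt0n.
have sPhi : size Phi = N.+1.
  rewrite -(size_map_inj_poly (f := intr : int -> rat) (@intr_inj _)) // PhiE size_scale ?natr0//.
  by rewrite prednK// size_poly_gt0.
have sHz : size Hz = size H.
  by rewrite -(size_map_inj_poly (f := intr : int -> rat) (@intr_inj _)) // HzE size_scale ?natr0.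
have PhiN0 : Phi != 0 by rewrite -size_poly_eq0 sPhi.
have HzN0 : Hz != 0 by rewrite -size_poly_eq0 sHz size_poly_eq0.
(* [phi * (phi - 1)] divides a power of [G = F * H]. With denominators cleared, every prime dividing
   [x * y] divides [K0] or one of the values of [Hz] and [F] at [n]. *)
have key : (L ^ 2 * L3)%:R *: (Hz * F) ^+ e = (L2 ^ e)%:R *: (Phi * (Phi - L%:R%:P) * Zz).
  apply: (map_inj_poly (f := intr : int -> rat) (@intr_inj _)) => //.
  rewrite -!mul_polyC !rmorphM rmorphXn rmorphM rmorphB /= !map_polyC /= PhiE HzE ZzE !rmorph_nat.
  rewrite -scalerAl -GE -!mul_polyC !polyC_natr exprMn ZE natrX; ring.
have keyN (n : nat) : (L ^ 2 * L3 * (`|Hz.[n%:Z]| * `|F.[n%:Z]|) ^ e =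
    L2 ^ e * (`|Phi.[n%:Z]| * `|Phi.[n%:Z] - L%:Z| * `|Zz.[n%:Z]|))%N.
  have := congr1 (fun p : {poly int} => `|p.[n%:Z]|%N) key.
  rewrite !hornerZ horner_exp !hornerM hornerD hornerN hornerC !natz !abszM abszX abszM.
  by rewrite !absz_nat.
have [Cb HCb] := abc_nat_gcd abc N0.
have [NP HP] := poly_int_growth R PhiN0.
have [NF HF] := poly_int_growth R F0.
have [NH HH] := poly_int_growth R HzN0.
have [|CH HCH] := @horner_bound Hz (N + 2 - size F) _.
  by rewrite sHz sH; move: sH0; rewrite sH; clear -sF; clearbody N; lia.
have [K0 K00 [LK0 LLK0]] : exists2 K0 : nat, (0 < K0)%N & (L %| K0)%N /\ (L ^ 2 * L3 %| K0)%N.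
  by exists (L * (L ^ 2 * L3))%N; rewrite ?muln_gt0 ?L0 ?L30// dvdn_mulr// dvdn_mull.
pose K := (2 ^ N * (L ^ N * (Cb * (K0 * CH * C2) ^ N.+1)))%N.
exists (NP + NF + NH + 2 * L + 1 + K)%N => n Nn.
rewrite ltnNge; apply/negP => radF.
have [n0 [nP [nF [nH [nL nK]]]]] : (0 < n)%N /\ (NP <= n)%N /\ (NF <= n)%N /\ (NH <= n)%N /\ (2 * L < n)%N /\ (K < n)%N.
  by move: Nn; clear; clearbody K; lia.
have pow0 m : (0 < n ^ m)%N by rewrite expn_gt0 n0.
set x := `|Phi.[n%:Z]|%N.
have xn : (n ^ N <= 2 * x)%N by have := HP n nP; rewrite sPhi.
have F1 : (0 < `|F.[n%:Z]|)%N by have := leq_trans (pow0 _) (HF n nF); rewrite muln_gt0.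
have H1 : (0 < `|Hz.[n%:Z]|)%N by have := leq_trans (pow0 _) (HH n nH); rewrite muln_gt0.
have nN : (n <= n ^ N)%N by rewrite -[leqLHS]expn1 leq_pexp2l.
have Lx : (L < x)%N by move: nN xn nL; clear; lia.
set y := `|Phi.[n%:Z] - L%:Z|%N.
have xy : x = (y + L)%N \/ y = (x + L)%N by rewrite /x /y; move: Lx; rewrite /x; clear; lia.
have x0 : (0 < x)%N by move: Lx; clear; lia.
have hr : (rad (x * y * L) <= K0 * CH * C2 * n ^ N.-1)%N.
  apply: leq_trans (_ : rad (K0 * (`|Hz.[n%:Z]| * `|F.[n%:Z]|)) <= _)%N.
    apply: rad_le => [|p pp]; first by rewrite !muln_gt0 K00 H1 F1.
    rewrite mulnC Euclid_dvdM// => /orP[pL|pxy]; first by rewrite dvdn_mulr// (dvdn_trans pL).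
    have : (p %| L ^ 2 * L3 * (`|Hz.[n%:Z]| * `|F.[n%:Z]|) ^ e)%N.
      by rewrite keyN dvdn_mull// dvdn_mulr.
    rewrite Euclid_dvdM// => /orP[pL|]; first by rewrite dvdn_mulr// (dvdn_trans pL).
    by rewrite Euclid_dvdX// => /andP[pH _]; rewrite dvdn_mull.
  apply: leq_trans (radM _ _) _; rewrite ?muln_gt0 ?H1 ?F1//.
  have -> : (n ^ N.-1 = n ^ (N + 2 - size F) * n ^ (size F - 3))%N.
    by rewrite -expnD; congr (n ^ _)%N; move: sH0; rewrite sH; clear -sF N0; clearbody N; lia.
  rewrite [leqRHS](_ : _ = K0 * ((CH * n ^ (N + 2 - size F)) * (C2 * n ^ (size F - 3))))%N; last by ring.
  rewrite leq_mul ?rad_leq// (leq_trans (radM _ _))// leq_mul//.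
  by apply: leq_trans (rad_leq H1) _; exact: HCH.
have hx : (x ^ N <= L ^ N * (Cb * rad (x * y * L) ^ N.+1))%N.
  have gL m : (gcdn m L <= L)%N by rewrite dvdn_leq// dvdn_gcdr.
  case: xy => E.
    have y0 : (0 < y)%N by move: Lx E; clear; lia.
    have := HCb y L x y0 L0 (esym E).
    rewrite [X in rad X](_ : _ = x * y * L)%N; last by ring.
    by move=> /leq_trans; apply; rewrite leq_mul2r leq_exp2r// gL orbT.
  have := HCb x L y x0 L0 (esym E).
  rewrite [X in rad X](_ : _ = x * y * L)%N; last by ring.
  move=> H2; apply: leq_trans (_ : y ^ N <= _)%N; first by rewrite leq_exp2r// E leq_addr.
  by apply: leq_trans H2 _; rewrite leq_mul2r leq_exp2r// gL orbT.
(* With [eps = 1 / N], a radical of order [n ^ (N - 1)] contradicts abc by one power of [n], since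
   [N ^ 2 = (N - 1) * (N + 1) + 1]. *)
suff : (n ^ (N * N) <= K * n ^ (N.-1 * N.+1))%N.
  have -> : (N * N = (N.-1 * N.+1).+1)%N by clear -N0; clearbody N; case: N N0 => //= m _; ring.
  by rewrite expnS leq_pmul2r// leqNgt nK.
apply: leq_trans (_ : 2 ^ N * x ^ N <= _)%N; first by rewrite expnM -expnMn leq_exp2r.
rewrite /K -mulnA leq_mul2l; apply/orP; right; apply: leq_trans hx _.
rewrite -!mulnA leq_mul2l; apply/orP; right; rewrite leq_mul2l; apply/orP; right.
by rewrite expnM -expnMn leq_exp2r// !mulnA.
Qed.

(** * Large square factors under the abc conjecture *)

Lemma separable_polyE (R : idomainType) (p : {poly R}) : separable_poly p = coprimep p p^`().
Proof. by rewrite unlock. Qed.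

Lemma separable_comp_shift (F : fieldType) (p : {poly F}) (c : F) :
  separable_poly p -> separable_poly (p \Po ('X + c%:P)).
Proof.
rewrite !separable_polyE => /Bezout_eq1_coprimepP[[u v] /= E].
apply/Bezout_eq1_coprimepP; exists (u \Po ('X + c%:P), v \Po ('X + c%:P)).
rewrite /= deriv_comp derivD derivX derivC addr0 mulr1 -!comp_polyM -comp_polyD E.
exact: comp_polyC.
Qed.

(** The two factors share a root only if [j] is a difference of roots; [s] exceeds every such
    difference that is a natural number. *)
Lemma separable_shift_mul (p : {poly rat}) : separable_poly p ->
  exists s : nat, forall j : nat, (s <= j)%N -> separable_poly (p * (p \Po ('X + j%:R%:P))).
Proof.
move=> sp; have p0 := separable_poly_neq0 sp.
pose pC := map_poly (ratr : rat -> algC) p.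
have [rs pE] := closed_field_poly_normal pC.
have pC0 : pC != 0 by rewrite map_poly_eq0.
have inrs x : root pC x -> x \in rs.
  by rewrite pE rootZ ?lead_coef_eq0// root_prod_XsubC.
exists (\sum_(x <- rs) \sum_(y <- rs) Num.truncn (y - x)).+1 => j sj.
rewrite separable_mul sp separable_comp_shift//=.
rewrite -(coprimep_map (ratr : {rmorphism rat -> algC})); apply: Pdiv.ClosedField.root_coprimep => x rx.
rewrite map_comp_poly rmorphD /= map_polyX map_polyC /= rmorph_nat horner_comp hornerD hornerX hornerC.
apply/negP => /eqP ry; have xs := inrs x rx; have ys : x + j%:R \in rs by apply: inrs; apply/eqP.
move: sj; rewrite (big_rem x)//= (big_rem (x + j%:R) ys)/= addrC addKr natrK.
by rewrite -addnA -addSn ltnNge leq_addr.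
Qed.

(* If [p ^ 2 %| h n] and [q ^ 2 %| h (n + j)] with [p, q] of order at least [B], then [rad (h n * h (n + j))] is too
   small for the squarefree polynomial [h(X) h(X + j)]; hence exceptional [n] are bunched or far apart. *)
Lemma large_square_thin_abc (R : realType) (h : {poly int}) : abc_conjecture R -> (1 < size h)%N ->
  separable_poly (map_poly intr h : {poly rat}) -> large_square_thin h.
Proof.
move=> abc sh seph K; have h0 : h != 0 by apply: contraTneq sh => ->; rewrite size_poly0.
have [s Hs] := separable_shift_mul seph; pose d := (size h).-1.
have dE : size h = d.+1 by rewrite prednK// ltnW.
have d0 : (0 < d)%N by move: sh; rewrite dE.
have [|C' HC'] := @horner_bound h d _; first by rewrite dE.
pose C := C'.+1; have HC n : (0 < n)%N -> (`|h.[n%:Z]| <= C * n ^ d)%N.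
  by move=> n0; apply: leq_trans (HC' n n0) _; rewrite leq_mul2r leqnSn orbT.
(* Gaps [j <= s] are tolerated, because [h(X) * h(X + j)] may have a repeated factor for such
   [j]. *)
apply: (@thin_gap s.+1) => // W.
pose F j := h * (h \Po ('X + j%:R%:P)).
have sF j : size (F j) = (d + d).+1.
  have sc : size (h \Po ('X + j%:R%:P)) = d.+1 by rewrite size_comp_poly2 ?dE// size_XaddC.
  have hc0 : h \Po ('X + j%:R%:P) != 0 by rewrite -size_poly_eq0 sc.
  by rewrite size_mul// sc dE /= addnS.
pose C2 := ((C * K) * (C * K * 2 ^ d))%N.
have HF j : (s < j)%N -> exists N0 : nat, forall n : nat, (N0 <= n)%N -> (C2 * n ^ (d + d - 2) < rad `|(F j).[n%:Z]|)%N.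
  move=> sj; have [||N0 HN0] := @abc_rad_bound R (F j) C2 abc; first by rewrite sF; move: d0; clear; clearbody d; lia.
    rewrite rmorphM /= map_comp_poly rmorphD /= map_polyX map_polyC /= rmorph_nat; exact: Hs (ltnW sj).
  exists N0 => n /HN0; by rewrite sF subSS.
have [N HN] : exists N : nat, forall n j : nat, (N <= n)%N -> (s < j < W)%N ->
    (C2 * n ^ (d + d - 2) < rad `|(F j).[n%:Z]|)%N.
  elim: W => [|W [N HN]]; first by exists 0%N => n j _; rewrite ltn0 andbF.
  case: (ltnP s W) => sW; last first.
    by exists 0%N => n j _ /andP[sj]; rewrite ltnS => /(leq_trans sj); rewrite ltnNge sW.
  have [N' HN'] := HF W sW; exists (N + N')%N => n j Nn; rewrite ltnS [(j <= W)%N]leq_eqVlt => /andP[sj /orP[/eqP ->|jW]].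
    by apply: HN'; apply: leq_trans Nn; rewrite leq_addl.
  by apply: HN; [apply: leq_trans Nn; rewrite leq_addr|rewrite sj].
exists (N + W + 1)%N => B n n' Nn /andP[nn' n'B] n'W.
move=> /asboolP[p [pp pB] ph] /asboolP[q [pq qB] qh].
rewrite ltnS leqNgt; apply/negP => sj; set j := (n' - n)%N in sj.
have n'E : n' = (n + j)%N by rewrite subnKC// ltnW.
have [Nn1 [Wn n0]] : (N <= n /\ W <= n /\ 0 < n)%N by move: Nn; clear; lia.
have jW : (j < W)%N by move: n'W; rewrite n'E ltn_add2l.
have := HN n j Nn1; rewrite sj jW => /(_ isT); rewrite ltnNge => /negP; apply.
(* The radical of [h m] is at most [|h m| / r], and [r > B / K >= m / K]: a square factor gains a
   full power of [m]. *)
have radb (r m : nat) : prime r -> (B < r * K)%N -> (0 < m)%N -> (m <= B)%N -> (r ^ 2 %| `|h.[m%:Z]|)%N ->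
    (0 < `|h.[m%:Z]|)%N -> (rad `|h.[m%:Z]| <= C * K * m ^ d.-1)%N.
  move=> pr rB m0 mB rh hm; rewrite -(leq_pmul2r m0).
  apply: leq_trans (_ : rad `|h.[m%:Z]| * (r * K) <= _)%N; first by rewrite leq_mul2l (leq_trans mB (ltnW rB)) orbT.
  rewrite mulnA; apply: leq_trans (_ : `|h.[m%:Z]| * K <= _)%N; first by rewrite leq_mul2r rad_prime_sq ?orbT.
  rewrite -mulnA -expnSr prednK// mulnAC leq_mul2r; apply/orP; right; exact: HC.
(* As [rad 0 = 1], a zero value only needs the upper bound to be positive. *)
have [Fz|Fn] := posnP `|(F j).[n%:Z]|%N.
  have K0 : (0 < K)%N by have := leq_ltn_trans (leq0n B) pB; rewrite muln_gt0 => /andP[].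
  by rewrite Fz /rad /= big_nil !muln_gt0 !expn_gt0 K0 n0.
have FE : `|(F j).[n%:Z]|%N = (`|h.[n%:Z]| * `|h.[n'%:Z]|)%N.
  by rewrite /F hornerM horner_comp hornerD hornerX hornerC abszM natz -PoszD -n'E.
move: Fn; rewrite FE muln_gt0 => /andP[h1 h2].
apply: leq_trans (radM h1 h2) _.
apply: leq_trans (_ : (C * K * n ^ d.-1) * (C * K * n' ^ d.-1) <= _)%N.
  by apply: leq_mul; [apply: (radb p)|apply: (radb q)] => //; move: nn' n'B n0; clear; lia.
rewrite /C2; apply: leq_trans (_ : (C * K * n ^ d.-1) * (C * K * (2 ^ d * n ^ d.-1)) <= _)%N.
  rewrite !leq_mul2l; do 2 (apply/orP; right).
  apply: leq_trans (_ : (2 * n) ^ d.-1 <= _)%N; last by rewrite expnMn leq_mul2r leq_exp2l// leq_pred orbT.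
  have [->|d1] := posnP d.-1; first by rewrite !expn0.
  by rewrite leq_exp2r// n'E; move: jW Wn; clear; lia.
have -> : (n ^ (d + d - 2) = n ^ d.-1 * n ^ d.-1)%N by rewrite -expnD; congr (n ^ _)%N; move: d0; clear; clearbody d; lia.
by apply/eq_leq; ring.
Qed.

(** By Gauss's lemma a square factor over the rationals yields a primitive integral one; in
    characteristic 0 there is no other obstruction to separability. *)
Lemma squarefree_separable (h : {poly int}) : h != 0 -> squarefree_poly h ->
  separable_poly (map_poly intr h : {poly rat}).
Proof.
move=> h0 sqf; apply/separable_polyP; split=> [|u _ su]; last first.
  rewrite -size_poly_eq0 polyorder.size_deriv; by move: su; case: (size u) => [|[]].
apply/poly_square_freeP => u su; apply/negP; have [q [a a0 uE]] := rat_poly_scale u.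
have su' : size q = size u by rewrite uE size_scale ?invr_eq0 ?intr_eq0// size_rat_int_poly.
rewrite uE exprZn dvdpZl ?expf_neq0 ?invr_eq0 ?intr_eq0// -rmorphXn dvdp_rat_int => /dvdpP_int[r].
rewrite expr2 zprimitiveM -expr2 mulrC => /sqf; rewrite poly_unitE size_zprimitive su'.
by rewrite (negPf su).
Qed.

Lemma separable_separated (h : {poly int}) : separable_poly (map_poly intr h : {poly rat}) -> separated h.
Proof.
rewrite separable_polyE => /Bezout_eq1_coprimepP[[u v] /= E].
have [L [U [L0 UE]]] := rat_poly_clear u; have [M [V [M0 VE]]] := rat_poly_clear v.
exists (L * M)%:Z, (M%:R *: U), (L%:R *: V); split; first by rewrite eqz_nat -lt0n muln_gt0 L0.
apply: (map_inj_poly (f := intr : int -> rat) (@intr_inj _)) => //.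
have D : map_poly intr h^`() = (map_poly intr h)^`() :> {poly rat} by rewrite deriv_map.
rewrite -!mul_polyC rmorphD !rmorphM /= !map_polyC /= UE VE D !rmorph_nat -!mul_polyC.
rewrite [RHS](_ : _ = L%:R * M%:R * 1); last by rewrite mulr1 -natrM -polyC_natr.
by rewrite -[X in _ = _ * X]E !polyC_natr; ring.
Qed.

Lemma image_size_deg_ge2 (R : realType) (f : {poly int}) (c : int) (g h : {poly int}) :
  f != 0 -> f = c%:P * g ^+ 2 * h -> squarefree_poly h -> (2 <= (size h).-1)%N ->
  ((3 < (size h).-1)%N -> abc_conjecture R) ->
  forall k, exists B0, forall B, (B0 <= B -> k * (B - image_size f B) <= B)%N.
Proof.
move=> f0 fE sqf sh abc.
have h0 : h != 0 by apply: contraNneq f0 => h0; rewrite fE h0 mulr0.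
have seph := squarefree_separable h0 sqf; have seph' := separable_separated seph.
have sh2 : (2 < size h)%N by move: sh; case: (size h) => [|m]; rewrite ?ltnS.
apply: (thin_good f0 fE); last first.
  by move=> u v u0 v0; exact: (@thin_collision R).
apply: square_divisor_small => //.
have [s3|s3] := eqVneq (size h) 3%N; first exact: (@large_square_thin_quadratic R).
have [s4|s4] := eqVneq (size h) 4%N; first exact: (@large_square_thin_cubic R).
apply: (@large_square_thin_abc R) => //; last exact: ltnW.
by apply: abc; move: sh2 s3 s4; case: (size h) => [|[|[|[|[|m]]]]].
Qed.

(** * The value of zeta at 2 *)

Local Open Scope classical_set_scope.
Local Open Scope ring_scope.

Lemma cvgn_dist (R : realType) (u : nat -> R) (l : R) :
  u @ \oo --> l <-> (forall e, 0 < e -> exists N : nat, forall n, (N <= n)%N -> `|u n - l| <= e).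
Proof.
split=> [/cvgrPdist_le ul e e0|H].
  by have [N _ HN] := ul e e0; exists N => n Nn; rewrite distrC; apply: HN.
apply/cvgrPdist_le => e e0; have [N HN] := H e e0; exists N => // n Nn /=; rewrite distrC; exact: HN.
Qed.

Lemma cvgn_unique (R : realType) (u : nat -> R) (k l : R) : u @ \oo --> k -> u @ \oo --> l -> k = l.
Proof. by move=> uk ul; rewrite -(cvg_lim (@Rhausdorff R) uk) (cvg_lim (@Rhausdorff R) ul). Qed.

(** The mean value theorem for [sin] and [tan] gives [x * cos x <= sin x <= x], and
    [1 / sin ^ 2 = 1 + cos ^ 2 / sin ^ 2]. *)
Lemma sub_div_sin (R : realType) (x : R) : 0 < x < pi / 2 ->
  x ^- 2 <= (sin x) ^- 2 <= x ^- 2 + 1.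
Proof.
move=> /andP[x0 xpi].
have s0 : 0 < sin x by rewrite sin_gt0_pihalf ?x0.
have c0 : 0 < cos x by rewrite cos_gt0_pihalf// xpi andbT (lt_trans _ x0)// oppr_lt0 divr_gt0 ?pi_gt0.
have sx : sin x <= x.
  have [|z zI E] := @MVT_segment R sin cos 0 x (ltW x0).
    exact/continuous_subspaceT/continuous_sin.
  by move: E; rewrite sin0 !subr0 => ->; rewrite -[leRHS]mul1r ler_wpM2r ?cos_le1// ltW.
have xt : x * cos x <= sin x.
  have cz (z : R) : z \in `]0, x[ -> 0 < cos z.
    rewrite in_itv /= => /andP[z0 zx]; rewrite cos_gt0_pihalf// (lt_trans zx xpi) andbT.
    by rewrite (lt_trans _ z0)// oppr_lt0 divr_gt0 ?pi_gt0.
  have [|| z zI E] := @MVT R tan (fun y => (cos y) ^- 2) 0 x x0.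
  - by move=> y yI; apply: is_derive_tan; rewrite gt_eqF// cz.
  - apply/continuous_in_subspaceT => y /[!(@mem_setE R)]; rewrite in_itv /= => /andP[y0 yx].
    apply: continuous_tan; rewrite gt_eqF// cos_gt0_pihalf// (le_lt_trans yx xpi) andbT.
    by rewrite (lt_le_trans _ y0)// oppr_lt0 divr_gt0 ?pi_gt0.
  move: E; rewrite tan0 !subr0 /tan => E.
  rewrite -ler_pdivlMr// E -[leLHS]mul1r ler_wpM2r ?(ltW x0)//.
  by rewrite invf_ge1 ?exprn_gt0 ?cz// exprn_ile1 ?cos_le1// ltW ?cz.
rewrite lef_pV2 ?posrE ?exprn_gt0// lerXn2r ?nnegrE ?(ltW s0) ?(ltW x0)//= .
have -> : x ^- 2 + 1 = (1 + x ^+ 2) / x ^+ 2.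
  by field; rewrite gt_eqF.
rewrite ler_pdivlMr ?exprn_gt0// mulrC ler_pdivrMr ?exprn_gt0//.
have : (x * cos x) ^+ 2 <= sin x ^+ 2 by rewrite lerXn2r ?nnegrE ?mulr_ge0// ltW.
by rewrite exprMn cos2sin2; move: (x ^+ 2) (sin x ^+ 2) => a b; lra.
Qed.

Lemma sin_halves (R : realType) (y : R) : sin (y *+ 2) != 0 ->
  (sin y) ^- 2 + (sin (y + pi / 2)) ^- 2 = 4 * (sin (y *+ 2)) ^- 2.
Proof.
rewrite sinDpihalf sin_mulr2n => H.
have [s0 c0] : sin y != 0 /\ cos y != 0.
  by split; apply: contraNneq H => ->; rewrite ?mul0r ?mulr0 mul0rn.
have E := cos2Dsin2 y; rewrite -[_ *+ 2]mulr_natr.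
rewrite [LHS](_ : _ = (cos y ^+ 2 + sin y ^+ 2) / (cos y ^+ 2 * sin y ^+ 2)); last by field; rewrite s0 c0.
by rewrite E; field; rewrite s0 c0.
Qed.

(* Hofbauer's route to [zeta 2]: iterate [1 / sin y ^ 2 + 1 / cos y ^ 2 = 4 / sin (2 y) ^ 2] from [x = pi / 2],
   then compare [1 / sin t ^ 2] with [1 / t ^ 2]. *)
Lemma sum_inv_sin (R : realType) (n : nat) (x : R) : 0 < x < pi ->
  \sum_(0 <= k < 2 ^ n) (sin ((x + k%:R * pi) / 2 ^+ n)) ^- 2 = 4 ^+ n * (sin x) ^- 2.
Proof.
move=> /andP[x0 xpi]; elim: n => [|n IH].
  by rewrite expn0 big_nat1 mul0r addr0 !expr0 divr1 mul1r.
have p2 : (2 : R) ^+ n != 0 by rewrite expf_neq0// pnatr_eq0.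
have e2 : (2 ^ n.+1 = 2 ^ n + 2 ^ n)%N by rewrite expnS mul2n addnn.
rewrite e2 (@big_cat_nat _ _ _ (2 ^ n)) ?leq_addr//=.
rewrite -[X in _ + \sum_(X <= _ < _) _]add0n big_addn addnK -big_split /=.
rewrite [4 ^+ n.+1]exprS -[RHS]mulrA -IH mulr_sumr; apply: eq_big_nat => k /andP[_ kn].
set y := (x + k%:R * pi) / 2 ^+ n.+1.
have y2 : y *+ 2 = (x + k%:R * pi) / 2 ^+ n by rewrite /y -mulr_natr exprS; field.
have -> : (x + (k + 2 ^ n)%N%:R * pi) / 2 ^+ n.+1 = y + pi / 2.
  by rewrite /y natrD natrX exprS; field.
rewrite -y2 sin_halves// y2 gt_eqF// sin_gt0_pi// divr_gt0 ?exprn_gt0//=; last first.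
  by rewrite ltr_wpDr// mulr_ge0// pi_ge0.
rewrite ltr_pdivrMr ?exprn_gt0// -natrX; apply: (@lt_le_trans _ _ (k.+1%:R * pi)).
  by rewrite -natr1 mulrDl mul1r addrC ltrD2l.
by rewrite mulrC ler_wpM2l ?pi_ge0// ler_nat.
Qed.

(** At [x = pi / 2] with [2 ^ (m + 1)] terms, the symmetry [t -> pi - t] folds the second half of
    the sum onto the first. *)
Lemma sum_odd_inv_sin (R : realType) (m : nat) :
  \sum_(0 <= k < 2 ^ m) (sin ((k.*2.+1)%:R * pi / 2 ^+ m.+2)) ^- 2 = 4 ^+ m * 2 :> R.
Proof.
have pi0 : (0 : R) < pi := pi_gt0 R.
have := @sum_inv_sin R m.+1 (pi / 2); rewrite sin_pihalf expr1n invr1 mulr1.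
have pih : 0 < (pi / 2 : R) < pi by move: pi0; move: (pi : R) => p; lra.
move=> /(_ pih).
have e2 : (2 ^ m.+1 = 2 ^ m + 2 ^ m)%N by rewrite expnS mul2n addnn.
rewrite {1}e2 (@big_cat_nat _ _ _ (2 ^ m)) ?leq_addr//=.
rewrite -[X in _ + \sum_(X <= _ < _) _]add0n big_addn addnK.
have p2 : (2 : R) ^+ m != 0 by rewrite expf_neq0// pnatr_eq0.
have tE (k : nat) : (pi / 2 + k%:R * pi) / 2 ^+ m.+1 = (k.*2.+1)%:R * pi / 2 ^+ m.+2 :> R.
  have -> : (k.*2.+1)%:R = 2 * k%:R + 1 :> R by rewrite -natr1 -mul2n natrM.
  by rewrite !exprS; field.
rewrite (eq_bigr (fun k : nat => (sin ((k.*2.+1)%:R * pi / 2 ^+ m.+2)) ^- 2 : R)); last first.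
  by move=> k _; rewrite tE.
rewrite [X in _ + X](_ : _ = \sum_(0 <= k < 2 ^ m) (sin ((k.*2.+1)%:R * pi / 2 ^+ m.+2)) ^- 2); last first.
  rewrite big_nat_rev /= add0n; apply: eq_big_nat => k /andP[_ km].
  rewrite tE; congr (_ ^- 2).
  have -> : ((2 ^ m - k.+1 + 2 ^ m).*2.+1)%:R * pi / 2 ^+ m.+2 = pi - (k.*2.+1)%:R * pi / 2 ^+ m.+2 :> R.
    have -> : ((2 ^ m - k.+1 + 2 ^ m).*2.+1)%:R = 2 ^+ m.+2 - (k.*2.+1)%:R :> R.
      apply/eqP; rewrite eq_sym subr_eq -natrD -natrX eqr_nat; apply/eqP; rewrite !expnS.
      by move: km; clear; move: (2 ^ m)%N => a; lia.
    by rewrite mulrBl mulrBl mulrAC divff ?mul1r// expf_neq0// pnatr_eq0.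
  by rewrite sinB sinpi cospi mul0r sub0r mulN1r opprK.
rewrite [4 ^+ m.+1]exprS; move: (\sum_(_ <= _ < _) _) (4 ^+ m) => a b; lra.
Qed.

(* Partial sums of [zeta 2] deprived of its Euler factors at the primes dividing [A]. *)
Definition inv_sq_sum (R : realType) (A M : nat) : R :=
  \sum_(1 <= s < M.+1 | coprime s A) s%:R ^- 2.

Lemma inv_sq_sumS (R : realType) A M :
  inv_sq_sum R A M.+1 = inv_sq_sum R A M + (if coprime M.+1 A then M.+1%:R ^- 2 else 0).
Proof. by rewrite /inv_sq_sum big_mkcond /= big_nat_recr //= -big_mkcond. Qed.

(** Among the [s] coprime to [A], the multiples of [p] are the [p * s'] with [s'] coprime to [A]. *)
Lemma inv_sq_sum_prime (R : realType) A M p : prime p -> coprime p A ->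
  inv_sq_sum R (A * p) M = inv_sq_sum R A M - p%:R ^- 2 * inv_sq_sum R A (M %/ p).
Proof.
move=> pp pA; elim: M => [|M IH]; first by rewrite div0n /inv_sq_sum !big_geq// mulr0 subr0.
rewrite (inv_sq_sumS _ (A * p)) (inv_sq_sumS _ A M) IH coprimeMr [coprime M.+1 p]coprime_sym [coprime p M.+1]prime_coprime// divnS ?prime_gt0//.
have [pM|pM] := boolP (p %| M.+1)%N; last by rewrite andbT add0n addrAC.
have ME : M.+1 = ((M %/ p).+1 * p)%N by rewrite -[LHS](divnK pM) divnS ?prime_gt0// pM.
rewrite andbF addr0 add1n inv_sq_sumS ME coprimeMl pA andbT.
case: ifP => _; last by rewrite !addr0.
have -> : ((M %/ p).+1 * p)%:R ^- 2 = p%:R ^- 2 * (M %/ p).+1%:R ^- 2 :> R by rewrite natrM exprMn invfM mulrC.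
by rewrite mulrDr; move: (p%:R ^- 2 * _) (p%:R ^- 2 * _) => x y; ring.
Qed.

(** Telescoping, from [1 / (x + 1) ^ 2 <= 1 / x - 1 / (x + 1)]. *)
Lemma inv_sq_sum_tail (R : realType) A M N : (0 < M <= N)%N ->
  inv_sq_sum R A M <= inv_sq_sum R A N <= inv_sq_sum R A M + M%:R^-1 - N%:R^-1.
Proof.
move=> /andP[M0 MN]; rewrite -(subnKC MN); elim: (N - M)%N => [|k IH]; first by rewrite addn0 lexx addrK lexx.
rewrite addnS inv_sq_sumS; have /andP[I1 I2] := IH; apply/andP; split.
  by apply: le_trans I1 _; rewrite lerDl; case: ifP => // _; rewrite invr_ge0 exprn_ge0.
apply: le_trans (lerD I2 (_ : _ <= ((M + k)%:R^-1 - (M + k).+1%:R^-1))) _; last by rewrite addrA subrK.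
have mk0 : (0 : R) < (M + k)%:R by rewrite ltr0n addn_gt0 M0.
have mk1 : (0 : R) < (M + k).+1%:R by rewrite ltr0n.
apply: (@le_trans _ _ ((M + k).+1%:R ^- 2)).
  by case: ifP => // _; rewrite invr_ge0 exprn_ge0.
rewrite -natr1; move: mk0; move: ((M + k)%:R : R) => x x0; rewrite -subr_ge0.
have x1 : 0 < x + 1 by rewrite addr_gt0.
have -> : x^-1 - (x + 1)^-1 - (x + 1) ^- 2 = (x * (x + 1) ^+ 2)^-1 by field; rewrite !gt_eqF.
by rewrite invr_ge0 mulr_ge0 ?exprn_ge0 ?ltW.
Qed.

Lemma cvg_inv_sq_sum (R : realType) A : exists Z : R, inv_sq_sum R A @ \oo --> Z.
Proof.
suff : cvgn (inv_sq_sum R A) by move=> H; exists (lim (inv_sq_sum R A @ \oo)).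
apply: nondecreasing_is_cvgn.
  apply/nondecreasing_seqP => n; rewrite inv_sq_sumS lerDl; case: ifP => // _.
exists (inv_sq_sum R A 1 + 1) => _ [n _ <-]; case: n => [|n].
  have I0 : inv_sq_sum R A 0 = 0 by rewrite /inv_sq_sum big_geq.
  by rewrite inv_sq_sumS I0 add0r addr_ge0//; case: ifP => // _; rewrite invr_ge0 exprn_ge0.
have /andP[_ H] := @inv_sq_sum_tail R A 1 n.+1 isT.
by apply: le_trans H _; rewrite invr1 gerBl invr_ge0.
Qed.

Lemma inv_sq_sum_bounds (R : realType) A (Z : R) M : inv_sq_sum R A @ \oo --> Z -> (0 < M)%N ->
  inv_sq_sum R A M <= Z <= inv_sq_sum R A M + M%:R^-1.
Proof.
move=> /cvgn_dist HZ M0; apply/andP; split; apply/ler_addgt0Pr => e e0; have [N HN] := HZ e e0.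
  have := HN (maxn N M) (leq_maxl _ _); rewrite ler_distl => /andP[_ H].
  by apply: le_trans H; have /andP[] := @inv_sq_sum_tail R A M (maxn N M) ltac:(by rewrite M0 leq_maxr).
have := HN (maxn N M) (leq_maxl _ _); rewrite ler_distl => /andP[H _].
have /andP[_ H2] := @inv_sq_sum_tail R A M (maxn N M) ltac:(by rewrite M0 leq_maxr).
rewrite -lerBlDr; apply: le_trans H _; apply: le_trans H2 _.
by rewrite gerBl invr_ge0.
Qed.

Lemma inv_sq_sum_limit_ge1 (R : realType) A (Z : R) : inv_sq_sum R A @ \oo --> Z -> 1 <= Z.
Proof.
move=> HZ; have /andP[] := inv_sq_sum_bounds HZ (isT : (0 < 1)%N).
have I0 : inv_sq_sum R A 0 = 0 by rewrite /inv_sq_sum big_geq.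
by rewrite inv_sq_sumS coprime1n I0 add0r expr1n invr1.
Qed.

Lemma cvg_inv_sq_sum_prime (R : realType) A p (Z : R) : prime p -> coprime p A ->
  inv_sq_sum R A @ \oo --> Z -> inv_sq_sum R (A * p) @ \oo --> Z * (1 - p%:R ^- 2).
Proof.
move=> pp pA ZA; have -> : inv_sq_sum R (A * p) = fun M => inv_sq_sum R A M - p%:R ^- 2 * inv_sq_sum R A (M %/ p).
  by apply/funext => M; rewrite inv_sq_sum_prime.
rewrite mulrBr mulr1 [Z * _]mulrC; apply: cvgB => //; apply: cvgM; first exact: cvg_cst.
apply: (cvg_comp (fun M => M %/ p)%N _ _ ZA); apply/cvgnyPge => N.
by exists (N * p)%N => // M /= NM; rewrite leq_divRL ?prime_gt0.
Qed.

Lemma sum_odd_sq (R : realType) m :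
  inv_sq_sum R 2 (2 ^ m.+1) = \sum_(0 <= k < 2 ^ m) (k.*2.+1)%:R ^- 2.
Proof.
rewrite expnS mul2n; elim: (2 ^ m)%N => [|n IH]; first by rewrite /inv_sq_sum !big_geq.
rewrite big_nat_recr //= -IH doubleS !inv_sq_sumS !coprimen2 /= odd_double /= addr0//.
Qed.

(** With [t k = (2 k + 1) * pi / 2 ^ (m + 2)], the sum of the [1 / t k ^ 2] differs from [2 * 4 ^ m]
    by at most 1 for each of the [2 ^ m] terms. After scaling by [pi ^ 2 / 16 / 4 ^ m] the error
    tends to 0. As convergence is known, a subsequence identifies the limit. *)
Lemma basel_odd (R : realType) : inv_sq_sum R 2 @ \oo --> (pi ^+ 2 / 8 : R).
Proof.
have [Z HZ] := cvg_inv_sq_sum R 2; suff <- : Z = pi ^+ 2 / 8 by [].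
have pi0 : (0 : R) < pi := pi_gt0 R.
have H m : pi ^+ 2 / 8 - pi ^+ 2 / 16 / 2 ^+ m <= inv_sq_sum R 2 (2 ^ m.+1) <= pi ^+ 2 / 8.
  rewrite sum_odd_sq; pose t (k : nat) : R := (k.*2.+1)%:R * pi / 2 ^+ m.+2.
  have p2 : (0 : R) < 2 ^+ m by rewrite exprn_gt0.
  have t0 k : (k < 2 ^ m)%N -> 0 < t k < pi / 2.
    move=> km; apply/andP; split; first by rewrite /t; apply: divr_gt0; [apply: mulr_gt0|rewrite exprn_gt0].
    rewrite /t ltr_pdivrMr ?exprn_gt0// mulrC -mulrA ltr_pM2l//.
    have -> : (k.*2.+1)%:R = 2 * k%:R + 1 :> R by rewrite -natr1 -mul2n natrM.
    have : (k.+1%:R : R) <= 2 ^+ m by rewrite -natrX ler_nat.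
    by rewrite -natr1 !exprS; move: p2; clear; move: (k%:R : R) (2 ^+ m) => a b; lra.
  have E : \sum_(0 <= k < 2 ^ m) (k.*2.+1)%:R ^- 2 = pi ^+ 2 / 16 / 4 ^+ m * \sum_(0 <= k < 2 ^ m) t k ^- 2.
    have fld (a b e : R) : 0 < a -> 0 < b -> 0 < e -> a ^- 2 = b ^+ 2 / 16 / (e * e) * (a * b / (2 * (2 * e))) ^- 2.
      by move=> a0 b0 e0; field; rewrite !gt_eqF.
    rewrite mulr_sumr; apply: eq_bigr => k _; rewrite /t.
    have -> : (4 : R) ^+ m = 2 ^+ m * 2 ^+ m by rewrite -exprMn -natrM.
    have -> : (2 : R) ^+ m.+2 = 2 * (2 * 2 ^+ m) by rewrite !exprS.
    by apply: fld; rewrite ?ltr0n.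
  have L : \sum_(0 <= k < 2 ^ m) t k ^- 2 <= 4 ^+ m * 2.
    rewrite -sum_odd_inv_sin; apply: ler_sum_nat => k /andP[_ km].
    by have /andP[] := sub_div_sin (t0 k km).
  have U : 4 ^+ m * 2 <= \sum_(0 <= k < 2 ^ m) t k ^- 2 + 2 ^+ m.
    have -> : (2 : R) ^+ m = \sum_(0 <= k < 2 ^ m) 1 by rewrite sumr_const_nat subn0 natrX.
    rewrite -sum_odd_inv_sin -big_split /=.
    apply: ler_sum_nat => k /andP[_ km].
    by have /andP[] := sub_div_sin (t0 k km).
  rewrite E; have c0 : 0 <= pi ^+ 2 / 16 / 4 ^+ m :> R by rewrite !divr_ge0 ?exprn_ge0 ?ltW.
  have p4 : (4 : R) ^+ m = 2 ^+ m * 2 ^+ m by rewrite -exprMn -natrM.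
  apply/andP; split.
    apply: (@le_trans _ _ (pi ^+ 2 / 16 / 4 ^+ m * (4 ^+ m * 2 - 2 ^+ m))).
      by rewrite p4 le_eqVlt; apply/orP; left; apply/eqP; field; rewrite gt_eqF.
    by rewrite ler_wpM2l// lerBlDr.
  apply: (@le_trans _ _ (pi ^+ 2 / 16 / 4 ^+ m * (4 ^+ m * 2))); first by rewrite ler_wpM2l.
  by rewrite p4 le_eqVlt; apply/orP; left; apply/eqP; field; rewrite gt_eqF.
have sub : (fun m => inv_sq_sum R 2 (2 ^ m.+1)) @ \oo --> Z.
  apply: (cvg_comp (fun m => 2 ^ m.+1)%N _ _ HZ); apply/cvgnyPge => N.
  by exists N => // M /= NM; apply: leq_trans NM _; apply: ltnW; apply: ltnW; exact: ltn_expl.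
have sub2 : (fun m => inv_sq_sum R 2 (2 ^ m.+1)) @ \oo --> (pi ^+ 2 / 8 : R).
  apply: (squeeze_cvgr (f := fun m => pi ^+ 2 / 8 - pi ^+ 2 / 16 / 2 ^+ m) (h := fun=> pi ^+ 2 / 8)).
  - by near=> m; exact: H.
  - rewrite -[X in _ --> X]subr0; apply: cvgB; first exact: cvg_cst.
    rewrite -[X in _ --> X](mulr0 (pi ^+ 2 / 16)); apply: cvgM; first exact: cvg_cst.
    under eq_fun do rewrite -exprVn.
    by apply: cvg_expr; rewrite ger0_norm ?invr_ge0// invf_lt1// ltr1n.
  - exact: cvg_cst.
exact: (cvgn_unique sub sub2).
Unshelve. all: by end_near.
Qed.

Lemma basel (R : realType) : inv_sq_sum R 1 @ \oo --> (pi ^+ 2 / 6 : R).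
Proof.
have [Z HZ] := cvg_inv_sq_sum R 1.
have := @cvg_inv_sq_sum_prime R 1 2 Z isT isT HZ; rewrite mul1n => H.
have E : Z * (1 - 2 ^- 2) = pi ^+ 2 / 8 by apply: cvgn_unique H _; exact: basel_odd.
suff <- : Z = pi ^+ 2 / 6 by [].
by apply: (mulIf (_ : 1 - 2 ^- 2 != 0 :> R)); rewrite ?E; [lra|field].
Qed.

Lemma primes_rad A : (0 < A)%N -> primes (rad A) = primes A.
Proof.
move=> A0; apply/eq_primes => p; rewrite !mem_primes rad_gt0 A0 /=.
apply: andb_id2l => pp; apply/idP/idP => [/dvdn_trans|pA]; first by apply; exact: rad_dvd.
by rewrite /rad (big_rem p) ?dvdn_mulr// mem_primes pp A0.
Qed.

Lemma cvg_inv_sq_sum_primes (R : realType) A : (0 < A)%N ->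
  inv_sq_sum R A @ \oo --> (pi ^+ 2 / 6 * \prod_(p <- primes A) (1 - p%:R ^- 2) : R).
Proof.
(* The sum depends only on the primes of [A], and the radical lets them be removed one at a time. *)
move=> A0; have -> : inv_sq_sum R A = inv_sq_sum R (rad A).
  apply/funext => M; apply: congr_big_nat => // s /andP[s0 _].
  by rewrite !coprime_has_primes ?rad_gt0// primes_rad.
rewrite /rad; have := primes_uniq A; have : all prime (primes A) by apply/allP => p; rewrite mem_primes => /andP[].
elim: (primes A) => [|p s IH] /=; first by rewrite !big_nil mulr1 => _ _; exact: basel.
move=> /andP[pp ps] /andP[pns us]; rewrite !big_cons mulnC mulrCA mulrC.
apply: cvg_inv_sq_sum_prime => //; last exact: IH.
rewrite big_seq; elim/big_ind: _ => [|x y|q qs]; [exact: coprimen1|by rewrite coprimeMr => -> ->|].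
by rewrite prime_coprime// dvdn_prime2//; [apply: contraNneq pns => ->|exact: (allP ps)].
Qed.

(** * Squarefree numbers in residue classes *)

Lemma cnt_key_sum (key : nat -> nat) (P : pred nat) B K : (forall n, (0 < n <= B)%N -> (key n < K)%N) ->
  (\sum_(0 <= s < K) cnt (fun n => (key n == s) && P n) B = cnt P B)%N.
Proof.
rewrite /cnt => keyK; have : {in iota 1 B, forall n, (key n < K)%N}.
  by move=> n; rewrite mem_iota add1n ltnS; exact: keyK.
elim: (iota 1 B) => [|n s IH] H /=; first by rewrite big1.
rewrite big_split /= IH; last by move=> x xs; apply: H; rewrite inE xs orbT.
congr (_ + _)%N; case: (P n); last by rewrite big1// => i _; rewrite andbF.
rewrite (eq_bigr (fun i => (i == key n) : nat)); last by move=> i _; rewrite andbT eq_sym.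
have kK := H n (mem_head _ _).
rewrite (bigD1_seq (key n)) ?mem_index_iota ?iota_uniq//= eqxx big1 ?addn0// => i /negPf ->//.
Qed.

Lemma cnt_mod_bounds (R : realType) A r X : (0 < A)%N ->
  `|(cnt (fun n => n == r %[mod A]) X)%:R - X%:R / A%:R| <= 1 :> R.
Proof.
move=> A0; set P := fun n => _.
have per n : P (n + A)%N = P n by rewrite /P modnDr.
have one : count P (iota 0 A) = 1%N.
  rewrite (@eq_in_count _ _ (pred1 (r %% A)%N)); last first.
    by move=> n; rewrite mem_iota add0n /= => nA; rewrite /P (modn_small nA).
  by rewrite count_uniq_mem ?iota_uniq// mem_iota /= add0n ltn_mod A0.
have := cnt_periodic_le 1 X A0 per; have := cnt_periodic_ge 1 X A0 per; rewrite one !muln1 -/(cnt P X) => L U.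
have Ar : (0 : R) < A%:R by rewrite ltr0n.
have := divn_eq X A => E; have := ltn_pmod X A0 => mA.
rewrite ler_norml lerBrDr lerBlDr.
have XE : X%:R / A%:R = (X %/ A)%:R + (X %% A)%:R / A%:R :> R.
  by rewrite {1}E natrD natrM mulrDl mulfK// gt_eqF.
have f0 : 0 <= (X %% A)%:R / A%:R :> R by rewrite divr_ge0.
have f1 : (X %% A)%:R / A%:R <= 1 :> R by rewrite ler_pdivrMr// mul1r ler_nat ltnW.
have : ((X %/ A)%:R : R) <= (cnt P X)%:R by rewrite ler_nat.
have : ((cnt P X)%:R : R) <= (X %/ A)%:R + 1 by rewrite natr1 ler_nat.
by rewrite XE; move: f0 f1; move: (_ / _) ((cnt P X)%:R : R) ((X %/ A)%:R : R) => a b c; lra.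
Qed.

Lemma square_part : exists key : nat -> nat, forall n, (0 < n)%N ->
  [/\ (0 < key n)%N, sqfree (n %/ key n ^ 2) & (key n ^ 2 %| n)%N].
Proof.
have /boolp.choice[key H] n : exists k, (0 < n)%N -> [/\ (0 < k)%N, sqfree (n %/ k ^ 2) & (k ^ 2 %| n)%N].
  case: (posnP n) => [->|n0]; first by exists 0%N.
  have [q [m [m0 sq E]]] := sqfree_decomp n0; exists m => _.
  by rewrite E mulnK ?expn_gt0 ?m0// dvdn_mull.
by exists key.
Qed.

Lemma cnt_square_part (key : nat -> nat) (P : pred nat) s X : (forall n, (0 < n)%N ->
    [/\ (0 < key n)%N, sqfree (n %/ key n ^ 2) & (key n ^ 2 %| n)%N]) -> (0 < s)%N ->
  cnt (fun n => (key n == s) && P n) X =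
  cnt (fun q => `[< sqfree q >] && P (s ^ 2 * q)%N) (X %/ s ^ 2)%N.
Proof.
move=> keyP s0; have s20 : (0 < s ^ 2)%N by rewrite expn_gt0 s0.
have nE n : (0 < n)%N -> key n = s -> n = (s ^ 2 * (n %/ s ^ 2))%N.
  by move=> n0 ks; have [_ _ d] := keyP n n0; rewrite mulnC divnK// -ks.
apply/eqP; rewrite eqn_leq; apply/andP; split.
  apply: (@cnt_inj _ _ (fun n => n %/ s ^ 2)%N) => [n n'|n].
    rewrite !inE => /andP[/andP[n0 _] /andP[/eqP kn _]] /andP[/andP[n'0 _] /andP[/eqP kn' _]] E.
    by rewrite (nE n n0 kn) (nE n' n'0 kn') E.
  move=> /andP[n0 nX] /andP[/eqP kn Pn]; have E := nE n n0 kn.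
  have [_ sq _] := keyP n n0; rewrite kn in sq.
  by rewrite -E Pn leq_div2r// sqfree_gt0//= andbT; apply/asboolP.
apply: (@cnt_inj _ _ (fun q => s ^ 2 * q)%N) => [q q' _ _ /eqP|q].
  by rewrite eqn_pmul2l// => /eqP.
move=> /andP[q0 qX] /andP[/asboolP sq Pq]; have n0 : (0 < s ^ 2 * q)%N by rewrite muln_gt0 s20.
have [k0 sq' d] := keyP _ n0; have E : (key (s ^ 2 * q) ^ 2 * (s ^ 2 * q %/ key (s ^ 2 * q) ^ 2) = s ^ 2 * q)%N by rewrite mulnC divnK.
have qE := sqfree_uniq k0 s0 sq' sq E.
move: E; rewrite qE => /eqP; rewrite eqn_pmul2r// eqn_exp2r// => ks.
by rewrite n0 Pq ks /= andbT; move: qX; rewrite leq_divRL// mulnC.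
Qed.

(** The witness is [r' = x / m], where [x] is [r] modulo [A] and 0 modulo [m]. *)
Lemma mul_mod_solution A m r : (0 < m)%N -> coprime A m -> coprime r A -> exists r', coprime r' A /\
  forall q, (m * q == r %[mod A])%N = (q == r' %[mod A])%N.
Proof.
move=> m0 cAm crA; pose x := chinese A m r 0.
have xr : x = r %[mod A] := chinese_modl cAm r 0.
have xm : (m %| x)%N by rewrite /dvdn; have := chinese_modr cAm r 0; rewrite -/x mod0n => ->.
exists (x %/ m)%N; split.
  have : coprime x A by rewrite -coprime_modl xr coprime_modl.
  by rewrite -{1}(divnK xm) coprimeMl => /andP[].
move=> q; rewrite -xr -{1}(divnK xm) [(_ * m)%N]mulnC.
wlog qx : q / (q <= x %/ m)%N => [H|].
  have [|/ltnW xq] := leqP q (x %/ m)%N; first exact: H.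
  by rewrite eqn_mod_dvd ?leq_mul2l ?xq ?orbT// -mulnBr Gauss_dvdr// -eqn_mod_dvd.
by rewrite eq_sym [in RHS]eq_sym !eqn_mod_dvd ?leq_mul2l ?qx ?orbT// -mulnBr Gauss_dvdr.
Qed.

Definition sqfree_count (A r X : nat) := cnt (fun q => `[< sqfree q >] && (q == r %[mod A])%N) X.

(** The bound is uniform in the reduced residue [r], because the recursion passes from [r] to
    [r / s ^ 2]. *)
Definition sqfree_dens_le (R : realType) (A : nat) (k e : R) := exists X0 : nat, forall X r : nat,
  (X0 <= X)%N -> coprime r A -> `|(sqfree_count A r X)%:R - k * X%:R| <= e * X%:R.

Lemma mul_mod_coprime A m r q : coprime r A -> (m * q = r %[mod A])%N -> coprime m A.
Proof. by move=> cr E; move: cr; rewrite -coprime_modl -E coprime_modl coprimeMl => /andP[]. Qed.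

(* Sort [n = s ^ 2 * q = r %[mod A]] according to [s]: the term [s = 1] is the count sought, and
   the terms [s >= 2] multiply the relative error by at most [zeta 2 - 1 <= 3 / 4]. *)
Lemma sqfree_dens_contract (R : realType) (A : nat) (Z e : R) : (0 < A)%N -> inv_sq_sum R A @ \oo --> Z ->
  0 < e -> sqfree_dens_le A (A%:R * Z)^-1 e -> sqfree_dens_le A (A%:R * Z)^-1 (7 / 8 * e).
Proof.
move=> A0 HZ e0 [X0]; set k := (A%:R * Z)^-1 => HX0.
have Ar : (1 : R) <= A%:R by rewrite ler1n.
have Z1 := inv_sq_sum_limit_ge1 HZ.
have AZ1 : 1 <= A%:R * Z by rewrite -[leLHS]mulr1 ler_pM.
have k1 : k <= 1 by rewrite invf_le1// (lt_le_trans ltr01).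
have k0 : 0 < k by rewrite invr_gt0 (lt_le_trans ltr01).
pose M := (Num.truncn (32 / e)).+2.
have M0 : (0 < M)%N by [].
have Me : 2 / M%:R <= e / 16.
  have : 32 / e < M%:R by rewrite (lt_trans (truncnS_gt _))// ltr_nat.
  rewrite ltr_pdivrMr// => H; rewrite ler_pdivrMr ?ltr0n//.
  by rewrite mulrAC ler_pdivlMr// -natrM; lra.
exists (M + X0.+1 * M ^ 2 + (Num.truncn ((M.+1)%:R * 16 / e)).+1)%N => X r HX cr.
have [XM [X2 X3]] : (M <= X)%N /\ (X0.+1 * M ^ 2 <= X)%N /\ ((Num.truncn ((M.+1)%:R * 16 / e)).+1 <= X)%N.
  by move: HX; clear; move: (X0.+1 * M ^ 2)%N (_.+1) => a b; lia.
have X3' : M.+1%:R <= e / 16 * X%:R.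
  have : M.+1%:R * 16 / e < X%:R by rewrite (lt_le_trans (truncnS_gt _))// ler_nat.
  by rewrite ltr_pdivrMr// => H; lra.
have [key keyP] := square_part.
pose T s := cnt (fun q => `[< sqfree q >] && (s ^ 2 * q == r %[mod A])%N) (X %/ s ^ 2)%N.
have T1 : T 1%N = sqfree_count A r X.
  by rewrite /T exp1n divn1; apply: eq_count => q; rewrite mul1n.
have NE : cnt (fun n => n == r %[mod A])%N X = (\sum_(1 <= s < X.+1) T s)%N.
  rewrite -(@cnt_key_sum key _ _ X.+1) => [|n /andP[n0 nX]]; last first.
    have [k00 _ d] := keyP n n0; rewrite ltnS (leq_trans _ nX)// (leq_trans _ (dvdn_leq n0 d))//.
    by rewrite -[leqLHS]expn1 leq_pexp2l.
  rewrite big_nat_recl// [X in (X + _)%N](_ : _ = 0%N) ?add0n; last first.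
    apply/eqP; rewrite -leqn0; apply: cnt_fin => n /andP[n0 _] /andP[/eqP kn _].
    by have [] := keyP n n0; rewrite kn.
  rewrite big_add1 /=; apply: eq_bigr => s _; exact: cnt_square_part.
have ME : (\sum_(1 <= s < X.+1) T s = T 1 + \sum_(2 <= s < M.+1) T s + \sum_(M.+1 <= s < X.+1) T s)%N.
  by rewrite (@big_cat_nat _ _ _ M.+1)//= (@big_cat_nat _ _ _ 2 1 M.+1)//= big_nat1.
have tail : ((\sum_(M.+1 <= s < X.+1) T s)%N%:R : R) <= X%:R / M%:R.
  rewrite ler_pdivlMr ?ltr0n// -natrM ler_nat mulnC.
  apply: leq_trans (sum_div_sq X (X - M) M0); rewrite leq_mul2l; apply/orP; right.
  rewrite /index_iota subSS; apply: leq_sum => s _; exact: cnt_leB.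
pose c s : R := if coprime s A then s%:R ^- 2 else 0.
have ZME : inv_sq_sum R A M = 1 + \sum_(2 <= s < M.+1) c s.
  by rewrite /inv_sq_sum big_mkcond /= big_ltn// coprime1n expr1n invr1.
have err s : (2 <= s < M.+1)%N -> `|(T s)%:R - k * X%:R * c s| <= e * X%:R * s%:R ^- 2 + 1.
  move=> /andP[s2 sM]; have s0 : (0 < s)%N by apply: leq_trans s2.
  have sr : (0 : R) < s%:R ^+ 2 by rewrite exprn_gt0// ltr0n.
  rewrite /c; case: ifPn => cs; last first.
    have -> : T s = 0%N.
      apply/eqP; rewrite -leqn0; apply: cnt_fin => q _ /andP[_ /eqP E].
      by move: cs; rewrite -(@coprime_pexpl 2)// (mul_mod_coprime cr E).
    by rewrite mulr0 subr0 normr0 addr_ge0// !mulr_ge0 ?invr_ge0 ?(ltW e0) ?(ltW sr).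
  have cAs : coprime A (s ^ 2) by rewrite coprime_sym coprimeXl.
  have s20 : (0 < s ^ 2)%N by rewrite expn_gt0 s0.
  have [r' [cr' HT]] := mul_mod_solution s20 cAs cr.
  have TE : T s = sqfree_count A r' (X %/ s ^ 2) by apply: eq_count => q; rewrite HT.
  have Xs : (X0 <= X %/ s ^ 2)%N.
    rewrite leq_divRL ?expn_gt0 ?s0//; apply: leq_trans X2; apply: leq_mul => //.
    by rewrite leq_exp2r// -ltnS.
  have := HX0 _ r' Xs cr'; rewrite -TE.
  have D1 : ((X %/ s ^ 2)%:R : R) <= X%:R * s%:R ^- 2 by rewrite ler_pdivlMr// -natrX -natrM ler_nat leq_divM.
  have D2 : X%:R * s%:R ^- 2 <= (X %/ s ^ 2)%:R + 1 :> R.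
    by rewrite ler_pdivrMr// natr1 -natrX -natrM ler_nat ltnW// ltn_ceil// expn_gt0 s0.
  move: D1 D2; rewrite -!mulrA; move: (X%:R * s%:R ^- 2) ((X %/ s ^ 2)%:R : R) ((T s)%:R : R) => a b t D1 D2.
  rewrite !ler_norml => /andP[H1 H2].
  have ab : e * b <= e * a by rewrite ler_wpM2l// ltW.
  have kb1 : k * b <= k * a by rewrite ler_wpM2l// ltW.
  have kb2 : k * a <= k * b + 1 by apply: le_trans (ler_wpM2l (ltW k0) D2) _; rewrite mulrDr mulr1 lerD2l.
  by apply/andP; split; lra.
have sum34 : \sum_(2 <= s < M.+1) s%:R ^- 2 <= 3 / 4 :> R.
  have /andP[_] := @inv_sq_sum_tail R 1 2 M isT.
  have -> : inv_sq_sum R 1 2 = 1 + 1 / 4.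
    by rewrite /inv_sq_sum big_mkcond /= big_ltn// big_nat1 !coprimen1 expr1n; field.
  have -> : inv_sq_sum R 1 M = 1 + \sum_(2 <= s < M.+1) s%:R ^- 2.
    by rewrite /inv_sq_sum big_mkcond /= big_ltn// !coprimen1 expr1n invr1; congr (_ + _); apply: eq_bigr => s _; rewrite coprimen1.
  have : 0 <= M%:R^-1 :> R by rewrite invr_ge0.
  by move: (M%:R^-1) (\sum_(_ <= _ < _) _) => a b; lra.
have errs : `|(\sum_(2 <= s < M.+1) T s)%N%:R - k * X%:R * \sum_(2 <= s < M.+1) c s| <= e * X%:R * (3 / 4) + M%:R.
  rewrite natr_sum mulr_sumr -sumrB; apply: le_trans (ler_norm_sum _ _ _) _.
  apply: le_trans (ler_sum_nat (G := fun s => e * X%:R * s%:R ^- 2 + 1) err) _.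
  rewrite big_split /= -mulr_sumr lerD//.
    by rewrite ler_wpM2l ?mulr_ge0 ?(ltW e0).
  by rewrite sumr_const_nat subSS ler_nat leq_subr.
have := cnt_mod_bounds R r X A0; rewrite NE ME T1 !natrD.
(* This is where the value of [k] enters: the terms [k * X / s ^ 2] over all [s] coprime to [A] add
   up to [X / A]. *)
have XA : X%:R / A%:R = k * X%:R * Z.
  by rewrite /k; field; rewrite !gt_eqF// (lt_le_trans ltr01).
have /andP[ZM1 ZM2] := inv_sq_sum_bounds HZ M0.
rewrite XA; move: errs tail ZM1 ZM2; rewrite ZME.
have t0 : 0 <= (\sum_(M.+1 <= s < X.+1) T s)%N%:R :> R by [].
have kX0 : 0 <= k * X%:R by rewrite mulr_ge0// ltW.
have kX1 : k * X%:R <= X%:R by rewrite -[leRHS]mul1r ler_wpM2r.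
have XMe : X%:R / M%:R <= X%:R * (e / 32).
  by rewrite ler_wpM2l//; move: Me; lra.
move: t0; move: (\sum_(_ <= _ < _) c _) (_%:R) (_%:R) => C T2 T3 t0 errs tail ZM1 ZM2.
have kZ1 : k * X%:R * (1 + C) <= k * X%:R * Z by rewrite ler_wpM2l.
have kZ2 : k * X%:R * Z <= k * X%:R * (1 + C) + X%:R / M%:R.
  apply: le_trans (ler_wpM2l kX0 ZM2) _; rewrite [leLHS]mulrDr lerD2l.
  by rewrite ler_wpM2r ?invr_ge0.
move: errs; rewrite !ler_norml => /andP[E1 E2] /andP[F1 F2].
have M1 : (M%:R : R) + 1 <= e / 16 * X%:R by rewrite natr1.
(* In units of [e * X]: [3 / 4] from the terms [s >= 2], [1 / 16] from rounding, [1 / 32] each from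
   the tail and from truncating [Z]. *)
apply/andP; split; lra.
Qed.

(** * Polynomials of degree one *)

Definition asymp (R : realType) (u : nat -> R) (k : R) := forall e, 0 < e -> exists N : nat,
  forall B, (N <= B)%N -> `|u B - k * B%:R| <= e * B%:R.

Lemma asymp_eq (R : realType) (u v : nat -> R) k : u =1 v -> asymp u k -> asymp v k.
Proof. by move=> uv H e e0; have [N HN] := H e e0; exists N => B /HN; rewrite uv. Qed.

Lemma asympD (R : realType) (u v : nat -> R) k l : asymp u k -> asymp v l ->
  asymp (fun B => u B + v B) (k + l).
Proof.
move=> Hu Hv e e0; have [|N HN] := Hu (e / 2); first by rewrite divr_gt0.
have [|N' HN'] := Hv (e / 2); first by rewrite divr_gt0.
exists (maxn N N') => B; rewrite geq_max => /andP[/HN H /HN' H'].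
have -> : u B + v B - (k + l) * B%:R = (u B - k * B%:R) + (v B - l * B%:R) by ring.
apply: le_trans (ler_normD _ _) _; apply: le_trans (lerD H H') _.
by rewrite -mulrDl -splitr.
Qed.

Lemma asymp_sum (R : realType) (u : nat -> nat -> R) (k : nat -> R) A :
  (forall r, (r < A)%N -> asymp (u r) (k r)) ->
  asymp (fun B => \sum_(0 <= r < A) u r B) (\sum_(0 <= r < A) k r).
Proof.
elim: A => [|A IH] H.
  move=> e e0; exists 0%N => B _; rewrite !big_geq// mul0r subr0 normr0.
  by rewrite mulr_ge0// ltW.
rewrite big_nat_recr //=; apply: asymp_eq (asympD (IH _) (H A _)) => //.
  by move=> B /=; rewrite big_nat_recr.
by move=> r rA; apply: H; rewrite ltnW.
Qed.

Lemma asymp_squeeze (R : realType) (u v w : nat -> R) k (C : R) :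
  (forall B, v B - C <= u B <= w B + C) -> asymp v k -> asymp w k -> asymp u k.
Proof.
move=> H Hv Hw e e0; have [|N HN] := Hv (e / 2); first by rewrite divr_gt0.
have [|N' HN'] := Hw (e / 2); first by rewrite divr_gt0.
exists (maxn (maxn N N') (Num.truncn (2 * C / e)).+1) => B; rewrite !geq_max => /andP[/andP[/HN H1 /HN' H2] CB].
have : C <= e / 2 * B%:R.
  have : 2 * C / e < B%:R by rewrite (lt_le_trans (truncnS_gt _))// ler_nat.
  by rewrite ltr_pdivrMr// => H3; lra.
have /andP[U L] := H B; move: H1 H2; rewrite !ler_norml => /andP[U1 U2] /andP[L1 L2] CC.
by apply/andP; split; lra.
Qed.

Lemma asymp_comp (R : realType) (u : nat -> R) (f : nat -> nat) (k a D : R) : 0 < a ->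
  (forall B, `|(f B)%:R - a * B%:R| <= D) -> asymp u k -> asymp (fun B => u (f B)) (k * a).
Proof.
move=> a0 fD H e e0; have ea : 0 < e / (2 * a) by rewrite divr_gt0// mulr_gt0.
have [N HN] := H _ ea.
have D0 : 0 <= D by apply: le_trans (fD 0%N).
pose D' := (e / (2 * a) + `|k|) * D.
exists (maxn (Num.truncn ((N%:R + D) / a)).+1 (Num.truncn (2 * D' / e)).+1) => B.
rewrite geq_max => /andP[B1 B2]; have := fD B; rewrite ler_distl => /andP[f1 f2].
have Nf : (N <= f B)%N.
  have : (N%:R + D) / a < B%:R by rewrite (lt_le_trans (truncnS_gt _))// ler_nat.
  rewrite ltr_pdivrMr// => NB; rewrite -(ler_nat R); move: NB f1; lra.
have := HN _ Nf => H1.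
have -> : u (f B) - k * a * B%:R = (u (f B) - k * (f B)%:R) + k * ((f B)%:R - a * B%:R) by ring.
apply: le_trans (ler_normD _ _) _; rewrite normrM.
apply: le_trans (lerD H1 (ler_wpM2l (normr_ge0 k) (fD B))) _.
have H2 : e / (2 * a) * (f B)%:R <= e / (2 * a) * (a * B%:R + D) by rewrite ler_wpM2l// ltW.
have -> : e * B%:R = e / (2 * a) * (a * B%:R) + e / 2 * B%:R by field; rewrite gt_eqF.
have H3 : D' <= e / 2 * B%:R.
  have : 2 * D' / e < B%:R by rewrite (lt_le_trans (truncnS_gt _))// ler_nat.
  by rewrite ltr_pdivrMr// => H3; lra.
move: H2 H3; rewrite /D' mulrDr mulrDl; lra.
Qed.

Lemma sqfree_density (R : realType) (A r : nat) (Z : R) : (0 < A)%N -> inv_sq_sum R A @ \oo --> Z ->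
  coprime r A -> asymp (fun X => (sqfree_count A r X)%:R) (A%:R * Z)^-1.
Proof.
move=> A0 HZ cr e e0.
have H n : sqfree_dens_le A (A%:R * Z)^-1 ((7 / 8) ^+ n).
  elim: n => [|n IH]; last by rewrite exprS; apply: sqfree_dens_contract => //; rewrite exprn_gt0.
  exists 0%N => X r' _ _; rewrite expr0 mul1r.
  have Z1 := inv_sq_sum_limit_ge1 HZ.
  have AZ1 : 1 <= A%:R * Z by rewrite -[leLHS]mulr1 ler_pM// ler1n.
  have k1 : (A%:R * Z)^-1 <= 1 by rewrite invf_le1// (lt_le_trans ltr01).
  have k0 : 0 < (A%:R * Z)^-1 by rewrite invr_gt0 (lt_le_trans ltr01).
  have c1 : ((sqfree_count A r' X)%:R : R) <= X%:R by rewrite ler_nat cnt_leB.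
  have c0 : 0 <= (sqfree_count A r' X)%:R :> R by [].
  have : 0 <= (A%:R * Z)^-1 * X%:R by rewrite mulr_ge0// ltW.
  have : (A%:R * Z)^-1 * X%:R <= X%:R by rewrite -[leRHS]mul1r ler_wpM2r.
  by rewrite ler_norml => *; apply/andP; split; lra.
have /cvgn_dist/(_ e e0)[n /(_ n (leqnn n))] : (fun n => (7 / 8) ^+ n) @ \oo --> (0 : R).
  by apply: cvg_expr; rewrite ger0_norm; lra.
rewrite subr0 => /ler_normlW en; have [X0 HX] := H n; exists X0 => X XX.
by apply: le_trans (HX X r XX cr) _; rewrite ler_wpM2r.
Qed.

(* [delta] is [1 / delta_witness ^ 2]; when there is no witness both vanish because [0^-1 = 0]. *)
Definition delta_witness (a b : int) (r : nat) : nat :=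
  if pselect (exists m, delta_cond a b r m) is left ex then ex_minn ex else 0%N.

Lemma deltaE (R : realType) (a b : int) (r : nat) : delta R a b r = (delta_witness a b r)%:R ^- 2.
Proof.
rewrite /delta /delta_witness; case: pselect => [ex|_]; first by rewrite div1r.
by rewrite expr0n /= invr0.
Qed.

Lemma delta_witness_cond a b r : (0 < delta_witness a b r)%N -> delta_cond a b r (delta_witness a b r).
Proof. by rewrite /delta_witness; case: pselect => // ex _; case: ex_minnP. Qed.

Lemma delta_witness_min a b r m : delta_cond a b r m -> (0 < delta_witness a b r <= m)%N.
Proof.
move=> H; rewrite /delta_witness; case: pselect => [ex|]; last by case; exists m.
by case: ex_minnP => k /andP[k0 _] mn; rewrite k0 mn.
Qed.

(** For large [n] the value [a * n + b] has the sign of [a], so it equals [sgz a * q * m ^ 2] with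
    [q] squarefree, and [m ^ 2 * r] is [b] modulo [a] for this residue [r]. *)
Definition sgn_residue (a : int) (q : nat) : nat := `|(sgz a * q%:Z %% a)%Z|%N.

Section linear.
Variables (a b : int).
Hypotheses (a0 : a != 0) (cab : coprime `|a| `|b|).

Let sgz_sqr : sgz a * sgz a = 1.
Proof. by case: sgzP a0 => // ->; rewrite eqxx. Qed.

Let abs_sgz : `|sgz a|%N = 1%N.
Proof. by case: sgzP a0 => // ->; rewrite eqxx. Qed.

Lemma sgn_residue_lt q : (sgn_residue a q < `|a|)%N.
Proof. by rewrite -ltz_nat /sgn_residue gez0_abs ?modz_ge0// abszE ltz_mod. Qed.

Lemma sgn_residueP q : (sgz a * q%:Z = (sgn_residue a q)%:Z %[mod a])%Z.
Proof. by rewrite /sgn_residue gez0_abs ?modz_ge0// modz_mod. Qed.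

Lemma sgn_residue_eq q r : (r < `|a|)%N ->
  (sgn_residue a q == r) = (q == sgn_residue a r %[mod `|a|])%N.
Proof.
move=> ra; have -> : (sgn_residue a q == r) = (sgz a * q%:Z == r%:Z %[mod a])%Z.
  by rewrite sgn_residueP -!(modz_abs _ a) !modz_nat eqz_nat !modn_small ?sgn_residue_lt.
have -> : (q == sgn_residue a r %[mod `|a|])%N = (q%:Z == (sgn_residue a r)%:Z %[mod a])%Z.
  by rewrite -!(modz_abs _ a) !modz_nat eqz_nat.
rewrite -sgn_residueP !eqz_mod_dvd.
have -> : sgz a * q%:Z - r%:Z = sgz a * (q%:Z - sgz a * r%:Z) by rewrite mulrBr mulrA sgz_sqr mul1r.
by rewrite !dvdzE abszM abs_sgz mul1n.
Qed.

Lemma coprimez_mod x y : (x = y %[mod a])%Z -> coprimez x a = coprimez y a.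
Proof. by move=> E; rewrite /coprimez -gcdz_modl E gcdz_modl. Qed.

Lemma sgn_residue_coprime r m : delta_cond a b r m -> coprime (sgn_residue a r) `|a|.
Proof.
move=> /andP[m0 /eqP E].
have cr : coprime r `|a|.
  have : coprimez (m%:Z ^+ 2 * r%:Z) a by rewrite (coprimez_mod E) coprimezE coprime_sym.
  by rewrite coprimezMl => /andP[_]; rewrite coprimezE.
have : coprimez (sgz a * r%:Z) a by rewrite coprimezE abszM abs_sgz mul1n.
by rewrite (coprimez_mod (sgn_residueP r)) coprimezE.
Qed.

(** The squarefree [q] whose least admissible multiple [q * m ^ 2] is at most [Z]; a positive
    witness encodes that some [m] exists. *)
Definition class_reps (Z q : nat) := [&& `[< sqfree q >], (0 < delta_witness a b (sgn_residue a q))%N &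
  (q * delta_witness a b (sgn_residue a q) ^ 2 <= Z)%N].

Lemma cnt_trunc (P : pred nat) W Y : (W <= Y)%N -> cnt (fun q => P q && (q <= W)%N) Y = cnt P W.
Proof.
move=> WY; rewrite /cnt -{1}(subnKC WY) iotaD count_cat [X in (_ + X)%N](_ : _ = 0%N) ?addn0.
  by apply: eq_in_count => q; rewrite mem_iota add1n ltnS => /andP[_ ->]; rewrite andbT.
apply/eqP; rewrite -leqn0 leqNgt -has_count; apply/hasPn => q.
by rewrite mem_iota add1n => /andP[Wq _]; rewrite leqNgt Wq andbF.
Qed.

Lemma cnt_class_reps Z Y : (Z <= Y)%N ->
  cnt (class_reps Z) Y = (\sum_(0 <= r < `|a|) (if delta_witness a b r == 0%N then 0 else
    sqfree_count `|a| (sgn_residue a r) (Z %/ delta_witness a b r ^ 2)))%N.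
Proof.
move=> ZY; rewrite -(@cnt_key_sum (sgn_residue a) _ _ `|a|) => [|n _]; last exact: sgn_residue_lt.
apply: eq_big_nat => r /andP[_ ra]; case: eqP => [r0|/eqP r0].
  apply/eqP; rewrite -leqn0; apply: cnt_fin => q _ /andP[/eqP E] /and3P[_].
  by rewrite E r0.
rewrite -lt0n in r0; rewrite /sqfree_count -(@cnt_trunc _ (Z %/ delta_witness a b r ^ 2)%N Y); last first.
  by apply: leq_trans ZY; apply: leq_div.
apply: eq_count => q; rewrite /class_reps -sgn_residue_eq//.
case: eqP => [->|_]; last by rewrite andbF.
by rewrite r0 andbT /= leq_divRL// expn_gt0 r0.
Qed.

(** The residue [r] contributes the squarefree [q <= F B / m ^ 2] of one reduced class modulo [|a|],
    of density [(|a| * Z)^-1]. As [F B] is [|a| * B + O(1)], there are about [Z^-1 / m ^ 2 * B] of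
    them. *)
Lemma cnt_class_reps_asymp (R : realType) (Z : R) (F Y : nat -> nat) (D : nat) :
  inv_sq_sum R `|a| @ \oo --> Z -> (forall B, F B <= Y B)%N ->
  (forall B, F B <= `|a| * B + D /\ `|a| * B <= F B + D)%N ->
  asymp (fun B => (cnt (class_reps (F B)) (Y B))%:R) (Z^-1 * \sum_(0 <= r < `|a|) delta R a b r).
Proof.
move=> HZ FY FD; set A := `|a|%N.
have A0 : (0 < A)%N by rewrite absz_gt0.
have Ar : (0 : R) < A%:R by rewrite ltr0n.
rewrite mulr_sumr; apply: (@asymp_eq _ (fun B => \sum_(0 <= r < A)
  (if delta_witness a b r == 0%N then 0 else sqfree_count A (sgn_residue a r) (F B %/ delta_witness a b r ^ 2))%N%:R)).
  by move=> B; rewrite cnt_class_reps// natr_sum.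
apply: asymp_sum => r rA; rewrite deltaE; case: eqP => [->|/eqP r0].
  move=> e e0; exists 0%N => B _; rewrite expr0n /= invr0 !mulr0 mul0r subr0 normr0.
  by rewrite mulr_ge0// ltW.
rewrite -lt0n in r0; set m := delta_witness a b r in r0 *.
have mr : (0 : R) < m%:R ^+ 2 by rewrite exprn_gt0// ltr0n.
have Z0 : Z != 0 by rewrite gt_eqF// (lt_le_trans ltr01)// (inv_sq_sum_limit_ge1 HZ).
have -> : Z^-1 * m%:R ^- 2 = (A%:R * Z)^-1 * (A%:R / m%:R ^+ 2).
  by field; rewrite Z0 !gt_eqF// ltr0n.
apply: (@asymp_comp R (fun X => (sqfree_count A (sgn_residue a r) X)%:R) (fun B => F B %/ m ^ 2)%N _ _ (D%:R + 1)).
- by rewrite divr_gt0.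
- move=> B; have [F1 F2] := FD B.
  have m20 : (0 < m ^ 2)%N by rewrite expn_gt0 r0.
  have U1 : ((F B %/ m ^ 2)%:R : R) * m%:R ^+ 2 <= (F B)%:R by rewrite -natrX -natrM ler_nat leq_divM.
  have L1 : (F B)%:R <= ((F B %/ m ^ 2)%:R + 1) * m%:R ^+ 2 :> R.
    by rewrite natr1 -natrX -natrM ler_nat ltnW// ltn_ceil.
  have F1' : ((F B)%:R : R) <= A%:R * B%:R + D%:R by rewrite -natrM -natrD ler_nat.
  have F2' : (A%:R : R) * B%:R <= (F B)%:R + D%:R by rewrite -natrM -natrD ler_nat.
  have m1 : (1 : R) <= m%:R ^+ 2 by rewrite -natrX ler1n.
  have E : (F B %/ m ^ 2)%:R - A%:R / m%:R ^+ 2 * B%:R =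
      ((F B %/ m ^ 2)%:R * m%:R ^+ 2 - A%:R * B%:R) / m%:R ^+ 2 :> R by field; rewrite gt_eqF// ltr0n.
  have D0 : (0 : R) <= D%:R by [].
  rewrite E normrM normfV (gtr0_norm mr) ler_pdivrMr//.
  have D1 : (D%:R : R) <= D%:R * m%:R ^+ 2 by rewrite -[leLHS]mulr1 ler_wpM2l.
  rewrite mulrDl mul1r in L1 *; rewrite ler_norml; apply/andP; split; lra.
- apply: sqfree_density => //; apply: sgn_residue_coprime (delta_witness_cond r0).
Qed.

End linear.

(** For large [n] the class of [f n] is that of [c * sgz a * q], with [q] the squarefree part of
    [|a * n + b|], and distinct [q] give distinct classes. The constant [C] accounts for [n < N] and
    for [q <= |a| * N + |b|]. *)
Lemma image_size_linear_bounds (f : {poly int}) (c : int) (g : {poly int}) (a b : int) :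
  a != 0 -> f != 0 -> f = c%:P * g ^+ 2 * (a%:P * 'X + b%:P) -> exists C : nat, forall B,
  (cnt (class_reps a b (`|a| * B - `|b|)) (`|a| * B + `|b|) <= image_size f B + C)%N /\
  (image_size f B <= cnt (class_reps a b (`|a| * B + `|b|)) (`|a| * B + `|b|) + C)%N.
Proof.
move=> a0 f0 fE; have [N0 NP] := poly_int_neq0 f0.
have sgz2 : sgz a * sgz a = 1 by case: sgzP a0 => // ->; rewrite eqxx.
have sa : sgz a != 0 by rewrite sgz_eq0.
have aE : a = sgz a * `|a|%N%:Z by rewrite -intEsg.
have fn0 n : (N0 <= n)%N -> [/\ c != 0, g.[n%:Z] != 0 & a * n%:Z + b != 0].
  move=> /NP; rewrite fE !hornerM hornerD hornerM !hornerC hornerX !mulf_eq0 !negb_or.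
  by move=> /andP[/andP[? /andP[? _]] ?].
have c0 : c != 0 by have [] := fn0 N0 (leqnn _).
pose N := (N0 + `|b| + 1)%N.
pose cls (q : nat) := square_class (c * sgz a * q%:Z).
have clsE (n q s : nat) : (N0 <= n)%N -> (0 < q)%N -> (0 < s)%N -> a * n%:Z + b = sgz a * (q * s ^ 2)%N%:Z ->
    square_class f.[n%:Z] = cls q.
  move=> n0 q0 s0 E; have [_ gn _] := fn0 n n0.
  have q1 : q%:Z != 0 by rewrite eqz_nat -lt0n.
  apply/square_class_eq; [exact: NP|by rewrite !mulf_neq0|].
  exists 1, (g.[n%:Z] * s%:Z); split; [by []|by rewrite mulf_neq0// eqz_nat -lt0n|].
  rewrite fE !hornerM hornerD hornerM !hornerC hornerX E PoszM -mulnn PoszM; ring.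
have sgnE (q : nat) : (sgz a * q%:Z = (sgn_residue a q)%:Z %[mod a])%Z := sgn_residueP a0 q.
have hE (n : nat) : a * n%:Z + b = sgz a * (`|a|%N%:Z * n%:Z + sgz a * b).
  by rewrite mulrDr !mulrA sgz2 mul1r -aE.
have A0 : (0 < `|a|)%N by rewrite absz_gt0.
have sb : (- `|b|%N%:Z <= sgz a * b <= `|b|%N%:Z) by clear -a0; case: sgzP a0; lia.
have modE (q m : nat) : (m%:Z ^+ 2 * (sgn_residue a q)%:Z == b %[mod a])%Z = (a %| sgz a * (q * m ^ 2)%N%:Z - b)%Z.
  rewrite -modzMmr -sgnE modzMmr eqz_mod_dvd; congr (a %| _ - b)%Z.
  by rewrite PoszM -mulnn PoszM; ring.
exists (N + (`|a| * N + `|b|))%N => B; set Y := (`|a| * B + `|b|)%N; split.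
- have H1 : (cnt (class_reps a b (`|a| * B - `|b|)) Y <= cnt (fun q => class_reps a b (`|a| * B - `|b|) q && (`|a| * N + `|b| < q)%N) Y + (`|a| * N + `|b|))%N.
    apply: leq_trans (leq_add (leqnn _) (@cnt_fin (fun q => q <= `|a| * N + `|b|)%N Y _ _)) => //.
    by apply: cnt_leU => q _ ->; case: leqP; rewrite ?orbT.
  apply: leq_trans H1 _; apply: (@leq_trans (image_size f B + (`|a| * N + `|b|))%N); last by rewrite leq_add2l leq_addl.
  rewrite leq_add2r.
  rewrite /image_size cntE -(size_map cls); apply: (@uniq_leq_size _ _ (enum_fset _)).
    rewrite map_inj_in_uniq ?filter_uniq ?iota_uniq// => q q'.
    rewrite !mem_filter => /andP[/andP[/and3P[/asboolP sq _ _] _] _] /andP[/andP[/and3P[/asboolP sq' _ _] _] _] E.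
    have q0 := sqfree_gt0 sq; have q'0 := sqfree_gt0 sq'.
    move/square_class_eq : E => [||s [t [s0 t0 E]]]; rewrite ?mulf_neq0// ?eqz_nat -?lt0n//.
    apply: (@sqfree_uniq `|s| `|t|); rewrite ?absz_gt0//.
    have : s ^+ 2 * q%:Z = t ^+ 2 * q'%:Z.
      by apply: (mulfI (mulf_neq0 c0 sa)); rewrite mulrCA E mulrCA.
    by move=> /(congr1 absz); rewrite !abszM !mulnn.
  move=> _ /mapP[q + ->]; rewrite mem_filter => /andP[/andP[/and3P[/asboolP sq w0 qZ] Cq] _].
  have /andP[_] := delta_witness_cond w0; set m := delta_witness _ _ _ in w0 qZ *.
  rewrite modE => /dvdzP[n' E]; have q0 := sqfree_gt0 sq.
  have E2 : (q * m ^ 2)%N%:Z = `|a|%N%:Z * n' + sgz a * b.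
    have -> : (q * m ^ 2)%N%:Z = sgz a * (sgz a * (q * m ^ 2)%N%:Z - b) + sgz a * b.
      by rewrite mulrBr mulrA sgz2 mul1r subrK.
    by rewrite E {2}aE; rewrite [n' * _]mulrCA !mulrA sgz2 mul1r mulrC.
  have qm : (q <= q * m ^ 2)%N by rewrite leq_pmulr// expn_gt0 w0.
  (* The lower bound comes from [q > |a| * N + |b|], the upper one from
     [q * m ^ 2 <= |a| * B - |b|]. *)
  have [n1 n2] : N%:Z < n' /\ n' <= B%:Z.
    move: qZ qm Cq E2 sb q0; move: (q * m ^ 2)%N (sgz a * b) => u v; clear -A0.
    by move: (`|a|%N) A0 => A A0 *; split; nia.
  case: n' n1 n2 E E2 => // n n1 n2 E E2.
  have nN : (N < n)%N by rewrite -ltz_nat.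
  rewrite -(@clsE n q m)//; last 2 first.
  - by rewrite (leq_trans _ (ltnW nN))// /N -addnA leq_addr.
  - by apply/eqP; rewrite -subr_eq0 -opprB oppr_eq0 opprD addrA addrAC E mulrC subrr.
  apply: in_imfset; by rewrite /= mem_iota add1n ltnS (leq_ltn_trans _ nN) -?lez_nat.
- rewrite addnC; apply: leq_trans (_ : N + cnt (class_reps a b Y) Y <= _)%N; last by rewrite -addnA leq_add2l leq_addl.
  rewrite /image_size cntE -[X in (X + _)%N](size_iota 0 N) -(size_map (fun n : nat => square_class f.[n%:Z])) -(size_map cls) -size_cat.
  apply: (@uniq_leq_size _ (enum_fset _)); first exact: fset_uniq.
  move=> x /imfsetP[n /= ni ->]; rewrite mem_cat.
  move: ni; rewrite mem_iota add1n ltnS => /andP[n0 nB].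
  have [nN|Nn] := ltnP n N; first by apply/orP; left; apply/mapP; exists n; rewrite ?mem_iota.
  apply/orP; right; pose w := `|a|%N%:Z * n%:Z + sgz a * b.
  have w0 : 0 < w.
    rewrite /w; move: sb Nn; rewrite /N; move: (sgz a * b) => v; clear -A0.
    by move: (`|a|%N) A0 => A A0 *; nia.
  have wY : (`|w| <= Y)%N.
    rewrite -lez_nat gtz0_abs// /w /Y; move: sb nB; move: (sgz a * b) => v; clear.
    by move: (`|a|%N) => A *; nia.
  have [|q [s [s0 sq wE]]] := @sqfree_decomp `|w|; first by rewrite absz_gt0 gt_eqF.
  have q0 := sqfree_gt0 sq.
  have E : a * n%:Z + b = sgz a * (q * s ^ 2)%N%:Z by rewrite hE -/w -wE gtz0_abs.
  rewrite (@clsE n q s)//; last by apply: leq_trans Nn; rewrite /N -addnA leq_addr.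
  have qs : (q <= q * s ^ 2)%N by rewrite leq_pmulr// expn_gt0 s0.
  apply: map_f; rewrite mem_filter mem_iota add1n ltnS q0 (leq_trans qs) -?wE// ?andbT.
  (* The square part [s] of the value is admissible, so the least witness is at most [s]. *)
  have dc : delta_cond a b (sgn_residue a q) s by rewrite /delta_cond s0 modE -E addrK dvdz_mulr.
  have /andP[d0 ds] := delta_witness_min dc; rewrite ?andbT; apply/and3P; split => //; first exact/asboolP.
  by apply: leq_trans wY; rewrite wE leq_mul2l leq_exp2r// ds orbT.
Qed.

(** * The theorem *)

Lemma image_size_le (f : {poly int}) B : (image_size f B <= B)%N.
Proof.
rewrite /image_size -[leqRHS](size_iota 1 B) -(size_map (fun n : nat => square_class f.[n%:Z])).
apply: (@uniq_leq_size _ (enum_fset _)); first exact: fset_uniq.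
by move=> x /imfsetP[n /= ni ->]; apply/mapP; exists n.
Qed.

Lemma asymp_le1 (R : realType) (u : nat -> nat) (k : R) : (forall B, u B <= B)%N ->
  asymp (fun B => (u B)%:R) k -> 0 <= k <= 1.
Proof.
move=> uB H; apply/andP; split; apply/ler_addgt0Pr => e e0; have [N HN] := H e e0.
  have := HN N.+1 (leqnSn N); rewrite ler_distl => /andP[_ U].
  have u0 : 0 <= (u N.+1)%:R :> R by [].
  have N0 : (0 : R) < N.+1%:R by rewrite ltr0n.
  by rewrite -(pmulr_lge0 _ N0) mulrDl; apply: le_trans U.
have := HN N.+1 (leqnSn N); rewrite ler_distl => /andP[L _].
have u1 : (u N.+1)%:R <= N.+1%:R :> R by rewrite ler_nat.
have N0 : (0 : R) < N.+1%:R by rewrite ltr0n.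
rewrite -(ler_pM2r N0) mulrDl mul1r -lerBlDr; exact: le_trans L u1.
Qed.

Lemma asymp_littleo (R : realType) (u : nat -> R) (k : R) : asymp u k ->
  u = (fun B : nat => k * B%:R) +o_\oo (fun B : nat => B%:R : R).
Proof.
move=> H; apply/eqaddoP => e e0; have [N HN] := H e e0; exists N => // B NB /=.
by rewrite (ger0_norm (ler0n R B)); exact: HN.
Qed.

(** Only the classes of 0 and of [c] times the constant [h] can occur. *)
Lemma image_size_deg0 (R : realType) (f : {poly int}) (c : int) (g h : {poly int}) :
  f = c%:P * g ^+ 2 * h -> (size h <= 1)%N -> asymp (fun B => (image_size f B)%:R : R) 0.
Proof.
move=> fE /size1_polyC hE e e0.
have le2 B : (image_size f B <= 2)%N.
  rewrite /image_size -[leqRHS]/(size [:: square_class 0; square_class (c * h`_0)]).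
  apply: (@uniq_leq_size _ (enum_fset _)); first exact: fset_uniq.
  move=> x /imfsetP[n _ ->]; rewrite !inE.
  have fnE : f.[n%:Z] = g.[n%:Z] ^+ 2 * (c * h`_0).
    by rewrite fE {1}hE !hornerM !hornerC; ring.
  have [->|fn0] := eqVneq f.[n%:Z] 0; first by rewrite eqxx.
  have := fn0; rewrite fnE mulf_eq0 negb_or expf_eq0 /= => /andP[gn ch].
  apply/orP; right; apply/eqP/square_class_eq => //; first by rewrite -fnE.
  by exists 1, g.[n%:Z]; split => //; rewrite mul1r.
exists (Num.truncn (2 / e)).+1 => B NB; rewrite mul0r subr0 ger0_norm//.
have : 2 / e < B%:R by rewrite (lt_le_trans (truncnS_gt _))// ler_nat.
rewrite ltr_pdivrMr// => H; apply: le_trans (_ : 2 <= _); first by rewrite ler_nat.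
by rewrite mulrC ltW.
Qed.

Lemma image_size_deg1 (R : realType) (f : {poly int}) (c : int) (g : {poly int}) (a b : int) :
  a != 0 -> coprime `|a| `|b| -> f != 0 -> f = c%:P * g ^+ 2 * (a%:P * 'X + b%:P) ->
  asymp (fun B => (image_size f B)%:R) (6 / pi ^+ 2 * (\sum_(0 <= r < `|a|%N) delta R a b r)
    * (\prod_(p <- primes `|a|%N) (1 - p%:R ^- 2)^-1) : R).
Proof.
move=> a0 cab f0 fE; have [C HC] := image_size_linear_bounds a0 f0 fE.
have A0 : (0 < `|a|)%N by rewrite absz_gt0.
have HZ := @cvg_inv_sq_sum_primes R _ A0.
set Z := _ * _ in HZ.
have -> : 6 / pi ^+ 2 * (\sum_(0 <= r < `|a|) delta R a b r) * (\prod_(p <- primes `|a|) (1 - p%:R ^- 2)^-1) =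
    Z^-1 * \sum_(0 <= r < `|a|) delta R a b r.
  by rewrite prodfV /Z !invfM invrK; ring.
apply: (@asymp_squeeze R _ (fun B => (cnt (class_reps a b (`|a| * B - `|b|)) (`|a| * B + `|b|))%:R)
  (fun B => (cnt (class_reps a b (`|a| * B + `|b|)) (`|a| * B + `|b|))%:R) _ C%:R).
- move=> B; have [L U] := HC B; rewrite lerBlDr -!natrD !ler_nat L U //.
- apply: (@cnt_class_reps_asymp a b a0 cab R Z _ _ `|b|) => // B; first by rewrite (leq_trans (leq_subr _ _))// leq_addr.
  by split; [rewrite (leq_trans (leq_subr _ _))// leq_addr|rewrite addnC -leq_subLR].
- by apply: (@cnt_class_reps_asymp a b a0 cab R Z _ _ `|b|) => // B; split; rewrite // -addnA leq_addr.
Qed.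

Lemma image_size_asymp1 (R : realType) (f : {poly int}) :
  (forall k, exists B0, forall B, (B0 <= B -> k * (B - image_size f B) <= B)%N) ->
  asymp (fun B => (image_size f B)%:R : R) 1.
Proof.
move=> H e e0; have [B0 HB] := H (Num.truncn e^-1).+1; exists B0 => B /HB.
rewrite -(ler_nat R) natrM natrB ?image_size_le// => HB'.
have u1 : (image_size f B)%:R <= B%:R :> R by rewrite ler_nat image_size_le.
rewrite mul1r ler0_norm ?subr_le0// opprB.
have k1 : 1 <= e * (Num.truncn e^-1).+1%:R.
  by rewrite -ler_pdivrMl// mulr1 ltW// truncnS_gt.
have : e * ((Num.truncn e^-1).+1%:R * (B%:R - (image_size f B)%:R)) <= e * B%:R by rewrite ler_wpM2l// ltW.
by apply: le_trans; rewrite mulrA -[leLHS]mul1r ler_wpM2r// subr_ge0.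
Qed.

(** The gcd of [a] and [b] divides the content. *)
Lemma primitive_linear_coprime (a b : int) : `|zcontents (a%:P * 'X + b%:P)|%N = 1%N -> coprime `|a| `|b|.
Proof.
move=> H; have : (gcdz a b %| zcontents (a%:P * 'X + b%:P))%Z.
  rewrite dvdz_contents; apply/polyOverP => i.
  rewrite coefD coefCM coefX coefC rpredD//.
    by case: (i == 1%N); rewrite ?mulr1 ?mulr0 ?rpred0// dvdz_gcdl.
  by case: (i == 0%N); rewrite ?rpred0// dvdz_gcdr.
by rewrite dvdzE H dvdn1 /gcdz.
Qed.

Lemma deg1_constant_rational (R : realType) (a b : int) : exists q : rat,
  6 / pi ^+ 2 * (\sum_(0 <= r < `|a|%N) delta R a b r) * (\prod_(p <- primes `|a|%N) (1 - p%:R ^- 2)^-1) =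
  1 / pi ^+ 2 * ratr q.
Proof.
exists (6 * (\sum_(0 <= r < `|a|%N) (delta_witness a b r)%:R ^- 2) * (\prod_(p <- primes `|a|%N) (1 - p%:R ^- 2)^-1)).
have -> : \sum_(0 <= r < `|a|%N) delta R a b r = ratr (\sum_(0 <= r < `|a|%N) (delta_witness a b r)%:R ^- 2).
  rewrite rmorph_sum /=; apply: eq_bigr => r _.
  by rewrite deltaE fmorphV rmorphXn /= rmorph_nat.
have -> : \prod_(p <- primes `|a|%N) (1 - p%:R ^- 2)^-1 = ratr (\prod_(p <- primes `|a|%N) (1 - p%:R ^- 2)^-1) :> R.
  rewrite rmorph_prod /=; apply: eq_bigr => p _.
  by rewrite fmorphV rmorphB /= rmorph1 fmorphV rmorphXn /= rmorph_nat.
by rewrite !rmorphM /= rmorph_nat; ring.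
Qed.

Theorem theorem3p7 (R : realType) (f : {poly int}) (c : int) (g h : {poly int})
    (f_neq0 : f != 0)
    (f_eq : f = c%:P * g ^+ 2 * h)
    (h_sqfree : squarefree_poly h)
    (h_prim : `|zcontents h|%N = 1%N)
    (abc : (3 < (size h).-1)%N -> abc_conjecture R) :
  exists cf : R,
    [/\ 0 <= cf <= 1,
        (fun B : nat => (image_size f B)%:R : R) =
          (fun B : nat => cf * B%:R) +o_\oo (fun B : nat => B%:R : R),
        ((size h).-1 = 0%N -> cf = 0),
        ((2 <= (size h).-1)%N -> cf = 1)
      & ((size h).-1 = 1%N ->
         forall a b : int, h = a%:P * 'X + b%:P ->
           cf = 6 / pi ^+ 2 * (\sum_(0 <= r < `|a|%N) delta R a b r)
                * (\prod_(p <- primes `|a|%N) (1 - p%:R ^- 2)^-1)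
           /\ exists q : rat, cf = 1 / pi ^+ 2 * ratr q)].
Proof.
suff [k Hk [k0 k2 k1]] : exists2 k : R, asymp (fun B => (image_size f B)%:R) k &
    [/\ ((size h).-1 = 0%N -> k = 0), ((2 <= (size h).-1)%N -> k = 1)
      & ((size h).-1 = 1%N ->
         forall a b : int, h = a%:P * 'X + b%:P ->
           k = 6 / pi ^+ 2 * (\sum_(0 <= r < `|a|%N) delta R a b r)
                * (\prod_(p <- primes `|a|%N) (1 - p%:R ^- 2)^-1))].
  exists k; split => //; first exact: asymp_le1 (image_size_le f) Hk.
    exact: asymp_littleo.
  move=> s1 a b hE; have E := k1 s1 a b hE; split=> //.
  by rewrite E; exact: deg1_constant_rational.
case: (ltngtP (size h).-1 1) => [s0|s2|s1].
- exists 0; last by split => //; move: s0; case: (_.-1).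
  by apply: image_size_deg0 f_eq _; move: s0; case: (size h) => [|[]].
- exists 1; last by split => // s; move: s2; rewrite s.
  apply: image_size_asymp1; exact: (@image_size_deg_ge2 R f c g h).
pose a := h`_1; pose b := h`_0.
have sh : size h = 2%N by move: s1; case: (size h) => [|n] //= ->.
have hE : h = a%:P * 'X + b%:P.
  apply/polyP => i; rewrite coefD coefCM coefX coefC; case: i => [|[|i]] /=.
  - by rewrite mulr0 add0r.
  - by rewrite mulr1 addr0.
  - by rewrite mulr0 addr0 nth_default// sh.
have a0 : a != 0 by have := lead_coef_eq0 h; rewrite lead_coefE sh -size_poly_eq0 sh => /negbT.
have cab : coprime `|a| `|b| by apply: primitive_linear_coprime; rewrite -hE.
have fE : f = c%:P * g ^+ 2 * (a%:P * 'X + b%:P) by rewrite -hE.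
eexists; first exact: (@image_size_deg1 R _ _ _ _ _ a0 cab f_neq0 fE).
split=> [|//|_ a' b' h'E]; first by rewrite s1.
have coefE i : h`_i = (a'%:P * 'X + b'%:P)`_i by rewrite h'E.
have -> : a' = a by rewrite /a coefE coefD coefCM coefX coefC /= mulr1 addr0.
by have -> : b' = b by rewrite /b coefE coefD coefCM coefX coefC /= mulr0 add0r.
Qed.
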